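(* Let $1\le p_0,p_1<\infty$, $0<\theta<1$ and $1\le q<\infty$. Let $W_0,W_1:\mathbb{R}^d\to M_n(\mathbb{C})$ be matrix weights and $|W_1W_0^{-1}|=UDU^{-1}$, where $U$ and $D$ are measurable, $U$ is unitary a.e. and $D=\mathrm{diag}(w_1,\dots,w_n)$ is diagonal a.e. If $p_0\le p_1$, then, for the real interpolation method, $$(L^{p_0}(W_0),L^{p_1}(W_1))_{\theta,q}=L(D;p_0;p_1;q;\theta)(U^{-1}W_0)$$ with equivalence of norms. In particular, if $\frac1q=\frac{1-\theta}{p_0}+\frac{\theta}{p_1}$ (for any $1\le p_0,p_1<\infty$), then $$(L^{p_0}(W_0),L^{p_1}(W_1))_{\theta,q}=L^q\big(|W_1W_0^{-1}|^\theta W_0\big)$$ with equivalence of norms.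
   Context: A matrix weight is a measurable $W:\mathbb{R}^d\to M_n(\mathbb{C})$ that is a.e. positive definite. For measurable a.e. invertible $W$ and a space $X$ of measurable $\mathbb{C}^n$-valued functions, $X(W)=\{f: Wf\in X\}$, $\|f\|_{X(W)}=\|Wf\|_X$; in particular $\|f\|_{L^p(W)}=(\int_{\mathbb{R}^d}|Wf|^p\,d\lambda)^{1/p}$, with $|\cdot|$ the Euclidean norm and $\lambda$ Lebesgue measure. The same notation $X(w)$ is used for scalar function spaces $X$ and positive measurable scalar functions $w$. For matrices $|A|=(A^*A)^{1/2}$. Couples are compatible through inclusion in the space of measurable functions. $(X_0,X_1)_{\theta,q}$ is the real interpolation space with norm $\big(\int_0^\infty(t^{-\theta}K(t,x))^q\frac{dt}{t}\big)^{1/q}$, $K(t,x)=\inf\{\|x_0\|_{X_0}+t\|x_1\|_{X_1}:x=x_0+x_1\}$. Let $\frac1{p_\theta}=\frac{1-\theta}{p_0}+\frac{\theta}{p_1}$. The space $L(D;p_0;p_1;q;\theta)$ for $D=\mathrm{diag}(w_j)_{j=1}^n$ is defined as follows. (a) If $p_0<p_1$: $L(D;p_0;p_1;q;\theta)=\bigoplus_{j=1}^nL^{p_\theta,q}\big(w_j^{-\frac{p_0p_1}{p_1-p_0}}d\lambda\big)\big(w_j^{\frac{p_1}{p_1-p_0}}\big)$, where $L^{p,q}(\eta\,d\lambda)$ is the scalar Lorentz space with respect to the measure $\eta\,d\lambda$, and the $j$-th summand consists of scalar $f$ with $w_j^{p_1/(p_1-p_0)}f$ in that Lorentz space. (b)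 If $p_0=p_1=p$: $L(D;p_0;p_1;q;\theta)=\bigoplus_{j=1}^nB^p_{\theta,q}(w_j)$, where $B^p_{\theta,q}(w)$ is the Beurling space: put $\gamma=\frac1p-\frac1q$ and let $\Omega(\theta,\gamma)$ be the set of $\varphi\ge0$ in $L^1((0,\infty),\frac{dt}{t})$ with norm $1$ such that $t^\theta\varphi(t)^\gamma$ is increasing. If $\gamma\le0$, $B^p_{\theta,q}(w)=\bigcup_{\varphi\in\Omega(\theta,\gamma)}L^p(w^\theta(\varphi\circ w)^\gamma)$ with $\|f\|=\inf_\varphi\|fw^\theta(\varphi\circ w)^\gamma\|_{L^p}$; if $\gamma\ge0$, $B^p_{\theta,q}(w)=\bigcap_{\varphi\in\Omega(\theta,\gamma)}L^p(w^\theta(\varphi\circ w)^\gamma)$ with $\|f\|=\sup_\varphi\|fw^\theta(\varphi\circ w)^\gamma\|_{L^p}$. The direct sums are finite direct sums of scalar function spaces, viewed as spaces of $\mathbb{C}^n$-valued functions via coordinates, with any of the usual equivalent direct sum norms. *)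

(* Defs.v *)
From HB Require Import structures.
From mathcomp Require Import all_boot all_order all_algebra.
From mathcomp Require Import sesquilinear spectral.
From mathcomp Require Import complex.
From mathcomp Require Import all_classical all_reals all_analysis.

Set Implicit Arguments.
Unset Strict Implicit.
Unset Printing Implicit Defensive.

Import Order.TTheory GRing.Theory Num.Theory.
Import numFieldNormedType.Exports.

Local Open Scope classical_set_scope.
Local Open Scope ring_scope.
Local Open Scope complex_scope.
Local Open Scope sesquilinear_scope.

Section lebesgue_Rd.
Context (R : realType).
Local Notation mR := (measurableTypeR R).

Definition cons_pair (d : nat) (z : mR * d.-tuple mR) : d.+1.-tuple mR :=
  [tuple of z.1 :: z.2].

Lemma measurable_cons_pair (d : nat) : measurable_fun setT (@cons_pair d).
Proof. by apply: measurable_cons; [exact: measurable_fst|exact: measurable_snd]. Qed.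

Section step.
Context (d : nat) (m : {measure set (d.-tuple mR) -> \bar R}).

Definition borel_lebesgue_step : set (d.+1.-tuple mR) -> \bar R :=
  pushforward (@lebesgue_measure R \x^ m)%E (@cons_pair d).

Let step0 : borel_lebesgue_step set0 = 0%E.
Proof. by rewrite /borel_lebesgue_step /pushforward preimage_set0 measure0. Qed.

Let step_ge0 A : (0 <= borel_lebesgue_step A)%E.
Proof. exact: integral_ge0. Qed.

Let step_sigma_additive : semi_sigma_additive borel_lebesgue_step.
Proof.
have mf := @measurable_cons_pair d.
move=> F mF tF mUF; rewrite /borel_lebesgue_step /pushforward preimage_bigcup.
apply: measure_semi_sigma_additive.
- by move=> n; rewrite -[X in measurable X]setTI; exact: mf.
- apply/trivIsetP => /= i j _ _ ij; rewrite -preimage_setI.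
  by move/trivIsetP : tF => /(_ _ _ _ _ ij) ->//; rewrite preimage_set0.
- by rewrite -preimage_bigcup -[X in measurable X]setTI; exact: mf.
Qed.

HB.instance Definition _ := isMeasure.Build _ _ _ borel_lebesgue_step
  step0 step_ge0 step_sigma_additive.

End step.

(* d-fold product of the one-dimensional Lebesgue measure, on Borel sets. *)
Fixpoint borel_lebesgue (d : nat) : {measure set (d.-tuple mR) -> \bar R} :=
  match d with
  | 0 => \d_([tuple] : 0.-tuple mR)
  | d'.+1 => borel_lebesgue_step (borel_lebesgue d')
  end.

(* R^d with its sigma-algebra of Lebesgue (not only Borel) measurable sets. *)
Definition Rd (d : nat) := caratheodory_type (mu_ext (borel_lebesgue d)).

Definition lebesgue_Rd (d : nat) : {measure set (Rd d) -> \bar R} :=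
  @completed_measure_extension _ _ _ (borel_lebesgue d).

End lebesgue_Rd.

Section complex_matrices.
Context (R : realType).
Local Notation C := R[i].

Definition cvnorm (n : nat) (v : 'cV[C]_n) : R :=
  Num.sqrt (\sum_(i < n) Normc.normc (v i ord0) ^+ 2).

Definition posdefmx (n : nat) (A : 'M[C]_n) : Prop :=
  A \is hermsymmx /\
  forall v : 'cV[C]_n, v != 0 -> 0 < (v^t* *m A *m v) ord0 ord0.

(* A `^ s for A Hermitian positive semidefinite, by the spectral theorem
   A = P^-1 diag(a) P with P unitary. *)
Definition mxpowR (n : nat) (A : 'M[C]_n) (s : R) : 'M[C]_n :=
  invmx (spectralmx A)
  *m diag_mx (map_mx (fun z : C => (complex.Re z `^ s)%:C) (spectral_diag A))
  *m spectralmx A.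

Definition mxabs (n : nat) (A : 'M[C]_n) : 'M[C]_n := mxpowR (A^t* *m A) 2^-1.

End complex_matrices.

(* fnorm is meaningful on fcarrier only. Functions are not quotiented by
   equality a.e.: over a complete measure, such as lebesgue_Rd, the carriers
   below are closed under it and the norms only depend on a.e. classes. *)

Record fspace (R : realType) (T V : Type) := FSpace {
  fcarrier : set (T -> V) ;
  fnorm : (T -> V) -> \bar R }.

Definition eq_fspace (R : realType) (T V : Type) (X Y : fspace R T V) : Prop :=
  fcarrier X = fcarrier Y /\
  exists c1 c2 : R, [/\ 0 < c1, 0 < c2 &
    forall f, fcarrier X f ->
      (c1%:E * fnorm Y f <= fnorm X f)%E /\ (fnorm X f <= c2%:E * fnorm Y f)%E].

Section function_spaces.
Context (R : realType) (disp : measure_display) (T : measurableType disp).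
Context (mu : {measure set T -> \bar R}).
Local Notation C := R[i].
Local Notation leb := (@lebesgue_measure R).

Definition measurable_cfun (f : T -> C) : Prop :=
  measurable_fun setT (fun x => complex.Re (f x)) /\
  measurable_fun setT (fun x => complex.Im (f x)).

Definition measurable_mxfun (m n : nat) (F : T -> 'M[C]_(m, n)) : Prop :=
  forall i j, measurable_cfun (fun x => F x i j).

Definition matrix_weight (n : nat) (W : T -> 'M[C]_n) : Prop :=
  measurable_mxfun W /\ {ae mu, forall x, posdefmx (W x)}.

Definition Lp (n : nat) (p : R) : fspace R T 'cV[C]_n :=
  let N f := Lnorm mu p%:E (fun x => (cvnorm (f x))%:E) in
  FSpace [set f | measurable_mxfun f /\ (N f < +oo)%E] N.

Definition weighted (n : nat) (X : fspace R T 'cV[C]_n) (W : T -> 'M[C]_n) :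
    fspace R T 'cV[C]_n :=
  FSpace [set f | measurable_mxfun f /\ fcarrier X (fun x => W x *m f x)]
         (fun f => fnorm X (fun x => W x *m f x)).

Section real_interpolation.
Context (n : nat) (X0 X1 : fspace R T 'cV[C]_n).

Definition decomposes (f f0 f1 : T -> 'cV[C]_n) : Prop :=
  [/\ fcarrier X0 f0, fcarrier X1 f1 & {ae mu, forall x, f x = f0 x + f1 x}].

Definition Kfun (t : R) (f : T -> 'cV[C]_n) : \bar R :=
  ereal_inf [set (fnorm X0 f01.1 + t%:E * fnorm X1 f01.2)%E |
             f01 in [set f01 | decomposes f f01.1 f01.2]].

Definition real_interp (theta q : R) : fspace R T 'cV[C]_n :=
  let N f := ((\int[leb]_(t in `]0%R, +oo[%classic)
                (((t `^ (- theta))%:E * Kfun t f) `^ q * (t^-1)%:E)) `^ q^-1)%E in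
  FSpace [set f | [/\ measurable_mxfun f, exists f0 f1, decomposes f f0 f1
                    & (N f < +oo)%E]] N.

End real_interpolation.

Definition density (w : T -> R) : set T -> \bar R :=
  fun A => (\int[mu]_(x in A) (w x)%:E)%E.

Definition rearrangement (nu : set T -> \bar R) (f : T -> C) (t : R) : \bar R :=
  ereal_inf [set s%:E | s in
    [set s : R | 0 <= s /\ (nu [set x | (s < Normc.normc (f x))%R] <= t%:E)%E]].

Definition Lorentz (nu : set T -> \bar R) (p q : R) : fspace R T C :=
  let N f := ((\int[leb]_(t in `]0%R, +oo[%classic)
                (((t `^ p^-1)%:E * rearrangement nu f t) `^ q * (t^-1)%:E))
              `^ q^-1)%E in
  FSpace [set f | measurable_cfun f /\ (N f < +oo)%E] N.

Definition scalar_weighted (X : fspace R T C) (w : T -> R) : fspace R T C :=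
  FSpace [set f | measurable_cfun f /\ fcarrier X (fun x => (w x)%:C * f x)]
         (fun f => fnorm X (fun x => (w x)%:C * f x)).

(* a ^ r for a >= 0, with 0 ^ r = +oo for r < 0 (the library has 0 `^ r = 0). *)
Definition xpowR (a r : R) : \bar R :=
  if (a == 0) && (r < 0) then +oo%E else (a `^ r)%:E.

Definition Omega_fun (theta gamma : R) (phi : R -> R) (t : R) : \bar R :=
  ((t `^ theta)%:E * xpowR (phi t) gamma)%E.

(* For gamma != 0 the monotonicity makes phi Borel, so that Borel measurability
   is no loss; for gamma = 0 Omega_fun does not depend on phi. *)
Definition Omega (theta gamma : R) : set (R -> R) :=
  [set phi : R -> R | [/\ measurable_fun (`]0, +oo[%classic : set R) phi,
      forall t, 0 < t -> 0 <= phi t,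
      (\int[leb]_(t in `]0%R, +oo[%classic) (phi t * t^-1)%:E = 1)%E
    & forall s t, 0 < s -> s <= t ->
        (Omega_fun theta gamma phi s <= Omega_fun theta gamma phi t)%E]].

(* The scalar L^p(v) for an extended-valued v >= 0; where v = +oo, finiteness
   of the norm forces f = 0, as 0 * +oo = 0. *)
Definition scalar_Lp (p : R) (v : T -> \bar R) : fspace R T C :=
  let N f := Lnorm mu p%:E (fun x => ((Normc.normc (f x))%:E * v x)%E) in
  FSpace [set f | measurable_cfun f /\ (N f < +oo)%E] N.

(* For gamma = 0 both branches give L^p(w ^ theta). *)
Definition Beurling (p theta q : R) (w : T -> R) : fspace R T C :=
  let gamma := p^-1 - q^-1 in
  let X phi := scalar_Lp p (fun x => Omega_fun theta gamma phi (w x)) in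
  if gamma <= 0 then
    FSpace [set f | exists2 phi, Omega theta gamma phi & fcarrier (X phi) f]
           (fun f => ereal_inf [set fnorm (X phi) f | phi in Omega theta gamma])
  else
    FSpace [set f | forall phi, Omega theta gamma phi -> fcarrier (X phi) f]
           (fun f => ereal_sup [set fnorm (X phi) f | phi in Omega theta gamma]).

Definition direct_sum (n : nat) (X : 'I_n -> fspace R T C) :
    fspace R T 'cV[C]_n :=
  FSpace [set f : T -> 'cV[C]_n | forall j, fcarrier (X j) (fun x => f x j ord0)]
         (fun f : T -> 'cV[C]_n => (\sum_(j < n) fnorm (X j) (fun x => f x j ord0))%E).

(* The weights w_j are the diagonal entries of D; in the theorem they are
   a.e. real and positive, so taking real parts loses nothing. *)
Definition LD (n : nat) (D : T -> 'M[C]_n) (p0 p1 q theta : R) :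
    fspace R T 'cV[C]_n :=
  let w j x := complex.Re (D x j j) in
  let ptheta := ((1 - theta) / p0 + theta / p1)^-1 in
  if p0 < p1 then
    direct_sum (fun j =>
      scalar_weighted
        (Lorentz (density (fun x => w j x `^ (- (p0 * p1 / (p1 - p0))))) ptheta q)
        (fun x => w j x `^ (p1 / (p1 - p0))))
  else direct_sum (fun j => Beurling p0 theta q (w j)).

End function_spaces.

(* Main.v *)
(** Put [g := U^-1 W0 f], so that [|W0 f| = |g|] and [|W1 f| = |D g|]. A decomposition of [g_j] may,
    up to a factor 2, be taken of the form [g_j 1_E + g_j 1_(~E)]; hence [K(t, f)] is comparable to the
    sum over [j] of [inf_E (int_E |g_j|^p0)^(1/p0) + t (int_(~E) (w_j |g_j|)^p1)^(1/p1)]. All the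
    integrals over [t] are replaced by sums over powers of two.

    For [p0 = p1 = p] the sets [{t w_j >= 1}] are optimal, and the interpolation norm becomes an
    [l^q] sum of the [L^p] norms of [w_j^theta g_j] over the dyadic level sets of [w_j]. By Hoelder's
    inequality with exponents [1/r] or [r], where [r = q/p], and its converse, this is a Beurling norm;
    the monotonicity required of [phi] is obtained by a geometric regularization of the extremal
    sequence.

    For [p0 < p1] put [F := w_j^(p1/(p1-p0)) |g_j|] and [kappa := w_j^(-p0 p1/(p1-p0))]. Then
    [|g_j|^p0 = F^p0 kappa] and [(w_j |g_j|)^p1 = F^p1 kappa], which reduces the claim to the
    interpolation of two [L^p] spaces over the measure [kappa d mu]: the sets [E] are superlevel sets
    of [F], and a discrete Young inequality bounds the resulting sums by the Lorentz norm.

    On the diagonal the Lorentz space is [L^(q,q) = L^q], and [F^q kappa = (w_j^theta |g_j|)^q]; the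
    case [p0 > p1] follows by exchanging the two spaces. *)

Require Import Defs.
From HB Require Import structures.
From mathcomp Require Import all_boot all_order all_algebra.
From mathcomp Require Import sesquilinear spectral.
From mathcomp Require Import complex finmap.
From mathcomp Require Import ring lra zify.
From mathcomp Require Import all_classical all_reals all_analysis.
From mathcomp Require Import measurable_realfun lebesgue_measure measurable_fun_approximation.

Set Implicit Arguments.
Unset Strict Implicit.
Unset Printing Implicit Defensive.

Import Order.TTheory GRing.Theory Num.Theory.
Import numFieldNormedType.Exports.

Local Open Scope classical_set_scope.
Local Open Scope ring_scope.

(** * Sums over the integers and powers of two *)

(** Every comparison holds with a constant fixed before the weight, the function and the coordinate,
    and for all measurable functions, infinite norms included. A single two-sided bound then yields
    both the equality of the spaces and the equivalence of the norms.

    This shapes the Beurling case q > p. Membership there says that each phi gives a finite norm,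
    with no common bound, so approaching the supremum is not enough: when the level sum diverges,
    one phi of infinite norm has to be exhibited. It comes from one summable sequence whose pairing
    with the levels diverges, turned into an admissible phi. That last step works because t^theta
    phi^gamma = (t^(theta/gamma) phi)^gamma: only the growth of phi relative to one power of t is
    constrained, and a one-sided geometric average enforces it at bounded cost.

    The matrix hypotheses hold only almost everywhere, whereas the scalar analysis works with
    weights positive at every point. The weights are corrected on a null set, and completeness of
    the measure preserves measurability. *)

Section zsum.
Context {R : realType}.
Local Open Scope ereal_scope.
Implicit Types (a b : int -> \bar R).

Definition zsum a : \bar R := \esum_(k in [set: int]) a k.

Lemma zsum_ge0 a : (forall k, 0 <= a k) -> 0 <= zsum a.
Proof. by move=> a0; apply: esum_ge0. Qed.

Lemma le_zsum a b : (forall k, a k <= b k) -> zsum a <= zsum b.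
Proof. by move=> ab; apply: le_esum. Qed.

Lemma eq_zsum a b : (forall k, a k = b k) -> zsum a = zsum b.
Proof. by move=> ab; apply: eq_esum. Qed.

Lemma zsumD a b : (forall k, 0 <= a k) -> (forall k, 0 <= b k) ->
  zsum (fun k => a k + b k) = zsum a + zsum b.
Proof. by move=> a0 b0; rewrite /zsum esumD. Qed.

Lemma zsum_sum (I : Type) (r : seq I) (f : I -> int -> \bar R) :
  (forall i k, 0 <= f i k) ->
  zsum (fun k => \sum_(i <- r) f i k) = \sum_(i <- r) zsum (f i).
Proof.
move=> f0; elim: r => [|i r IH].
  by under eq_zsum do rewrite big_nil; rewrite big_nil /zsum esum1.
under eq_zsum do rewrite big_cons.
by rewrite zsumD ?IH ?big_cons// => k; apply: sume_ge0.
Qed.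

Lemma zsum_ge_term a k : (forall k, 0 <= a k) -> a k <= zsum a.
Proof.
move=> a0; apply: esum_ge; exists [set k]; first by split.
by rewrite fsbig_set1.
Qed.

Lemma zsum_reindex (e : int -> int) a : bijective e ->
  zsum (fun k => a (e k)) = zsum a.
Proof.
by move=> be; rewrite /zsum [RHS](reindex_esum setT setT e) ?setTT_bijective.
Qed.

Lemma zsum_shift (m : int) a : zsum (fun k => a (k + m)%R) = zsum a.
Proof. by apply: (@zsum_reindex (fun k => k + m)%R); exists (fun k => k - m)%R => k /=; ring. Qed.

Lemma zsum_opp a : zsum (fun k => a (- k)%R) = zsum a.
Proof. by apply: (@zsum_reindex (fun k => - k)%R); exists (fun k => - k)%R => k /=; ring. Qed.

Lemma zsum_exchange (f : int -> int -> \bar R) : (forall k j, 0 <= f k j) ->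
  zsum (fun k => zsum (f k)) = zsum (fun j => zsum (fun k => f k j)).
Proof.
move=> f0; rewrite /zsum !esum_esum//.
rewrite (reindex_esum ([set: int] `*`` (fun=> [set: int]))
  ([set: int] `*`` (fun=> [set: int])) (fun p : int * int => (p.2, p.1)))//.
split => //; first by move=> [x y] [x' y'] _ _ [-> ->].
by move=> [x y] _; exists (y, x).
Qed.

Lemma zsumZl (c : \bar R) a : 0 <= c -> (forall k, 0 <= a k) ->
  zsum (fun k => c * a k) = c * zsum a.
Proof.
case: c => [c| |] c0 a0 //; last first.
  (* For infinite [c], the convention 0 * oo = 0 sets the zero sequence apart; any positive term
     makes both sides infinite. *)
  have [az|/existsNP[k ak]] := pselect (forall k, a k = 0).
    have z0 b : (forall k, b k = 0) -> zsum b = 0 by move=> bz; apply: esum1.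
    by rewrite (z0 a az) mule0 z0// => k; rewrite az mule0.
  have ak0 : 0 < a k by rewrite lt0e a0 andbT; exact/eqP.
  rewrite gt0_mulye; last exact: lt_le_trans ak0 (zsum_ge_term k a0).
  apply/eqP; rewrite -leye_eq.
  apply: le_trans (zsum_ge_term k _); first by rewrite gt0_mulye.
  by move=> j; apply: mule_ge0.
have [->|cn0] := eqVneq c 0%R.
  by rewrite mul0e /zsum esum1// => k _; rewrite mul0e.
rewrite /zsum /esum -ereal_sup_pZl; last by rewrite lt_neqAle eq_sym cn0.
congr ereal_sup; apply/seteqP; split => [_ [A [fA AT] <-]|_ [_ [A [fA AT] <-] <-]].
  exists (\sum_(x \in A) a x); first by exists A.
  by rewrite ge0_mule_fsumr.
by exists A => //; rewrite ge0_mule_fsumr.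
Qed.

Lemma zsumZr (c : \bar R) a : 0 <= c -> (forall k, 0 <= a k) ->
  zsum (fun k => a k * c) = zsum a * c.
Proof. by move=> *; rewrite muleC -zsumZl//; apply: eq_zsum => k; rewrite muleC. Qed.

(** Lists Z as 0, -1, 1, -2, 2, ... It turns [zsum] into an ordinary series, to which measurability
    of countable sums and monotone convergence apply. *)
Definition nat_to_int (n : nat) : int := if odd n then Negz n./2 else Posz n./2.

Lemma nat_to_int_bij : set_bij [set: nat] [set: int] nat_to_int.
Proof.
rewrite setTT_bijective.
exists (fun k => match k with Posz m => m.*2 | Negz m => m.*2.+1 end).
- move=> n; rewrite /nat_to_int; case: ifP => on; rewrite -[RHS]odd_double_half on//.
- move=> [m|m]; rewrite /nat_to_int /= odd_double /=; first by rewrite doubleK.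
  by rewrite uphalf_double.
Qed.

Lemma zsum_nneseries a : (forall k, 0 <= a k) ->
  zsum a = \sum_(n <oo) a (nat_to_int n).
Proof.
move=> a0; rewrite nneseries_esumT// /zsum.
by rewrite (reindex_esum _ _ _ _ nat_to_int_bij).
Qed.

Lemma zsum_gt_fset a (M : R) : M%:E < zsum a ->
  exists X : {fset int}, M%:E < \sum_(k <- X) a k.
Proof.
move=> /ereal_sup_gt[_ [A [fA _] <-]] h; exists (fset_set A).
by rewrite -fsbig_finite.
Qed.

End zsum.

Section powers_of_two.
Context {R : realType}.
Implicit Types x y : R.

(** With positive quantities written as powers of two with real exponents ([e2_surj]), inequalities
    between products of powers become linear inequalities between exponents. *)
Definition e2 x : R := 2 `^ x.

Lemma e2_gt0 x : 0 < e2 x. Proof. exact: powR_gt0. Qed.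
Lemma e2_ge0 x : 0 <= e2 x. Proof. exact: ltW (e2_gt0 x). Qed.
Lemma e2D x y : e2 (x + y) = e2 x * e2 y.
Proof. by rewrite /e2 powRD// pnatr_eq0 implybT. Qed.
Lemma e2N x : e2 (- x) = (e2 x)^-1. Proof. exact: powRN. Qed.
Lemma e20 : e2 0 = 1. Proof. exact: powRr0. Qed.
Lemma e2M x y : e2 x `^ y = e2 (x * y). Proof. by rewrite /e2 powRrM. Qed.
Lemma le_e2 x y : (e2 x <= e2 y) = (x <= y).
Proof.
apply/idP/idP => [|xy]; last by rewrite /e2 ler_powR// ler1n.
apply: contraTT; rewrite -!ltNge /e2 /powR => yx.
by rewrite !pnatr_eq0/= ltr_expR ltr_pM2r// ln_gt0// ltr1n.
Qed.
Lemma lt_e2 x y : (e2 x < e2 y) = (x < y).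
Proof. by rewrite !ltNge le_e2. Qed.
Lemma e2_ge1 x : 0 <= x -> 1 <= e2 x. Proof. by rewrite -e20 le_e2. Qed.
Lemma e2_le1 x : x <= 0 -> e2 x <= 1. Proof. by rewrite -e20 le_e2. Qed.
Lemma e2_lt1 x : x < 0 -> e2 x < 1. Proof. by rewrite -e20 lt_e2. Qed.
Lemma e2_surj y : 0 < y -> exists x, y = e2 x.
Proof.
move=> y0; exists (ln y / ln 2).
rewrite /e2 /powR pnatr_eq0 /= divfK ?lnK ?posrE//.
by rewrite gt_eqF// ln_gt0// ltr1n.
Qed.

End powers_of_two.

(** * Powers of extended nonnegative reals *)

Section poweR_tools.
Context {R : realType}.
Local Open Scope ereal_scope.
Implicit Types (x y : \bar R) (r : R).

Lemma le_poweR r x y : (0 <= r)%R -> 0 <= x -> x <= y -> x `^ r <= y `^ r.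
Proof.
move=> r0 x0 xy; apply: gt0_ler_poweR => //; rewrite in_itv/= leey andbT//.
exact: le_trans x0 xy.
Qed.

Lemma poweRK r x : r != 0%R -> 0 <= x -> (x `^ r) `^ r^-1 = x.
Proof. by move=> r0 x0; rewrite -poweRrM divff// poweRe1. Qed.

Lemma poweRVK r x : r != 0%R -> 0 <= x -> (x `^ r^-1) `^ r = x.
Proof. by move=> r0 x0; rewrite -poweRrM mulVf// poweRe1. Qed.

Lemma le_poweRV r x y : (0 < r)%R -> 0 <= x -> 0 <= y ->
  x `^ r <= y -> x <= y `^ r^-1.
Proof.
move=> r0 x0 y0 h; rewrite -(@poweRK r x) ?gt_eqF//.
by apply: le_poweR => //; [rewrite ltW// invr_gt0|exact: poweR_ge0].
Qed.

(** Each x_i is at most T^(1/r), with T the sum of the r-th powers; this treats r < 1 and r > 1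
    alike. The constant is built on n+1 rather than n so that it is positive for n = 0. *)
Lemma poweR_sum_le n r : (0 < r)%R ->
  exists2 C : R, (0 < C)%R & forall x : 'I_n -> \bar R, (forall i, 0 <= x i) ->
    (\sum_(i < n) x i) `^ r <= C%:E * \sum_(i < n) x i `^ r.
Proof.
move=> r0; exists ((n.+1%:R : R) `^ r)%R; first exact: powR_gt0.
move=> x x0; set T := (\sum_(i < n) x i `^ r).
have T0 : 0 <= T by apply: sume_ge0 => i _; exact: poweR_ge0.
have xT i : x i <= T `^ r^-1.
  apply: le_poweRV => //; rewrite /T (bigD1 i)//= leeDl//.
  by apply: sume_ge0 => j _; exact: poweR_ge0.
have -> : ((n.+1%:R : R) `^ r)%:E * T = (n.+1%:R%:E * T `^ r^-1) `^ r.
  by rewrite poweRM ?poweR_ge0// poweRVK// gt_eqF.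
apply: le_poweR; [exact: ltW|exact: sume_ge0|].
apply: (@le_trans _ _ (\sum_(i < n) T `^ r^-1)); first exact: lee_sum.
under eq_bigr do rewrite -[T `^ _]mul1e.
rewrite -ge0_sume_distrl// lee_wpmul2r ?poweR_ge0//.
by rewrite sumEFin sumr_const card_ord lee_fin ler_nat.
Qed.

Lemma poweRD_le r : (0 < r)%R ->
  exists2 C : R, (0 < C)%R & forall x y, 0 <= x -> 0 <= y ->
    (x + y) `^ r <= C%:E * (x `^ r + y `^ r).
Proof.
move=> r0; have [C C0 h] := poweR_sum_le 2 r0; exists C => // x y x0 y0.
have := h (fun i => if i == ord0 then x else y).
rewrite !big_ord_recl !big_ord0/= !adde0; apply.
by move=> i; case: ifP.
Qed.

Lemma powR_EFin_ge0 (a p : R) : 0 <= (a `^ p)%:E.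
Proof. by rewrite lee_fin powR_ge0. Qed.

End poweR_tools.

(** * Comparability of functionals up to a uniform constant *)

Section comparable_functionals.
Local Open Scope ereal_scope.
Context {R : realType}.

(** The constant precedes the argument, so packing weight, function and index into [F] expresses
    uniformity in all of them. As values may be infinite, A and B are finite at the same points of
    [P]. *)
Definition comparable_on (F : Type) (P : set F) (A B : F -> \bar R) :=
  exists2 M : R, (0 < M)%R & forall f, P f -> A f <= M%:E * B f /\ B f <= M%:E * A f.

Lemma comparable_on_sym F (P : set F) A B : comparable_on P A B -> comparable_on P B A.
Proof. by move=> [M M0 h]; exists M => // f /h[]. Qed.

Lemma comparable_on_trans F (P : set F) B A D :
  comparable_on P A B -> comparable_on P B D -> comparable_on P A D.
Proof.
move=> [M M0 h] [N N0 k]; exists (M * N)%R; first exact: mulr_gt0.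
move=> f Pf; have [h1 h2] := h f Pf; have [k1 k2] := k f Pf; split.
  apply: le_trans h1 _; rewrite EFinM -muleA; apply: lee_wpmul2l => //.
  by rewrite lee_fin ltW.
apply: le_trans k2 _; rewrite mulrC EFinM -muleA; apply: lee_wpmul2l => //.
by rewrite lee_fin ltW.
Qed.

Lemma comparable_on_le F (P : set F) (A B : F -> \bar R) M N : (0 < M)%R -> (0 < N)%R ->
  (forall f, P f -> [/\ 0 <= A f, 0 <= B f, A f <= M%:E * B f & B f <= N%:E * A f]) ->
  comparable_on P A B.
Proof.
move=> M0 N0 h; exists (M + N)%R; first exact: addr_gt0.
move=> f /h[A0 B0 AB BA]; split.
  by apply: le_trans AB _; apply: lee_wpmul2r => //; rewrite lee_fin lerDl ltW.
by apply: le_trans BA _; apply: lee_wpmul2r => //; rewrite lee_fin lerDr ltW.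
Qed.

Lemma comparable_on_comp F F' (e : F -> F') (P : set F) (P' : set F') (A B : F' -> \bar R) :
  (forall f, P f -> P' (e f)) -> comparable_on P' A B -> comparable_on P (A \o e) (B \o e).
Proof. by move=> Pe [M M0 h]; exists M => // f /Pe/h. Qed.

End comparable_functionals.

(** * Geometric sums and a discrete Young inequality *)

Section geometric_sums.
Context {R : realType}.
Local Open Scope ereal_scope.

(** The k-th integer in the enumeration has absolute value at least (k-1)/2, so its term is at most
    2^(s/2) r^k with r = 2^(-s/2). *)
Lemma two_sided_geometric (s : R) : (0 < s)%R ->
  exists2 C : R, (0 < C)%R & zsum (fun k => (e2 (- s * `|k%:~R|))%:E) <= C%:E.
Proof.
move=> s0; pose r := e2 (- (s / 2)).
have r0 : (0 < r)%R := e2_gt0 _.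
have r1 : (r < 1)%R by rewrite e2_lt1 ?oppr_lt0 ?divr_gt0.
have rn n : (r ^+ n)%R = e2 (- (s / 2) * n%:R).
  by rewrite -powR_mulrn ?e2M// ltW.
exists (e2 (s / 2) / (1 - r))%R; first by rewrite divr_gt0 ?e2_gt0// subr_gt0.
rewrite zsum_nneseries; last by move=> k; rewrite lee_fin e2_ge0.
apply: lime_le; first by apply: is_cvg_nneseries => n _ _; rewrite lee_fin e2_ge0.
apply: nearW => n.
apply: (@le_trans _ _ (\sum_(0 <= k < n) (e2 (s / 2) * r ^+ k)%R%:E)).
  apply: lee_sum => k _; rewrite lee_fin rn -e2D le_e2.
  have kb : (k%:R <= 2 * `|(nat_to_int k)%:~R| + 1 :> R)%R.
    have : (k <= 2 * `|nat_to_int k|%N + 1)%N.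
      by rewrite /nat_to_int; case: ifP => ok; rewrite -{1}(odd_double_half k) ok /=; lia.
    rewrite -(ler_nat R) natrD natrM => /le_trans; apply.
    by rewrite lerD2r ler_pM2l// -intr_norm natr_absz.
  nra.
rewrite sumEFin lee_fin -mulr_sumr; apply: ler_wpM2l; first exact: e2_ge0.
have -> : (\sum_(0 <= i < n) r ^+ i = (1 - r ^+ n) / (1 - r))%R.
  have r1' : (1 - r != 0)%R by rewrite subr_eq0 gt_eqF.
  elim: n => [|n IH]; first by rewrite big_geq// expr0 subrr mul0r.
  by rewrite big_nat_recr//= IH exprS; field.
rewrite -[leRHS]mul1r ler_pM2r ?invr_gt0 ?subr_gt0//.
by rewrite lerBlDr lerDl exprn_ge0// ltW.
Qed.

(** Two rounding conventions coexist: the strict lower bound here fits strict superlevel sets such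
    as {s < F}, the one of [e2_floor_le] fits the half-open intervals [dyadic]. *)
Lemma e2_floor_lt (al x : R) : (0 < al)%R -> (0 < x)%R ->
  exists k : int, (e2 (al * k%:~R) < x <= e2 (al * (k + 1)%:~R))%R.
Proof.
move=> a0 /e2_surj[y ->]; exists (Num.ceil (y / al) - 1)%R.
rewrite lt_e2 le_e2 subrK mulrC -ltr_pdivlMr// [in X in _ && X]mulrC -ler_pdivrMr//.
exact: ceil_itv.
Qed.

Lemma e2_floor_le (al x : R) : (0 < al)%R -> (0 < x)%R ->
  exists k : int, (e2 (al * k%:~R) <= x < e2 (al * (k + 1)%:~R))%R.
Proof.
move=> a0 /e2_surj[y ->]; exists (Num.floor (y / al)).
rewrite lt_e2 le_e2 mulrC -ler_pdivlMr// [in X in _ && X]mulrC -ltr_pdivrMr//.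
exact: floor_itv.
Qed.

(** An increasing geometric progression stopped at x is dominated by its last term, which is at most
    x^r. Together with [geometric_sum_ge] this replaces a power x^r by a sum over the thresholds
    below x, after which sums can be exchanged. *)
Lemma geometric_sum_le (al r : R) : (0 < al)%R -> (0 < r)%R ->
  exists2 C : R, (0 < C)%R & forall x : \bar R, 0 <= x ->
    zsum (fun k => if (e2 (al * k%:~R))%:E <= x then (e2 (al * k%:~R * r))%:E else 0)
    <= C%:E * x `^ r.
Proof.
move=> a0 r0; have [C C0 hC] := two_sided_geometric (mulr_gt0 a0 r0).
exists C => // -[x|_|//]; last by rewrite poweRyr ?gt_eqF// gt0_muley ?leey ?lte_fin.
rewrite lee_fin le_eqVlt => /predU1P[<-|x0].
  rewrite /zsum esum1 ?mule_ge0 ?poweR_ge0 ?lee_fin ?ltW// => k _.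
  by rewrite lee_fin leNgt e2_gt0.
have [m /andP[mx xm]] := e2_floor_le a0 x0.
apply: (@le_trans _ _ ((x `^ r)%:E * zsum (fun k => (e2 (- (al * r) * `|(k - m)%:~R|))%:E))).
  rewrite -zsumZl ?lee_fin ?powR_ge0//; last by move=> k; rewrite lee_fin e2_ge0.
  apply: le_zsum => k; rewrite lee_fin; case: ifPn => kx; last first.
    by rewrite -EFinM lee_fin mulr_ge0 ?powR_ge0 ?e2_ge0.
  have km : (k <= m)%R.
    have := le_lt_trans kx xm; rewrite lt_e2 ltr_pM2l// ltr_int; lia.
  rewrite -EFinM lee_fin.
  apply: (@le_trans _ _ (e2 (al * m%:~R) `^ r * e2 (- (al * r) * `|(k - m)%:~R|))%R).
    rewrite e2M -e2D le_e2 ler0_norm ?intrB; last by rewrite -intrB lerz0; lia.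
    by rewrite le_eqVlt; apply/orP; left; apply/eqP; ring.
  by apply: ler_wpM2r; rewrite ?e2_ge0// ge0_ler_powR ?nnegrE ?e2_ge0 ?(ltW r0) ?(ltW x0).
rewrite -/(x%:E `^ r) muleC lee_wpmul2r ?poweR_ge0//.
by rewrite (zsum_shift (- m) (fun k => (e2 (- (al * r) * `|k%:~R|))%:E)).
Qed.

(** For finite x the largest threshold below x suffices; for x = +oo the terms are unbounded. *)
Lemma geometric_sum_ge (al r : R) : (0 < al)%R -> (0 < r)%R ->
  exists2 C : R, (0 < C)%R & forall x : \bar R, 0 <= x ->
    x `^ r <= C%:E *
      zsum (fun k => if (e2 (al * k%:~R))%:E < x then (e2 (al * k%:~R * r))%:E else 0).
Proof.
move=> a0 r0; exists (e2 (al * r))%R; first exact: e2_gt0.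
have t0 x k : 0 <= if (e2 (al * k%:~R))%:E < x then (e2 (al * k%:~R * r))%:E else 0 :> \bar R.
  by case: ifP; rewrite ?lee_fin ?e2_ge0.
move=> -[x|_|//]; last first.
  rewrite (_ : zsum _ = +oo) ?gt0_muley ?leey ?lte_fin ?e2_gt0//.
  apply/eqyP => M /e2_surj[y ->].
  apply: le_trans (zsum_ge_term (Num.ceil (y / (al * r))) (t0 +oo)).
  rewrite ltry lee_fin le_e2 mulrAC mulrC -ler_pdivrMr ?mulr_gt0//.
  by have /andP[] := ceil_itv (y / (al * r)).
rewrite lee_fin le_eqVlt => /predU1P[<-|x0].
  by rewrite poweR0r ?gt_eqF// mule_ge0 ?zsum_ge0 ?lee_fin ?e2_ge0.
have [k /andP[kx xk]] := e2_floor_lt a0 x0.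
apply: (@le_trans _ _ ((e2 (al * r))%:E * (e2 (al * k%:~R * r))%:E)).
  rewrite -EFinM lee_fin -e2D.
  apply: (@le_trans _ _ (e2 (al * (k + 1)%:~R) `^ r)%R).
    by apply: ge0_ler_powR; rewrite ?nnegrE ?e2_ge0 ?(ltW x0) ?(ltW r0).
  by rewrite e2M intrD le_e2; rewrite le_eqVlt; apply/orP; left; apply/eqP; ring.
rewrite lee_wpmul2l ?lee_fin ?e2_ge0//.
by apply: le_trans (zsum_ge_term k (t0 x%:E)); rewrite lte_fin kx.
Qed.

(** Convolution with 2^(-s|j-k|) is bounded on l^r for every r > 0, including r < 1. The kernel is
    split into two equal factors w: one is absorbed by w x_j <= T_k^(1/r), where T_k is the sum over
    j of (w x_j)^r, the other is summed over j. The sum of the T_k is then computed by exchanging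
    the order. *)
Lemma zsum_young (s r : R) : (0 < s)%R -> (0 < r)%R ->
  exists2 C : R, (0 < C)%R & forall x : int -> \bar R, (forall j, 0 <= x j) ->
    zsum (fun k => (zsum (fun j => (e2 (- s * `|(j - k)%:~R|))%:E * x j)) `^ r)
    <= C%:E * zsum (fun j => x j `^ r).
Proof.
move=> s0 r0; have s20 : (0 < s / 2)%R by rewrite divr_gt0.
have [C1 C10 hC1] := two_sided_geometric s20.
have [C2 C20 hC2] := two_sided_geometric (mulr_gt0 s20 r0).
have rn0 : r != 0%R by rewrite gt_eqF.
have e0 t : 0 <= (e2 t)%:E :> \bar R by rewrite lee_fin e2_ge0.
exists (C1 `^ r * C2)%R; first by rewrite mulr_gt0// powR_gt0.
move=> x x0.
pose w j k := (e2 (- (s / 2) * `|(j - k)%:~R|) : R).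
pose T k := zsum (fun j => ((w j k)%:E * x j) `^ r).
have T0 k : 0 <= T k by apply: zsum_ge0 => j; exact: poweR_ge0.
have Tge j k : (w j k)%:E * x j <= T k `^ r^-1.
  apply: le_poweRV => //; first by apply: mule_ge0; [exact: e0|].
  by apply: (@zsum_ge_term _ (fun j => ((w j k)%:E * x j) `^ r)) => i; exact: poweR_ge0.
have step k : (zsum (fun j => (e2 (- s * `|(j - k)%:~R|))%:E * x j)) `^ r
    <= (C1 `^ r)%:E * T k.
  have -> : (C1 `^ r)%:E * T k = (C1%:E * T k `^ r^-1) `^ r.
    by rewrite poweRM ?poweR_ge0 ?lee_fin ?(ltW C10)// poweRVK.
  apply: le_poweR => //; [exact: ltW|by apply: zsum_ge0 => j; apply: mule_ge0|].
  apply: (@le_trans _ _ (zsum (fun j => (w j k)%:E * T k `^ r^-1))).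
    apply: le_zsum => j.
    have -> : (e2 (- s * `|(j - k)%:~R|))%:E = (w j k)%:E * (w j k)%:E :> \bar R.
      by rewrite -EFinM -e2D; congr (e2 _)%:E; field.
    by rewrite -muleA lee_wpmul2l// e0.
  rewrite zsumZr ?poweR_ge0//; last by move=> j; exact: e0.
  rewrite lee_wpmul2r ?poweR_ge0//; apply: le_trans hC1.
  by rewrite -(zsum_shift (- k) (fun j => (e2 (- (s / 2) * `|j%:~R|))%:E)).
apply: le_trans (le_zsum step) _.
rewrite zsumZl ?lee_fin ?powR_ge0// EFinM -muleA lee_wpmul2l ?lee_fin ?powR_ge0//.
rewrite /T zsum_exchange; last by move=> k j; exact: poweR_ge0.
rewrite -zsumZl ?lee_fin ?(ltW C20)//; last by move=> k; exact: poweR_ge0.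
apply: le_zsum => j.
have -> : zsum (fun k => ((w j k)%:E * x j) `^ r) = zsum (fun k => ((w j k) `^ r)%:E * x j `^ r).
  by apply: eq_zsum => k; rewrite poweRM// e0.
rewrite zsumZr ?poweR_ge0//; last by move=> k; rewrite lee_fin powR_ge0.
rewrite lee_wpmul2r ?poweR_ge0//; apply: le_trans hC2.
rewrite -(zsum_shift (- j) (fun k => (e2 (- (s / 2 * r) * `|k%:~R|))%:E)).
apply: le_zsum => k; rewrite lee_fin e2M le_e2 -normrN -intrN opprB.
by rewrite le_eqVlt; apply/orP; left; apply/eqP; ring.
Qed.

End geometric_sums.

(** * Discretization of integrals *)

Section integral_zsum.
Local Open Scope ereal_scope.
Context d (T : measurableType d) {R : realType} (mu : {measure set T -> \bar R}).

Lemma measurable_zsum (D : set T) (f : int -> T -> \bar R) :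
  (forall k x, 0 <= f k x) -> (forall k, measurable_fun D (f k)) ->
  measurable_fun D (fun x => zsum (fun k => f k x)).
Proof.
move=> f0 mf; under eq_fun do rewrite zsum_nneseries//.
by apply: ge0_emeasurable_sum => // k _; exact: mf.
Qed.

Lemma integral_zsum (D : set T) (f : int -> T -> \bar R) : measurable D ->
  (forall k x, 0 <= f k x) -> (forall k, measurable_fun D (f k)) ->
  \int[mu]_(x in D) zsum (fun k => f k x) = zsum (fun k => \int[mu]_(x in D) f k x).
Proof.
move=> mD f0 mf; under eq_integral do rewrite zsum_nneseries//.
rewrite integral_nneseries// zsum_nneseries// => k.
exact: integral_ge0.
Qed.

Lemma integral_zpartition (F : int -> set T) (D : set T) (f : T -> \bar R) :
  (forall k, measurable (F k)) -> D = \bigcup_k F k ->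
  measurable_fun D f -> (forall x, D x -> 0 <= f x) -> trivIset setT F ->
  \int[mu]_(x in D) f x = zsum (fun k => \int[mu]_(x in F k) f x).
Proof.
move=> mF DE mf f0 tF; have [nti1 nti2 nti3] := nat_to_int_bij.
have DE' : D = \bigcup_n (F \o nat_to_int) n.
  rewrite DE; apply/seteqP; split => x [k _ Fx]; last by exists (nat_to_int k).
  by have [n _ nk] := nti3 k I; exists n => //=; rewrite nk.
rewrite zsum_nneseries; last first.
  by move=> k; apply: integral_ge0 => x Fx; apply: f0; rewrite DE; exists k.
rewrite DE' in mf f0 *; rewrite ge0_integral_bigcup//.
  by move=> k; exact: mF.
by apply/trivIsetP => i j _ _ ij; move/trivIsetP: tF; apply => //; apply: contra_neq ij => /nti2; apply; rewrite inE.
Qed.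

End integral_zsum.

Section monotone_measurable.
Local Open Scope ereal_scope.
Context {R : realType}.

Definition monotone_pos (g : R -> \bar R) :=
  (forall s t, (0 < s)%R -> (s <= t)%R -> g s <= g t) \/
  (forall s t, (0 < s)%R -> (s <= t)%R -> g t <= g s).

(** Preimages of half-lines under a monotone function are intervals. *)
Lemma monotone_pos_measurable (g : R -> \bar R) : monotone_pos g ->
  measurable_fun (`]0%R, +oo[%classic : set R) g.
Proof.
move=> mg; apply: (measurability _ (ErealGenOInfty.measurableE R)) => // _ [_ [x ->] <-].
apply: is_interval_measurable => s t /=.
rewrite !in_itv/= !andbT => -[s0 gs] [t0 gt] u /andP[su ut].
rewrite !in_itv/= !andbT; have u0 : (0 < u)%R := lt_le_trans s0 su.
by split => //; case: mg => mg; [apply: lt_le_trans gs (mg _ _ _ _)|apply: lt_le_trans gt (mg _ _ _ _)].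
Qed.

End monotone_measurable.

Section discretization.
Local Open Scope ereal_scope.
Context {R : realType}.
Local Notation leb := (@lebesgue_measure R).

(** The step [al] is 1 for the K-functional and for level sets of weights, and [lor_exp] for
    rearrangements. *)
Definition dyadic (al : R) (k : int) : set R := `[e2 (al * k%:~R), e2 (al * (k + 1)%:~R)[%classic.

Lemma dyadic_lt (al : R) (k : int) : (0 < al)%R -> (e2 (al * k%:~R) < e2 (al * (k + 1)%:~R) :> R)%R.
Proof. by move=> a0; rewrite lt_e2 ltr_pM2l// ltr_int; lia. Qed.

Lemma dyadic_cover (al : R) : (0 < al)%R -> (`]0%R, +oo[%classic : set R) = \bigcup_k dyadic al k.
Proof.
move=> a0; apply/seteqP; split => [x|x [k _]] /=; rewrite in_itv/=.
  rewrite andbT => x0; have [k kx] := e2_floor_le a0 x0.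
  by exists k => //; rewrite /dyadic/= in_itv.
by move=> /andP[kx _]; rewrite andbT; exact: lt_le_trans (e2_gt0 _) kx.
Qed.

Lemma dyadic_trivIset (al : R) : (0 < al)%R -> trivIset setT (dyadic al).
Proof.
move=> a0; apply/trivIsetP => i j _ _.
wlog ij : i j / (i < j)%R.
  move=> h nij; have [ij|ji|/eqP] := ltgtP i j; [exact: h| |by rewrite (negbTE nij)].
  by rewrite setIC; apply: h => //; rewrite eq_sym.
move=> _; rewrite -subset0 => x []; rewrite /dyadic /= !in_itv/= => /andP[_ xi] /andP[jx _].
have := le_lt_trans jx xi; rewrite lt_e2 ltr_pM2l// ltr_int; lia.
Qed.

(** Only bounds h <= g <= H on the block enter, so that increasing and decreasing g are served by
    the same lemma. *)
Lemma discretize_block (al be q : R) : (0 < al)%R -> (0 < q)%R ->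
  exists2 C : R, (0 < C)%R & forall (g : R -> \bar R) (h H : \bar R) (k : int),
   0 <= h -> measurable_fun (dyadic al k) g ->
   (forall t, dyadic al k t -> h <= g t <= H) ->
   (((e2 (al * k%:~R * be))%:E * h) `^ q <=
    C%:E * \int[leb]_(t in dyadic al k) (((t `^ be)%:E * g t) `^ q * (t^-1)%:E)) /\
   (\int[leb]_(t in dyadic al k) (((t `^ be)%:E * g t) `^ q * (t^-1)%:E) <=
    C%:E * ((e2 (al * k%:~R * be))%:E * H) `^ q).
Proof.
(* On a block, t^be stays within the factor [hi] of its value at the left end, and the dt/t-mass of
   the block lies between l 2^(-al) and l; these give the lower constant [c1] and the upper constant
   [c2]. *)
move=> a0 q0; pose hi := e2 (al * `|be|) : R.
pose l := (e2 al - 1)%R; have l0 : (0 < l)%R.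
  by rewrite subr_gt0; have := a0; rewrite -(@lt_e2 R) e20.
pose c1 := (l * (e2 al)^-1 * (hi^-1) `^ q)%R; pose c2 := (l * hi `^ q)%R.
have hi0 : (0 < hi)%R := e2_gt0 _.
have c10 : (0 < c1)%R by rewrite /c1 !mulr_gt0 ?powR_gt0 ?invr_gt0 ?e2_gt0.
have c20 : (0 < c2)%R by rewrite /c2 mulr_gt0 ?powR_gt0.
exists (c1^-1 + c2)%R; first by rewrite addr_gt0 ?invr_gt0.
move=> g h H k h0 mg hgH.
have mI : measurable (dyadic al k) by exact: measurable_itv.
have pt0 t : dyadic al k t -> (0 < t)%R.
  by rewrite /dyadic/= in_itv/= => /andP[+ _]; exact: lt_le_trans (e2_gt0 _).
have lenI : leb (dyadic al k) = (l * e2 (al * k%:~R))%R%:E.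
  rewrite lebesgue_measure_itv/= lte_fin dyadic_lt// -EFinD; congr EFin.
  by rewrite /l intrD mulrDr mulr1 e2D; ring.
have intc (c : \bar R) : \int[leb]_(t in dyadic al k) c = c * (l * e2 (al * k%:~R))%R%:E.
  by rewrite integral_cst//; congr (_ * _); exact: lenI.
have H0 : 0 <= H.
  have [/andP[hg gH]] : h <= g (e2 (al * k%:~R)) <= H.
    by apply: hgH; rewrite /dyadic/= in_itv/= lexx dyadic_lt.
  exact: le_trans h0 (le_trans hg gH).
have tb t : dyadic al k t -> (hi^-1 * e2 (al * k%:~R * be) <= t `^ be <= hi * e2 (al * k%:~R * be))%R.
  move=> It; have [y ty] := e2_surj (pt0 _ It); move: It.
  rewrite /dyadic/= in_itv/= ty le_e2 lt_e2 intrD mulrDr mulr1 => /andP[ky yk].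
  rewrite -e2N -!e2D e2M !le_e2.
  have [b0|b0] := leP 0%R be.
    by rewrite (ger0_norm b0); nra.
  by rewrite (ltr0_norm b0); nra.
have gm : measurable_fun (dyadic al k) (fun t => ((t `^ be)%:E * g t) `^ q * (t^-1)%:E).
  apply: emeasurable_funM.
    apply: (measurableT_comp (measurable_poweR q)).
    apply: emeasurable_funM => //; apply/measurable_EFinP.
    by apply: measurable_funTS; exact: measurable_powR.
  apply/measurable_EFinP; apply: (eq_measurable_fun (fun t : R => (t `^ (-1))%R)).
    by move=> t /[!inE] /pt0 t0; rewrite powR_inv1// ltW.
  by apply: measurable_funTS; exact: measurable_powR.
have g0 t : dyadic al k t -> 0 <= ((t `^ be)%:E * g t) `^ q * (t^-1)%:E.
  by move=> It; rewrite mule_ge0 ?poweR_ge0// lee_fin invr_ge0 ltW// pt0.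
have e2p x : 0 <= (e2 x)%:E :> \bar R by rewrite lee_fin e2_ge0.
split.
  rewrite -(@lee_pmul2l _ c1%:E) ?lte_fin//.
  apply: (@le_trans _ _ (\int[leb]_(t in dyadic al k) (((t `^ be)%:E * g t) `^ q * (t^-1)%:E))); last first.
    rewrite muleA -EFinM mulrDr mulfV ?gt_eqF// -[leLHS]mul1e.
    rewrite lee_wpmul2r ?integral_ge0// lee_fin lerDl mulr_ge0 ?ltW//.
  pose c := ((hi^-1 * e2 (al * k%:~R * be))%:E * h) `^ q * (e2 (al * (k + 1)%:~R))^-1%:E.
  have -> : c1%:E * ((e2 (al * k%:~R * be))%:E * h) `^ q = \int[leb]_(t in dyadic al k) c.
    rewrite intc /c [(hi^-1 * _)%:E]EFinM -[_ * _ * h]muleA [((hi^-1)%:E * _) `^ q]poweRM ?mule_ge0 ?lee_fin ?invr_ge0 ?e2_ge0 ?(ltW hi0)//.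
    set Q := (_ * h) `^ q; rewrite poweR_EFin [LHS]muleC [_ * Q in RHS]muleC -!muleA -!EFinM; congr (_ * _%:E).
    rewrite /c1 intrD mulrDr mulr1 e2D; field; rewrite !gt_eqF ?e2_gt0//.
  apply: ge0_le_integral => //.
  - move=> t It; rewrite /c mule_ge0 ?poweR_ge0// lee_fin invr_ge0 e2_ge0//.
  - move=> t It; rewrite /c; have /andP[t1 t2] := tb t It; have /andP[ht _] := hgH t It.
    apply: lee_pmul; rewrite ?poweR_ge0 ?lee_fin ?invr_ge0 ?e2_ge0//.
      apply: le_poweR; rewrite ?(ltW q0)//.
        by rewrite mule_ge0 // lee_fin mulr_ge0 ?invr_ge0 ?e2_ge0 ?(ltW hi0).
      by apply: lee_pmul; rewrite ?lee_fin ?mulr_ge0 ?invr_ge0 ?e2_ge0 ?(ltW hi0).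
    rewrite lef_pV2 ?posrE ?e2_gt0 ?pt0//.
    by move: It; rewrite /dyadic /= in_itv/= => /andP[_ /ltW].
apply: (@le_trans _ _ (c2%:E * ((e2 (al * k%:~R * be))%:E * H) `^ q)); last first.
  by rewrite lee_wpmul2r ?poweR_ge0// lee_fin lerDr invr_ge0 ltW.
pose c := ((hi * e2 (al * k%:~R * be))%:E * H) `^ q * (e2 (al * k%:~R))^-1%:E.
have -> : c2%:E * ((e2 (al * k%:~R * be))%:E * H) `^ q = \int[leb]_(t in dyadic al k) c.
  rewrite intc /c [(hi * _)%:E]EFinM -[_ * _ * H]muleA [(hi%:E * _) `^ q]poweRM ?mule_ge0 ?lee_fin ?e2_ge0 ?(ltW hi0)//.
  set Q := (_ * H) `^ q; rewrite poweR_EFin [LHS]muleC [_ * Q in RHS]muleC -!muleA -!EFinM; congr (_ * _%:E).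
  by rewrite /c2; field; rewrite gt_eqF ?e2_gt0.
apply: ge0_le_integral => //.
move=> t It; rewrite /c; have /andP[t1 t2] := tb t It; have /andP[ht gt] := hgH t It.
have gt0 : 0 <= g t by exact: le_trans h0 ht.
apply: lee_pmul; rewrite ?poweR_ge0 ?lee_fin ?invr_ge0 ?(ltW (pt0 _ It))//.
  apply: le_poweR; rewrite ?(ltW q0)//; first by rewrite mule_ge0// lee_fin powR_ge0.
  by apply: lee_pmul; rewrite ?lee_fin ?powR_ge0.
rewrite lef_pV2 ?posrE ?e2_gt0 ?pt0//.
by move: It; rewrite /dyadic /= in_itv/= => /andP[].
Qed.

(** On each block a monotone g lies between its values at the two ends. Sampling at the other end
    shifts the index by one, which changes t^be by at most 2^(al |be|), hence the factor [D] after
    the power q. *)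
Lemma discretize (al be q : R) : (0 < al)%R -> (0 < q)%R ->
  exists2 C : R, (0 < C)%R & forall g : R -> \bar R,
   (forall t, (0 < t)%R -> 0 <= g t) -> monotone_pos g ->
   (zsum (fun k => ((e2 (al * k%:~R * be))%:E * g (e2 (al * k%:~R))) `^ q) <=
    C%:E * \int[leb]_(t in `]0%R, +oo[) (((t `^ be)%:E * g t) `^ q * (t^-1)%:E)) /\
   (\int[leb]_(t in `]0%R, +oo[) (((t `^ be)%:E * g t) `^ q * (t^-1)%:E) <=
    C%:E * zsum (fun k => ((e2 (al * k%:~R * be))%:E * g (e2 (al * k%:~R))) `^ q)).
Proof.
move=> a0 q0; have [C C0 hC] := discretize_block be a0 q0.
pose D := (e2 (al * `|be|) `^ q : R)%R.
have D1 : (1 <= D)%R.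
  by rewrite /D e2M e2_ge1// !mulr_ge0// ltW.
exists (C * D)%R; first by rewrite mulr_gt0// (lt_le_trans ltr01).
move=> g g0 mg; have gm := monotone_pos_measurable mg.
set F := fun t : R => ((t `^ be)%:E * g t) `^ q * (t^-1)%:E.
pose x k := ((e2 (al * k%:~R * be))%:E * g (e2 (al * k%:~R))) `^ q.
have x0 k : 0 <= x k by exact: poweR_ge0.
have sub k : dyadic al k `<=` (`]0%R, +oo[%classic : set R).
  by move=> t tk; rewrite (dyadic_cover a0); exists k.
have F0 t : (`]0%R, +oo[%classic : set R) t -> 0 <= F t.
  by rewrite /= in_itv/= andbT => t0; rewrite mule_ge0 ?poweR_ge0// lee_fin invr_ge0 ltW.
have FE : \int[leb]_(t in `]0%R, +oo[) F t = zsum (fun k => \int[leb]_(t in dyadic al k) F t).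
  apply: integral_zpartition => //.
  - by move=> k; exact: measurable_itv.
  - exact: dyadic_cover.
  - apply: emeasurable_funM.
      apply: (measurableT_comp (measurable_poweR q)).
      apply: emeasurable_funM => //; apply/measurable_EFinP.
      by apply: measurable_funTS; exact: measurable_powR.
    apply/measurable_EFinP; apply: (eq_measurable_fun (fun t : R => (t `^ (-1))%R)).
      by move=> t /[!inE] /=; rewrite in_itv/= andbT => t0; rewrite powR_inv1// ltW.
    by apply: measurable_funTS; exact: measurable_powR.
  - exact: dyadic_trivIset.
have int0 k : 0 <= \int[leb]_(t in dyadic al k) F t.
  by apply: integral_ge0 => t /sub /F0.
pose S := zsum x.
have shift1 k (u v : int) : (`|u - v| <= 1)%R ->
   ((e2 (al * u%:~R * be))%:E * g (e2 (al * k%:~R))) `^ q <=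
   D%:E * ((e2 (al * v%:~R * be))%:E * g (e2 (al * k%:~R))) `^ q.
  move=> uv; rewrite (_ : D%:E = (e2 (al * `|be|))%:E `^ q)// -poweRM ?mule_ge0 ?lee_fin ?e2_ge0 ?g0 ?e2_gt0//.
  apply: le_poweR; rewrite ?(ltW q0) ?mule_ge0 ?lee_fin ?e2_ge0 ?g0 ?e2_gt0//.
  rewrite muleA -EFinM lee_wpmul2r ?g0 ?e2_gt0// lee_fin -e2D le_e2.
  have : (`|u%:~R - v%:~R| <= 1 :> R)%R by rewrite -intrB -intr_norm (ler_int _ _ 1).
  move=> /(ler_wpM2l (ltW a0)) /(ler_wpM2r (normr_ge0 be)).
  rewrite mulr1 -lerBlDr -mulrBl -mulrBr; apply: le_trans.
  by apply: le_trans (ler_norm _) _; rewrite !normrM (ger0_norm (ltW a0)).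
have CDC : (C <= C * D)%R by rewrite ler_peMr// ltW.
(* The shifts [m] and [m'] point to the ends where g is smallest and largest: 0 and 1 for increasing
   g, 1 and 0 for decreasing g. *)
have [m [m' [m1 m1' mm]]] : exists m m' : int, [/\ (`|m| <= 1)%R, (`|m'| <= 1)%R &
    forall k t, dyadic al k t ->
      g (e2 (al * (k + m)%:~R)) <= g t <= g (e2 (al * (k + m')%:~R))].
  case: mg => mg; [exists 0%R, 1%R|exists 1%R, 0%R]; split=> // k t kt.
    have t0 : (0 < t)%R by have := sub _ _ kt; rewrite /= in_itv/= andbT.
    move: kt; rewrite /dyadic/= in_itv/= => /andP[kt tk].
    by rewrite addr0 !mg ?e2_gt0// ltW.
  have t0 : (0 < t)%R by have := sub _ _ kt; rewrite /= in_itv/= andbT.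
  move: kt; rewrite /dyadic/= in_itv/= => /andP[kt tk].
  by rewrite addr0 !mg ?e2_gt0// ltW.
have blk k := hC g _ _ k (g0 _ (e2_gt0 _)) (measurable_funS (@measurable_itv _ _) (@sub k) gm) (mm k).
have CD0 : 0 <= (C * D)%:E by rewrite lee_fin (le_trans (ltW C0)).
rewrite -/F -/S FE -!zsumZl//; split.
  rewrite /S -(zsum_shift m); apply: le_zsum => k.
  apply: le_trans (@shift1 _ _ k _) _; first by rewrite addrAC subrr add0r.
  rewrite (mulrC C D) EFinM -muleA lee_wpmul2l ?lee_fin ?(le_trans ler01 D1)//.
  by have [+ _] := blk k.
rewrite -[leRHS](zsum_shift m'); apply: le_zsum => k.
have [_ bk] := blk k.
pose y := ((e2 (al * k%:~R * be))%:E * g (e2 (al * (k + m')%:~R))) `^ q.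
suff yx : C%:E * y <= (C * D)%:E * x (k + m')%R by exact: le_trans bk yx.
rewrite EFinM -muleA lee_wpmul2l ?lee_fin ?(ltW C0)//.
by apply: shift1; rewrite opprD addrA subrr add0r normrN.
Qed.

End discretization.

(** * The K-functional over sets *)

#[local] Hint Resolve powR_EFin_ge0 : core.

Definition admissible d (T : measurableType d) (R : realType) (w a : T -> R) :=
  [/\ measurable_fun setT w, measurable_fun setT a,
  forall x, (0 < w x)%R & forall x, (0 <= a x)%R].

Definition admissible_pairs d (T : measurableType d) (R : realType) : set ((T -> R) * (T -> R)) :=
  [set wa | admissible wa.1 wa.2].

Section set_K_functional.
Local Open Scope ereal_scope.
Context d (T : measurableType d) {R : realType} (mu : {measure set T -> \bar R}).
Implicit Types (a w : T -> R) (E : set T) (p t : R).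

Definition Ipow p E a : \bar R := \int[mu]_(x in E) (a x `^ p)%:E.

Definition Kset p0 p1 w a t : \bar R :=
  ereal_inf [set Ipow p0 E a `^ p0^-1 + t%:E * Ipow p1 (~` E) (fun x => w x * a x)%R `^ p1^-1
            | E in (measurable : set (set T))].

(** A discretized interpolation norm raised to the power q, with the K-functional restricted to
    splittings along a set. *)
Definition Ksum p0 p1 theta q w a : \bar R :=
  zsum (fun k => ((e2 (k%:~R * - theta))%:E * Kset p0 p1 w a (e2 k%:~R)) `^ q).

Lemma Ipow_ge0 p E a : 0 <= Ipow p E a.
Proof. by apply: integral_ge0 => x _; rewrite lee_fin powR_ge0. Qed.

Lemma Kset_ge0 p0 p1 w a t : (0 <= t)%R -> 0 <= Kset p0 p1 w a t.
Proof.
move=> t0; apply: le_ereal_inf_tmp => _ [E _ <-].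
by rewrite adde_ge0 ?mule_ge0 ?poweR_ge0 ?lee_fin.
Qed.

Lemma Kset_le p0 p1 w a t E : measurable E ->
  Kset p0 p1 w a t <= Ipow p0 E a `^ p0^-1
                      + t%:E * Ipow p1 (~` E) (fun x => w x * a x)%R `^ p1^-1.
Proof. by move=> mE; apply: ereal_inf_lbound; exists E. Qed.

Lemma Kset_ge p0 p1 w a t M :
  (forall E, measurable E -> M <= Ipow p0 E a `^ p0^-1
                      + t%:E * Ipow p1 (~` E) (fun x => w x * a x)%R `^ p1^-1) ->
  M <= Kset p0 p1 w a t.
Proof. by move=> h; apply: le_ereal_inf_tmp => _ [E mE <-]; exact: h. Qed.

Lemma measurable_powR_EFin p (D : set T) a : measurable_fun setT a ->
  measurable_fun D (fun x => (a x `^ p)%:E).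
Proof.
move=> ma; apply/measurable_EFinP.
by apply: (measurableT_comp (measurable_powR p)); apply: measurable_funTS.
Qed.

Definition wlevel w (k : int) : set T := w @^-1` dyadic 1 k.

Section levels.
Context w (mw : measurable_fun setT w) (w0 : forall x, (0 < w x)%R).

Lemma wlevelE k x : wlevel w k x = (e2 k%:~R <= w x < e2 (k + 1)%:~R)%R :> Prop.
Proof. by rewrite /wlevel /dyadic /= in_itv/= !mul1r. Qed.

Lemma measurable_wlevel k : measurable (wlevel w k).
Proof. by rewrite -[wlevel _ _]setTI; apply: mw => //; exact: measurable_itv. Qed.

Lemma wlevel_cover : [set: T] = \bigcup_k wlevel w k.
Proof.
apply/seteqP; split => // x _.
have [k _ kx] : (\bigcup_k dyadic 1 k) (w x).
  by rewrite -dyadic_cover//= in_itv/= w0.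
by exists k.
Qed.

Lemma wlevel_trivIset : trivIset setT (wlevel w).
Proof.
apply/trivIsetP => i j _ _ ij; rewrite /wlevel -preimage_setI.
by move/trivIsetP : (dyadic_trivIset (@ltr01 R)) => ->//; rewrite preimage_set0.
Qed.

Lemma integral_wlevel E (f : T -> \bar R) : measurable E ->
  measurable_fun E f -> (forall x, E x -> 0 <= f x) ->
  \int[mu]_(x in E) f x = zsum (fun k => \int[mu]_(x in E `&` wlevel w k) f x).
Proof.
move=> mE mf f0; apply: integral_zpartition => //.
- by move=> k; apply: measurableI => //; exact: measurable_wlevel.
- by rewrite -setI_bigcupr -wlevel_cover setIT.
- by apply: trivIset_setIl; exact: wlevel_trivIset.
Qed.

Lemma integral_wlevel_le E (f g : T -> \bar R) (c : int -> R) : measurable E ->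
  measurable_fun setT f -> measurable_fun setT g ->
  (forall x, 0 <= f x) -> (forall x, 0 <= g x) -> (forall k, 0 <= c k)%R ->
  (forall k x, E x -> wlevel w k x -> f x <= (c k)%:E * g x) ->
  \int[mu]_(x in E) f x <= zsum (fun k => (c k)%:E * \int[mu]_(x in wlevel w k) g x).
Proof.
move=> mE mf mg f0 g0 c0 fg; rewrite integral_wlevel//; last exact: measurable_funTS.
apply: le_zsum => k; have mk := measurable_wlevel k.
rewrite -ge0_integralZl ?lee_fin//; last exact: measurable_funTS.
apply: (@le_trans _ _ (\int[mu]_(x in E `&` wlevel w k) ((c k)%:E * g x))).
  apply: ge0_le_integral => //; first exact: measurableI.
  - exact: measurable_funTS.
  - by apply: measurable_funeM; exact: measurable_funTS.
  - by move=> x [Ex kx]; exact: fg.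
apply: ge0_subset_integral => //; first exact: measurableI.
- by apply: measurable_funeM; exact: measurable_funTS.
- by move=> x _; rewrite mule_ge0 ?lee_fin.
Qed.

End levels.

(** Since w is about 2^k on the level set, this is comparable to the integral of (w^theta a)^p over
    it. *)
Definition Blevel p theta w a (k : int) : \bar R :=
  (e2 (k%:~R * theta * p))%:E * Ipow p (wlevel w k) a.

Lemma Blevel_ge0 p theta w a k : 0 <= Blevel p theta w a k.
Proof. by rewrite mule_ge0 ?lee_fin ?e2_ge0 ?Ipow_ge0. Qed.

(** At t = 2^(-k) one has t w >= 1 on the k-th level. Whatever E is, the parts of the level inside
    and outside E each have integral at most the p-th power of the cost of E, whence the factor
    2. *)
Lemma Blevel_le_Kset p theta w a k : (1 <= p)%R ->
  measurable_fun setT w -> measurable_fun setT a ->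
  (forall x, 0 < w x)%R -> (forall x, 0 <= a x)%R ->
  Blevel p theta w a k <=
    2%:E * ((e2 (k%:~R * theta))%:E * Kset p p w a (e2 (- k)%:~R)) `^ p.
Proof.
move=> p1 mw ma w0 a0; have p0 : (0 < p)%R := lt_le_trans ltr01 p1.
have pn0 : p != 0%R by rewrite gt_eqF.
have mk := measurable_wlevel mw k.
set A := Ipow p (wlevel w k) a; have A0 : 0 <= A := Ipow_ge0 _ _ _.
have mwa : measurable_fun setT (fun x => w x * a x)%R by exact: measurable_funM.
suff h : 2^-1%:E * A <= Kset p p w a (e2 (- k)%:~R) `^ p.
  rewrite poweRM ?lee_fin ?e2_ge0 ?Kset_ge0 ?e2_ge0// poweR_EFin e2M muleA -EFinM.
  rewrite [(2 * _)%R]mulrC EFinM /Blevel -/A -muleA.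
  apply: lee_wpmul2l; first by rewrite lee_fin e2_ge0.
  by rewrite -(@lee_pmul2l _ 2^-1%:E)// muleA -EFinM mulVf// mul1e.
rewrite -[leLHS](@poweRVK _ p) ?mule_ge0 ?lee_fin//.
apply: le_poweR; rewrite ?poweR_ge0 ?(ltW p0)//.
apply: Kset_ge => E mE; set X := Ipow p E a; set Y := Ipow p (~` E) _.
set v := _ + _; have X0 : 0 <= X := Ipow_ge0 _ _ _; have Y0 : 0 <= Y := Ipow_ge0 _ _ _.
have Y10 : 0 <= (e2 (- k)%:~R)%:E * Y `^ p^-1 by rewrite mule_ge0 ?poweR_ge0 ?lee_fin ?e2_ge0.
have X10 : 0 <= X `^ p^-1 by exact: poweR_ge0.
have v0 : 0 <= v by exact: adde_ge0.
rewrite -[leRHS](@poweRK _ p)//; apply: le_poweR; rewrite ?invr_ge0 ?(ltW p0) ?mule_ge0 ?lee_fin//.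
rewrite -(@lee_pmul2l _ 2%:E)// muleA -EFinM mulfV// mul1e.
have -> : 2%:E * v `^ p = v `^ p + v `^ p by rewrite -[2%R]/(1 + 1)%R EFinD ge0_muleDl// mul1e.
have -> : A = \int[mu]_(x in wlevel w k `&` E) (a x `^ p)%:E +
              \int[mu]_(x in wlevel w k `&` ~` E) (a x `^ p)%:E.
  rewrite /A /Ipow -{1}[wlevel w k](setUIDK _ E) setDE ge0_integral_setU//.
  - exact: measurableI.
  - by apply: measurableI => //; exact: measurableC.
  - exact: measurable_powR_EFin.
  - by apply/disj_set2P; rewrite -subset0 => x [[_ Ex] [_ nEx]].
apply: leeD.
  apply: (@le_trans _ _ X).
    apply: ge0_subset_integral => //; first exact: measurableI.
    exact: measurable_powR_EFin.
  rewrite -[leLHS](@poweRVK _ p)//; apply: le_poweR; rewrite ?(ltW p0)//.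
  by rewrite /v leeDl.
apply: (@le_trans _ _ ((e2 (- k)%:~R `^ p)%:E * Y)); last first.
  rewrite -[Y in leLHS](@poweRVK _ p)// -poweR_EFin -poweRM ?lee_fin ?e2_ge0 ?poweR_ge0//.
  by apply: le_poweR; rewrite ?(ltW p0)// /v leeDr.
rewrite -ge0_integralZl ?lee_fin ?powR_ge0//; last 2 first.
- exact: measurableC.
- exact: measurable_powR_EFin.
apply: (@le_trans _ _ (\int[mu]_(x in wlevel w k `&` ~` E)
   ((e2 (- k)%:~R `^ p)%:E * ((w x * a x) `^ p)%:E))).
  apply: ge0_le_integral => //.
  - by apply: measurableI => //; exact: measurableC.
  - exact: measurable_powR_EFin.
  - by apply: measurable_funeM; exact: measurable_powR_EFin.
  move=> x [+ _]; rewrite wlevelE => /andP[kx _].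
  rewrite -EFinM lee_fin -powRM ?e2_ge0 ?mulr_ge0 ?(ltW (w0 _))//.
  apply: ge0_ler_powR; rewrite ?nnegrE ?mulr_ge0 ?e2_ge0 ?(ltW (w0 _)) ?(ltW p0)//.
  rewrite mulrA -[leLHS]mul1r ler_wpM2r// intrN e2N mulrC ler_pdivlMr ?e2_gt0//.
  by rewrite mul1r.
apply: ge0_subset_integral => //.
- by apply: measurableI => //; exact: measurableC.
- exact: measurableC.
- by apply: measurable_funeM; exact: measurable_powR_EFin.
- by move=> x _; rewrite -EFinM lee_fin mulr_ge0 ?powR_ge0.
Qed.

Lemma Ksum_same_ge p theta q : (1 <= p)%R -> (0 < q)%R ->
  exists2 C : R, (0 < C)%R & forall w a,
    measurable_fun setT w -> measurable_fun setT a ->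
    (forall x, 0 < w x)%R -> (forall x, 0 <= a x)%R ->
    zsum (fun k => Blevel p theta w a k `^ (q / p)) <= C%:E * Ksum p p theta q w a.
Proof.
move=> p1 q0; have p0 : (0 < p)%R := lt_le_trans ltr01 p1.
exists (2 `^ (q / p))%R; first exact: powR_gt0.
move=> w a mw ma w0 a0.
rewrite -zsumZl ?lee_fin ?powR_ge0//; last by move=> k; exact: poweR_ge0.
(* Level k is matched with the time 2^(-k), so one of the two sums is reflected. *)
rewrite -[leRHS]zsum_opp; apply: le_zsum => k.
rewrite intrN mulrNN.
apply: le_trans (le_poweR _ (Blevel_ge0 _ _ _ _ _) (Blevel_le_Kset theta k p1 mw ma w0 a0)) _.
  by rewrite divr_ge0// ltW.
rewrite poweRM ?poweR_ge0// -[in leLHS]poweRrM (mulrC p) divfK ?gt_eqF//.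
by rewrite intrN.
Qed.

Lemma Ksum_same_le p theta q : (1 <= p)%R -> (0 < q)%R -> (0 < theta < 1)%R ->
  exists2 C : R, (0 < C)%R & forall w a,
    measurable_fun setT w -> measurable_fun setT a ->
    (forall x, 0 < w x)%R -> (forall x, 0 <= a x)%R ->
    Ksum p p theta q w a <= C%:E * zsum (fun k => Blevel p theta w a k `^ (q / p)).
Proof.
move=> p1 q0 /andP[th0 th1]; have p0 : (0 < p)%R := lt_le_trans ltr01 p1.
have pn0 : p != 0%R by rewrite gt_eqF.
(* With E = {w >= 2^k} at t = 2^(-k), level j contributes its [Blevel] times 2^(-theta p (j-k)) for
   j >= k and, up to a constant, times 2^(-(1-theta) p (k-j)) for j < k. Both decay at least at rate
   s. *)
pose s := (Num.min theta (1 - theta) * p)%R.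
have s0 : (0 < s)%R by rewrite mulr_gt0// lt_min th0 subr_gt0.
have [C C0 hC] := zsum_young s0 (divr_gt0 q0 p0).
exists (3 `^ q * C)%R; first by rewrite mulr_gt0// powR_gt0.
move=> w a mw ma w0 a0; have mwa : measurable_fun setT (fun x => w x * a x)%R by exact: measurable_funM.
have B0 := Blevel_ge0 p theta w a.
rewrite EFinM -muleA; apply: le_trans (lee_wpmul2l _ (hC _ B0)); last by rewrite lee_fin powR_ge0.
rewrite -[leLHS]zsum_opp -zsumZl ?lee_fin ?powR_ge0//; last by move=> k; exact: poweR_ge0.
apply: le_zsum => k; set Z := zsum _; rewrite intrN mulrNN.
have Z0 : 0 <= Z by apply: zsum_ge0 => j; rewrite mule_ge0// lee_fin e2_ge0.
rewrite (mulrC q) poweRrM (_ : (3 `^ q)%:E = 3%:E `^ q :> \bar R)// -[X in _ <= X]poweRM ?poweR_ge0//.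
apply: le_poweR; rewrite ?(ltW q0)//.
  by rewrite mule_ge0 ?Kset_ge0 ?lee_fin ?e2_ge0.
pose E := [set x | (e2 k%:~R <= w x)%R].
have mE : measurable E.
  rewrite -[E]setTI (_ : E = w @^-1` `[e2 k%:~R, +oo[); first by apply: mw => //; exact: measurable_itv.
  by apply/seteqP; split => x; rewrite /E /= in_itv/= andbT.
apply: (@le_trans _ _ ((e2 (k%:~R * theta))%:E * _)).
  by apply: lee_wpmul2l; [rewrite lee_fin e2_ge0|exact: Kset_le mE].
rewrite ge0_muleDr ?poweR_ge0 ?mule_ge0 ?poweR_ge0 ?lee_fin ?e2_ge0//.
(* One unit for the part on E, two for the part off E, where w is only known to be below 2^(j+1) on
   level j. *)
have -> : (3%:E * Z `^ p^-1 = Z `^ p^-1 + 2%:E * Z `^ p^-1).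
  by rewrite -[3%R]/(1 + 2)%R EFinD ge0_muleDl// mul1e.
have e2p x : 0 <= (e2 x)%:E :> \bar R by rewrite lee_fin e2_ge0.
have root (x : R) X : 0 <= X -> (e2 x)%:E * X `^ p^-1 = ((e2 (x * p))%:E * X) `^ p^-1.
  by move=> X0; rewrite poweRM// poweR_EFin e2M mulfK.
apply: leeD.
  rewrite root ?Ipow_ge0//.
  apply: le_poweR; rewrite ?invr_ge0 ?(ltW p0) ?mule_ge0 ?Ipow_ge0//.
  have := integral_wlevel_le mw w0 (c := fun j => if (k <= j)%R then 1%R else 0%R) mE
    (measurable_powR_EFin p ma) (measurable_powR_EFin p ma).
  move=> h.
  apply: (@le_trans _ _ ((e2 (k%:~R * theta * p))%:E *
     zsum (fun j => (if (k <= j)%R then 1%R else 0%R)%:E * Ipow p (wlevel w j) a))).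
    apply: lee_wpmul2l => //; apply: h => [//|//|j|j x].
    - by case: ifP.
    rewrite /E/= wlevelE => kx /andP[jx xj].
    have -> : (k <= j)%R by have := le_lt_trans kx xj; rewrite lt_e2 ltr_int ltzD1.
    by rewrite mul1e.
  rewrite -zsumZl//; last by move=> j; rewrite mule_ge0 ?Ipow_ge0// lee_fin; case: ifP.
  apply: le_zsum => j; rewrite muleA /Blevel [leRHS]muleA lee_wpmul2r ?Ipow_ge0//.
  rewrite -!EFinM lee_fin -e2D; case: ifPn => kj; last by rewrite mulr0 e2_ge0.
  rewrite mulr1 le_e2 ger0_norm; last by rewrite ler0z; lia.
  rewrite intrB; have kj' : (k%:~R <= j%:~R :> R)%R by rewrite ler_int.
  have sp : (s <= theta * p)%R by rewrite ler_wpM2r ?(ltW p0)// ge_min lexx.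
  nra.
rewrite muleA -EFinM -e2D !root ?Ipow_ge0//.
rewrite (_ : 2%:E * _ = ((2 `^ p)%:E * Z) `^ p^-1); last first.
  by rewrite poweRM ?lee_fin ?powR_ge0// poweR_EFin -powRrM mulfV// powRr1.
apply: le_poweR; rewrite ?invr_ge0 ?(ltW p0) ?mule_ge0 ?Ipow_ge0//.
pose c j : R := if (j < k)%R then e2 ((j%:~R + 1) * p) else 0%R.
have c0 j : (0 <= c j)%R by rewrite /c; case: ifP; rewrite ?e2_ge0.
apply: (@le_trans _ _ ((e2 ((k%:~R * theta - k%:~R) * p))%:E *
   zsum (fun j => (c j)%:E * Ipow p (wlevel w j) a))).
  apply: lee_wpmul2l => //.
  apply: integral_wlevel_le => //.
  - exact: measurableC.
  - exact: measurable_powR_EFin.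
  - exact: measurable_powR_EFin.
  move=> j x; rewrite /E/= wlevelE => /negP; rewrite -ltNge => xk /andP[jx xj].
  rewrite /c (_ : (j < k)%R); last by have := le_lt_trans jx xk; rewrite lt_e2 ltr_int.
  rewrite -EFinM lee_fin -e2M -powRM ?e2_ge0//.
  apply: ge0_ler_powR; rewrite ?nnegrE ?mulr_ge0 ?e2_ge0 ?(ltW (w0 _)) ?(ltW p0)//.
  by rewrite ler_wpM2r// ltW// -[1%R]/(1%:~R) -intrD.
rewrite -zsumZl//; last by move=> j; rewrite mule_ge0 ?Ipow_ge0// lee_fin.
rewrite -zsumZl//; last by move=> j; rewrite mule_ge0// lee_fin e2_ge0.
apply: le_zsum => j; rewrite muleA /Blevel !muleA lee_wpmul2r ?Ipow_ge0//.
rewrite -!EFinM lee_fin /c; case: ifPn => kj; last by rewrite mulr0 !mulr_ge0 ?e2_ge0 ?powR_ge0.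
rewrite -[(2 `^ p)%R]/(e2 p) -!e2D le_e2 ltr0_norm; last by rewrite ltrz0; lia.
rewrite intrB; have kj' : (j%:~R <= k%:~R :> R)%R by rewrite ler_int ltW.
have sp : (s <= (1 - theta) * p)%R by rewrite ler_wpM2r ?(ltW p0)// ge_min lexx orbT.
nra.
Qed.

Lemma Ksum_same p theta q : (1 <= p)%R -> (0 < q)%R -> (0 < theta < 1)%R ->
  comparable_on (@admissible_pairs d T R) (fun wa => Ksum p p theta q wa.1 wa.2)
    (fun wa => zsum (fun k => Blevel p theta wa.1 wa.2 k `^ (q / p))).
Proof.
move=> p1 q0 th01; have [M M0 hM] := Ksum_same_le p1 q0 th01.
have [N N0 hN] := Ksum_same_ge theta p1 q0.
apply: (comparable_on_le M0 N0) => -[w a] [mw ma w0 a0]; split.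
- by apply: zsum_ge0 => k; exact: poweR_ge0.
- by apply: zsum_ge0 => k; exact: poweR_ge0.
- exact: hM.
- exact: hN.
Qed.

End set_K_functional.

(** * Hoelder's inequality for sequences and its converse *)

Section sequences.
Local Open Scope ereal_scope.
Context {R : realType}.

(** Both x and y are at most x + y, and the exponents add up to 1. *)
Lemma poweR_mul_le (s : R) (x : \bar R) (y : R) : (0 < s < 1)%R -> 0 <= x -> (0 <= y)%R ->
  x `^ s * (y `^ (1 - s))%:E <= x + y%:E.
Proof.
move=> /andP[s0 s1] x0 y0; have s10 : (0 < 1 - s)%R by rewrite subr_gt0.
case: x x0 => [x| |] //; last by move=> _; rewrite addye// leey.
rewrite lee_fin => x0; rewrite poweR_EFin -EFinM -EFinD lee_fin.
have xy0 : (0 <= x + y)%R by exact: addr_ge0.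
have [xy|xyn0] := eqVneq (x + y)%R 0%R.
  have /andP[/eqP-> _] : ((x == 0) && (y == 0))%R by rewrite -paddr_eq0// xy.
  by rewrite powR0 ?gt_eqF// mul0r addr_ge0.
apply: (@le_trans _ _ ((x + y) `^ s * (x + y) `^ (1 - s))%R).
  have h t (z : R) : (0 <= t)%R -> (0 <= z)%R -> (z <= x + y)%R -> (z `^ t <= (x + y) `^ t)%R.
    by move=> t0 z0 zxy; apply: ge0_ler_powR.
  by apply: ler_pM; rewrite ?powR_ge0// h ?(ltW s0) ?(ltW s10) ?lerDl ?lerDr.
by rewrite -powRD ?xyn0 ?implybT// (_ : s + (1 - s) = 1)%R ?powRr1//; ring.
Qed.

Lemma zsum_eq0 (x : int -> \bar R) : (forall k, 0 <= x k) -> zsum x = 0 -> forall k, x k = 0.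
Proof.
move=> x0 X0 k; apply/eqP; rewrite eq_le x0 andbT -X0.
exact: (zsum_ge_term k x0).
Qed.

Lemma zsum0 (x : int -> \bar R) : (forall k, x k = 0) -> zsum x = 0.
Proof. by move=> x0; apply: esum1. Qed.

(** Hoelder's inequality with exponents 1/s and 1/(1-s): divide x by its sum and apply the pointwise
    inequality to each term. The constant 1 + Y replaces the sharp Y^(1-s). *)
Lemma zsum_holder (s Y : R) (x : int -> \bar R) (y : int -> R) : (0 < s < 1)%R ->
  (forall k, 0 <= x k) -> (forall k, 0 <= y k)%R -> zsum (fun k => (y k)%:E) <= Y%:E ->
  zsum (fun k => x k `^ s * (y k `^ (1 - s))%:E) <= (1 + Y)%:E * zsum x `^ s.
Proof.
move=> s01 x0 y0 yY; have /andP[s0 s1] := s01.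
have Y0 : (0 <= Y)%R.
  by rewrite -lee_fin; apply: le_trans yY; apply: zsum_ge0 => k; rewrite lee_fin.
have Y10 : (0 < 1 + Y)%R by rewrite ltr_wpDr.
have X0 := zsum_ge0 x0; move XE : (zsum x) X0 => X X0.
case: X XE X0 => [X| |//] XE; last first.
  by move=> _; rewrite poweRyr ?gt_eqF// gt0_muley ?lte_fin// leey.
rewrite lee_fin le_eqVlt => /predU1P[X0|X0].
  rewrite -X0 in XE; rewrite zsum0 => [|k].
    by apply: mule_ge0; rewrite ?poweR_ge0// lee_fin ltW.
  by rewrite (zsum_eq0 x0 XE) poweR0r ?gt_eqF// mul0e.
apply: (@le_trans _ _ (zsum (fun k => (X `^ s)%:E * (X^-1%:E * x k + (y k)%:E)))).
  apply: le_zsum => k.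
  rewrite (_ : x k `^ s = (X `^ s)%:E * (X^-1%:E * x k) `^ s).
    rewrite -muleA; apply: lee_wpmul2l; first by rewrite lee_fin powR_ge0.
    apply: poweR_mul_le => //.
    by rewrite mule_ge0// lee_fin invr_ge0 ltW.
  rewrite -poweR_EFin -poweRM ?lee_fin ?(ltW X0)//; last by rewrite mule_ge0// lee_fin invr_ge0 ltW.
  by rewrite muleA -EFinM divff ?gt_eqF// mul1e.
have t0 k : 0 <= X^-1%:E * x k by rewrite mule_ge0// lee_fin invr_ge0 ltW.
rewrite zsumZl//; last by move=> k; rewrite adde_ge0// lee_fin.
rewrite zsumD// zsumZl ?lee_fin ?invr_ge0 ?(ltW X0)// XE -EFinM mulVf ?gt_eqF//.
by rewrite muleC -poweR_EFin lee_wpmul2r ?poweR_ge0// EFinD leeD2l.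
Qed.

Lemma zsum_fset (X : {fset int}) (y : int -> \bar R) : (forall k, 0 <= y k) ->
  zsum (fun k => if k \in X then y k else 0) = \sum_(k <- X) y k.
Proof.
move=> y0; transitivity (\sum_(k \in [set` X]) y k); last first.
  by rewrite fsbig_finite ?set_fsetK//; exact: finite_fset.
rewrite -esum_fset //.
rewrite [RHS]esum_mkcond; apply: eq_esum => k _.
by congr (if _ then _ else _); apply/idP/idP; rewrite inE.
Qed.

(* Failure of the dual of Hoelder's inequality would be uniform: a gliding hump
   glues finitely supported almost-extremals into a single sequence. *)
Lemma gliding_hump (r : R) (B : int -> \bar R) : (1 < r)%R -> (forall k, 0 <= B k) ->
  zsum (fun k => B k `^ r) = +oo ->
  exists e : int -> \bar R, [/\ forall k, 0 <= e k, 0 < zsum e, zsum e < +oo &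
    zsum (fun k => e k `^ (1 - r^-1) * B k) = +oo].
Proof.
move=> r1 B0 BS; have r0 : (0 < r)%R := lt_trans ltr01 r1.
have rn0 : r != 0%R by rewrite gt_eqF.
pose sg := (1 - r^-1)%R.
have sg0 : (0 < sg)%R by rewrite subr_gt0 invf_lt1.
(* An infinite term is detected by the unit mass at its index. *)
have [[k Bk]|/forallNP Bf] := pselect (exists k, B k = +oo).
  have dE : zsum (fun j => if j \in [fset k]%fset then 1 else 0 :> \bar R) = 1.
    by rewrite zsum_fset// big_seq_fset1.
  exists (fun j => if j \in [fset k]%fset then 1 else 0); split.
  - by move=> j; case: ifP.
  - by rewrite dE.
  - by rewrite dE ltry.
  apply/eqP; rewrite -leye_eq; apply: le_trans (zsum_ge_term k _) => /=.
    by rewrite inE eqxx poweR1r mul1e Bk.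
  by move=> j; rewrite mule_ge0 ?poweR_ge0.
pose b k := fine (B k).
have bE k : B k = (b k)%:E.
  by rewrite /b fineK// ge0_fin_numE// ltey; apply/eqP/Bf.
have b0 k : (0 <= b k)%R by rewrite -lee_fin -bE.
(* The r-th root of the mass of this block exceeds 2^(2|m|), enough to beat the weight 2^(-|m|)
   given to the m-th hump. *)
have /choice[X hX] : forall m : int, exists X : {fset int},
    (e2 (2 * `|m%:~R| * r) < \sum_(k <- X) b k `^ r)%R.
  move=> m.
  have [|Y hY] := @zsum_gt_fset R (fun k => B k `^ r) (e2 (2 * `|m%:~R| * r)).
    by rewrite BS ltry.
  exists Y; rewrite -lte_fin -sumEFin; apply: lt_le_trans hY _.
  by apply: lee_sum => k _; rewrite bE.
pose N m := (\sum_(k <- X m) b k `^ r)%R.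
have N0 m : (0 < N m)%R := lt_trans (e2_gt0 _) (hX m).
(* The Hoelder extremal b^r on the block, scaled to total mass 2^(-|m|) so that the humps are
   summable. Keeping a single hump, the pairing is at least 2^(-|m| sg) N_m^(1/r) >= 2^|m|, for
   every m. *)
pose f m k : \bar R := if k \in X m then (e2 (- `|m%:~R|) * (b k `^ r / N m))%:E else 0.
have f0 m k : 0 <= f m k.
  by rewrite /f; case: ifP => // _; rewrite lee_fin mulr_ge0 ?e2_ge0 ?divr_ge0 ?powR_ge0 ?(ltW (N0 m)).
pose e k := zsum (fun m => f m k).
have e0 k : 0 <= e k by exact: zsum_ge0.
have fS m : zsum (f m) = (e2 (- `|m%:~R|))%:E.
  rewrite /f zsum_fset; last first.
    by move=> k; rewrite lee_fin mulr_ge0 ?e2_ge0 ?divr_ge0 ?powR_ge0 ?(ltW (N0 m)).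
  rewrite sumEFin -mulr_sumr -mulr_suml -/(N m) divff ?mulr1//.
  by rewrite gt_eqF.
have eS : zsum e = zsum (fun m => (e2 (- `|m%:~R|))%:E).
  by rewrite /e zsum_exchange//; apply: eq_zsum => m; rewrite fS.
exists e; split => //.
- rewrite eS; apply: lt_le_trans (zsum_ge_term 0 _); last by move=> k; rewrite lee_fin e2_ge0.
  by rewrite lte_fin e2_gt0.
- have [C C0 hC] := two_sided_geometric (@ltr01 R).
  rewrite eS; apply: le_lt_trans (ltry C); apply: le_trans hC.
  by apply: le_zsum => m; rewrite mulN1r.
have low m : (e2 `|m%:~R|)%:E <= zsum (fun k => e k `^ sg * B k).
  apply: (@le_trans _ _ (\sum_(k <- X m) (e2 (- `|m%:~R| * sg) * (N m `^ (- sg)) * b k `^ r)%:E)).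
    have NE : (N m `^ (- sg) * N m = N m `^ r^-1)%R.
      rewrite (_ : r^-1 = - sg + 1)%R; last by rewrite /sg; ring.
      by rewrite powRD ?(gt_eqF (N0 m)) ?implybT// powRr1// ltW.
    rewrite sumEFin -mulr_sumr -/(N m) lee_fin -mulrA NE.
    apply: (@le_trans _ _ (e2 (- `|m%:~R| * sg) * e2 (2 * `|m%:~R|))%R).
      rewrite -e2D le_e2; have m0 := normr_ge0 (m%:~R : R).
      have : (sg <= 1)%R by rewrite /sg lerBlDr lerDl invr_ge0 ltW.
      nra.
    apply: ler_wpM2l; first exact: e2_ge0.
    have -> : e2 (2 * `|m%:~R|) = (e2 (2 * `|m%:~R| * r) `^ r^-1 :> R)%R by rewrite e2M mulfK.
    by apply: ge0_ler_powR; rewrite ?nnegrE ?invr_ge0 ?e2_ge0 ?(ltW (N0 m)) ?(ltW r0) ?(ltW (hX m)).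
  rewrite -zsum_fset; last first.
    by move=> k; rewrite lee_fin !mulr_ge0 ?e2_ge0 ?powR_ge0.
  apply: le_zsum => k; case: ifPn => kX; last by rewrite mule_ge0 ?poweR_ge0.
  have fe : f m k <= e k by exact: (@zsum_ge_term _ (fun m => f m k)).
  rewrite bE; apply: (@le_trans _ _ (f m k `^ sg * (b k)%:E)); last first.
    by rewrite lee_wpmul2r ?lee_fin// le_poweR ?(ltW sg0).
  rewrite /f kX poweR_EFin -EFinM lee_fin powRM ?e2_ge0 ?divr_ge0 ?powR_ge0 ?(ltW (N0 m))//.
  rewrite powRM ?powR_ge0 ?invr_ge0 ?(ltW (N0 m))// e2M -powRrM.
  have -> : ((N m)^-1 `^ sg = N m `^ (- sg))%R.
    by rewrite -powR_inv1 ?(ltW (N0 m))// -powRrM mulN1r.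
  have -> : (r * sg = r - 1)%R by rewrite /sg; field.
  have [->|bn0] := eqVneq (b k) 0%R; first by rewrite powR0// !mulr0.
  have -> : (b k `^ r = b k `^ (r - 1) * b k)%R.
    by rewrite -[X in (_ * X)%R]powRr1// -powRD ?bn0 ?implybT// subrK.
  by rewrite le_eqVlt; apply/orP; left; apply/eqP; ring.
apply/eqyP => M /e2_surj[y ->].
apply: le_trans (low (Num.ceil `|y|)); rewrite lee_fin le_e2.
have /andP[_ yc] := ceil_itv `|y|.
by rewrite (le_trans (ler_norm _))// (le_trans yc)// ler_norm.
Qed.

End sequences.

(** * Beurling weights *)

Section Omega_functions.
Local Open Scope ereal_scope.
Context {R : realType}.
Local Notation leb := (@lebesgue_measure R).
Implicit Types (x y ga th be : R) (phi : R -> R).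

Lemma discretize1 (be q : R) : (0 < q)%R ->
  exists2 C : R, (0 < C)%R & forall g : R -> \bar R,
   (forall t, (0 < t)%R -> 0 <= g t) -> monotone_pos g ->
   (zsum (fun k => ((e2 (k%:~R * be))%:E * g (e2 k%:~R)) `^ q) <=
    C%:E * \int[leb]_(t in `]0%R, +oo[) (((t `^ be)%:E * g t) `^ q * (t^-1)%:E)) /\
   (\int[leb]_(t in `]0%R, +oo[) (((t `^ be)%:E * g t) `^ q * (t^-1)%:E) <=
    C%:E * zsum (fun k => ((e2 (k%:~R * be))%:E * g (e2 k%:~R)) `^ q)).
Proof.
move=> q0; have [C C0 hC] := discretize be (@ltr01 R) q0; exists C => // g g0 mg.
have := hC g g0 mg; have -> // : zsum (fun k => ((e2 (1 * k%:~R * be))%:E * g (e2 (1 * k%:~R))) `^ q) =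
  zsum (fun k => ((e2 (k%:~R * be))%:E * g (e2 k%:~R)) `^ q).
by apply: eq_zsum => k; rewrite mul1r.
Qed.

Lemma xpowR_ge0 x ga : 0 <= xpowR x ga.
Proof. by rewrite /xpowR; case: ifP => _; rewrite ?lee_fin ?powR_ge0. Qed.

Lemma xpowR_pos x ga : (0 <= ga)%R -> xpowR x ga = (x `^ ga)%:E.
Proof. by move=> g0; rewrite /xpowR ltNge g0 andbF. Qed.

Lemma xpowR_gt0 x ga : (0 < x)%R -> xpowR x ga = (x `^ ga)%:E.
Proof. by move=> x0; rewrite /xpowR gt_eqF. Qed.

Lemma le_xpowR_pos x y ga : (0 < ga)%R -> (0 <= x)%R -> (0 <= y)%R ->
  (xpowR x ga <= xpowR y ga) = (x <= y)%R.
Proof.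
move=> g0 x0 y0; rewrite !xpowR_pos ?(ltW g0)// lee_fin.
apply/idP/idP => [|xy]; last by apply: ge0_ler_powR; rewrite ?nnegrE ?(ltW g0).
apply: contraTT; rewrite -!ltNge => yx.
by apply: gt0_ltr_powR; rewrite ?nnegrE.
Qed.

Lemma le_xpowR_neg x y ga : (ga < 0)%R -> (0 <= x)%R -> (0 <= y)%R ->
  (xpowR x ga <= xpowR y ga) = (y <= x)%R.
Proof.
move=> g0 x0' y0'; have [x0|x0] := eqVneq 0%R x.
  rewrite -x0 /xpowR eqxx g0 /=; have [y0|y0] := eqVneq 0%R y.
    by rewrite -y0 ?eqxx /= !lexx.
  rewrite /= leye_eq; apply/esym/negbTE.
  by rewrite -ltNge lt_neqAle y0.
have xp : (0 < x)%R by rewrite lt_neqAle x0.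
have [y0|y0] := eqVneq 0%R y.
  by rewrite -y0 [X in _ <= X]/xpowR eqxx g0 /= leey.
have yp : (0 < y)%R by rewrite lt_neqAle y0.
have E z : (z `^ ga = (z `^ (- ga))^-1)%R by rewrite -powRN opprK.
rewrite !xpowR_gt0// lee_fin !E lef_pV2 ?posrE ?powR_gt0//.
by have := @le_xpowR_pos y x (- ga); rewrite !xpowR_gt0// lee_fin oppr_gt0; apply.
Qed.

(** With be = -th/ga, the monotonicity required in [Omega] becomes that of t^(-be) phi(t):
    increasing for ga > 0, decreasing for ga < 0. *)
Lemma Omega_funE th ga be phi t : (be * ga = - th)%R -> (0 < t)%R -> (0 <= phi t)%R ->
  Omega_fun th ga phi t = xpowR (t `^ (- be) * phi t)%R ga.
Proof.
move=> bg t0 p0; rewrite /Omega_fun /xpowR mulf_eq0 (gt_eqF (powR_gt0 _ t0))/=.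
case: ifP => _; first by rewrite gt0_muley// lte_fin powR_gt0.
by rewrite -EFinM powRM ?powR_ge0// -powRrM mulNr bg opprK.
Qed.

Lemma Omega_fun_ge0 th ga phi t : 0 <= Omega_fun th ga phi t.
Proof. by rewrite mule_ge0 ?xpowR_ge0// lee_fin powR_ge0. Qed.

(** phi is t^be times a monotone function, so its integral against dt/t, which is 1, controls the
    sum of its dyadic samples, uniformly in phi. *)
Lemma Omega_sum th ga : ga != 0%R ->
  exists2 C : R, (0 < C)%R & forall phi, Omega th ga phi ->
    zsum (fun k => (phi (e2 k%:~R))%:E) <= C%:E.
Proof.
move=> gn0; pose be := (- th / ga)%R.
have bg : (be * ga = - th)%R by rewrite /be divfK.
have [C C0 hC] := discretize1 be (@ltr01 R).
exists C => // phi [mphi phi0 phi1 mono].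
pose g t := (t `^ (- be) * phi t)%:E.
have g0 t : (0 < t)%R -> 0 <= g t.
  by move=> t0; rewrite lee_fin mulr_ge0 ?powR_ge0 ?phi0.
have mg : monotone_pos g.
  have [gn|gp] := ltP ga 0%R; [right|left] => s t s0 st; have t0 := lt_le_trans s0 st;
    have := mono _ _ s0 st; rewrite !(Omega_funE bg) ?phi0//.
    by rewrite le_xpowR_neg ?lee_fin ?mulr_ge0 ?powR_ge0 ?phi0.
  rewrite le_xpowR_pos ?lee_fin ?mulr_ge0 ?powR_ge0 ?phi0//.
  by rewrite lt_neqAle eq_sym gn0.
have [+ _] := hC g g0 mg; congr (_ <= _).
  apply: eq_zsum => k; rewrite -EFinM mulrA e2M mulrN -e2D subrr e20 mul1r.
  by rewrite poweRe1// lee_fin phi0 ?e2_gt0.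
rewrite (_ : \int[leb]_(_ in _) _ = 1) ?mule1// -phi1; apply: eq_integral => t.
rewrite inE => It; have t0 : (0 < t)%R by move: It; rewrite /= in_itv/= andbT.
rewrite -EFinM mulrA -powRD ?subrr ?eqxx ?gt_eqF//.
by rewrite powRr0 mul1r powRr1 ?phi0.
Qed.

(** Converts a summable sequence into an admissible phi whose dyadic values dominate the normalized
    sequence. Both ends 2^k and 2^(k+1) are controlled because [Vpow_ge] samples phi at the lower
    end of a level and [Vpow_le] at the upper end. *)
Lemma Omega_regularize th ga : (0 < th)%R -> ga != 0%R ->
  exists2 c : R, (0 < c)%R & forall e : int -> \bar R,
    (forall k, 0 <= e k) -> 0 < zsum e -> zsum e < +oo ->
    exists2 phi, Omega th ga phi & forall k : int,
      (c * (fine (e k) / fine (zsum e)) <= phi (e2 k%:~R))%R /\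
      (c * (fine (e k) / fine (zsum e)) <= phi (e2 (k + 1)%:~R))%R.
Proof.
move=> th0 gn0; pose be := (- th / ga)%R.
have bg : (be * ga = - th)%R by rewrite /be divfK.
have ben0 : be != 0%R by rewrite /be mulf_neq0 ?oppr_eq0 ?invr_eq0 ?(gt_eqF th0).
have abe0 : (0 < `|be|)%R by rewrite normr_gt0.
have [C1 C10 hC1] := discretize1 be (@ltr01 R).
have [C2 C20 hC2] := geometric_sum_le abe0 (@ltr01 R).
(* The cut-off is enlarged by one step, so that the k-th term still counts at t = 2^(k+1). *)
pose K : R := e2 `|be|; have K0 : (0 < K)%R := e2_gt0 _.
exists (e2 (- `|be|) / (C1 * (C2 * K)))%R.
  by rewrite divr_gt0 ?e2_gt0// !mulr_gt0.
move=> e e0 S0 Soo; pose S := fine (zsum e).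
have SE : zsum e = S%:E by rewrite fineK// ge0_fin_numE// ltW.
have S0' : (0 < S)%R by rewrite -lte_fin -SE.
(* Raising u only adds terms, so G(t) = Gam(t^(-be)) is monotone in the direction prescribed by the
   sign of ga, and t^be G(t) at t = 2^k contains the term e_k. *)
pose Gam u := zsum (fun j => if (e2 (- (j%:~R * be)) <= K * u)%R then (e2 (- (j%:~R * be)))%:E * e j else 0).
have t0 u j : 0 <= if (e2 (- (j%:~R * be)) <= K * u)%R then (e2 (- (j%:~R * be)))%:E * e j else 0.
  by case: ifP => // _; rewrite mule_ge0 ?lee_fin ?e2_ge0.
have Gam0 u : 0 <= Gam u by apply: zsum_ge0.
have Gam_mono u v : (u <= v)%R -> Gam u <= Gam v.
  move=> uv; apply: le_zsum => j; case: ifPn => ju; last exact: t0.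
  by rewrite (le_trans ju)// ler_wpM2l// ltW.
have Gam_fin u : (0 <= u)%R -> Gam u \is a fin_num.
  move=> u0; rewrite ge0_fin_numE//; apply: (@le_lt_trans _ _ ((K * u)%:E * zsum e)).
    rewrite -zsumZl ?lee_fin ?mulr_ge0 ?(ltW K0)//; apply: le_zsum => j.
    case: ifPn => ju; first by rewrite lee_wpmul2r ?lee_fin.
    by rewrite mule_ge0 ?lee_fin ?mulr_ge0 ?(ltW K0).
  by rewrite SE -EFinM ltry.
pose G (t : R) := Gam (t `^ (- be))%R.
have G0 t : (0 < t)%R -> 0 <= G t by move=> _; exact: Gam0.
have GE t : G t = (fine (G t))%:E by rewrite fineK// Gam_fin// powR_ge0.
have Gcmp : (forall s t, (0 < s)%R -> (s <= t)%R -> (ga < 0)%R -> G t <= G s) /\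
            (forall s t, (0 < s)%R -> (s <= t)%R -> (0 < ga)%R -> G s <= G t).
  split => s t s0 st g0; apply: Gam_mono; have t0' := lt_le_trans s0 st.
    have b0 : (0 <= be)%R by rewrite /be mulNr -mulrN -invrN divr_ge0 ?oppr_ge0 ?ltW.
    by rewrite !powRN lef_pV2 ?posrE ?powR_gt0// ge0_ler_powR ?nnegrE ?(ltW s0) ?(ltW t0').
  have b0 : (0 <= - be)%R by rewrite /be mulNr opprK divr_ge0 ?ltW.
  by rewrite ge0_ler_powR ?nnegrE ?(ltW s0) ?(ltW t0').
have mG : monotone_pos G.
  have [gn|gp] := ltP ga 0%R; [right|left] => s t s0 st; first exact: Gcmp.1.
  by apply: Gcmp.2 => //; rewrite lt_neqAle eq_sym gn0.
have mGm := monotone_pos_measurable mG.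
pose phi0 t := (t `^ be * fine (G t))%R.
have phi00 t : (0 <= phi0 t)%R by rewrite mulr_ge0 ?powR_ge0// fine_ge0// Gam0.
have low k : (fine (e k) <= phi0 (e2 k%:~R))%R /\
             (e2 (- `|be|) * fine (e k) <= phi0 (e2 (k + 1)%:~R))%R.
  have ek : e k = (fine (e k))%:E.
    rewrite fineK// ge0_fin_numE//; apply: le_lt_trans Soo; exact: zsum_ge_term.
  have main m : (- (k%:~R * be) <= `|be| - m%:~R * be)%R ->
      (e2 (m%:~R * be - k%:~R * be) * fine (e k) <= phi0 (e2 m%:~R))%R.
    move=> hm; rewrite /phi0 e2M e2D -mulrA ler_wpM2l ?e2_ge0//.
    rewrite -lee_fin -GE /G e2M mulrN; apply: le_trans (zsum_ge_term k (t0 _)).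
    by rewrite /K -e2D le_e2 hm ek -EFinM.
  split.
    by have := main k; rewrite subrr e20 mul1r; apply; rewrite lerDr.
  apply: le_trans (main (k + 1)%R _).
    rewrite ler_wpM2r ?fine_ge0// le_e2 intrD mulrDl mul1r addrAC subrr add0r.
    by rewrite lerNl (le_trans (ler_norm _)) ?normrN.
  by rewrite intrD mulrDl mul1r opprD addrCA lerDl subr_ge0 ler_norm.
have geoK : zsum (fun i => if (e2 (i%:~R * be) <= K)%R then (e2 (i%:~R * be))%:E else 0) <= (C2 * K)%:E.
  have hK := hC2 K%:E; rewrite lee_fin (ltW K0) poweRe1 ?lee_fin ?(ltW K0)// in hK.
  rewrite EFinM; apply: le_trans (hK isT).
  have [b0|b0] := leP 0%R be.
    by apply: le_zsum => i; rewrite ger0_norm// lee_fin mulr1 mulrC.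
  rewrite -[leLHS]zsum_opp; apply: le_zsum => i.
  have -> : ((- i)%:~R * be = - be * i%:~R)%R by rewrite intrN; ring.
  by rewrite ltr0_norm// lee_fin mulr1.
(* After exchanging the sums, e_j is counted with the weights 2^((k-j) be) that are at most K: a
   one-sided geometric series. *)
have sumle : zsum (fun k => ((e2 (k%:~R * be))%:E * G (e2 k%:~R)) `^ 1) <= (C2 * K)%:E * zsum e.
  pose tt k j := (if (e2 ((k - j)%:~R * be) <= K)%R then (e2 ((k - j)%:~R * be))%:E else 0) * e j.
  have tt0 k j : 0 <= tt k j by rewrite /tt mule_ge0//; case: ifP; rewrite ?lee_fin ?e2_ge0.
  rewrite (_ : zsum _ = zsum (fun k => zsum (tt k))); last first.
    apply: eq_zsum => k; rewrite poweRe1; last by rewrite mule_ge0 ?Gam0 ?lee_fin ?e2_ge0.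
    rewrite -zsumZl ?lee_fin ?e2_ge0//; apply: eq_zsum => j; rewrite /tt e2M mulrN /K -e2D !le_e2.
    rewrite intrB mulrBl -lerBlDr opprK [(- _ + _)%R]addrC; case: ifP => _; last by rewrite mule0 mul0e.
    by rewrite muleA -EFinM -e2D.
  rewrite zsum_exchange// -zsumZl ?lee_fin ?mulr_ge0 ?(ltW C20) ?(ltW K0)//.
  apply: le_zsum => j; rewrite /tt zsumZr//; last by move=> k; case: ifP; rewrite ?lee_fin ?e2_ge0.
  rewrite lee_wpmul2r//; apply: le_trans geoK.
  by rewrite -[leRHS](zsum_shift (- j)).
(* The normalizing integral. It is positive and at most C1 C2 K times the sum of e, so dividing by
   it costs only the constant of the statement. *)
pose Z := fine (\int[leb]_(t in `]0%R, +oo[) (((t `^ be)%:E * G t) `^ 1 * (t^-1)%:E)).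
have [Zlo Zhi] := hC1 G G0 mG.
have Zoo : \int[leb]_(t in `]0%R, +oo[) (((t `^ be)%:E * G t) `^ 1 * (t^-1)%:E) <= (C1 * (C2 * K) * S)%:E.
  apply: le_trans Zhi _; rewrite -mulrA EFinM lee_wpmul2l ?lee_fin ?(ltW C10)//.
  by rewrite EFinM -SE.
have ZE : \int[leb]_(t in `]0%R, +oo[) (((t `^ be)%:E * G t) `^ 1 * (t^-1)%:E) = Z%:E.
  rewrite fineK// ge0_fin_numE; first exact: le_lt_trans Zoo (ltry _).
  apply: integral_ge0 => t; rewrite /= in_itv/= andbT => t0'.
  by apply: mule_ge0; [exact: poweR_ge0|rewrite lee_fin invr_ge0 ltW].
have Z0 : (0 < Z)%R.
  rewrite -(@pmulr_rgt0 _ C1)// -lte_fin EFinM -ZE; apply: lt_le_trans Zlo.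
  apply: lt_le_trans S0 _; apply: le_zsum => k.
  rewrite poweRe1; last by rewrite mule_ge0 ?Gam0 ?lee_fin ?e2_ge0.
  have [+ _] := low k; rewrite /phi0 e2M -lee_fin EFinM -GE.
  rewrite fineK// ge0_fin_numE//; apply: le_lt_trans Soo; exact: zsum_ge_term.
have Zle : (Z <= C1 * (C2 * K) * S)%R by rewrite -lee_fin -ZE.
pose phi t := (phi0 t / Z)%R.
have phi_ge0 t : (0 <= phi t)%R by rewrite divr_ge0 ?(ltW Z0).
exists phi.
  split.
  - apply: measurable_funM; last exact: measurable_cst.
    apply: measurable_funM; first by apply: measurable_funTS; exact: measurable_powR.
    exact: (measurableT_comp (@fine_measurable R setT measurableT)).
  - by [].
  - rewrite (_ : 1 = Z^-1%:E * Z%:E); last by rewrite -EFinM mulVf// gt_eqF.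
    rewrite -ZE -ge0_integralZl; last first.
    + by rewrite lee_fin invr_ge0 ltW.
    + move=> t; rewrite /= in_itv/= andbT => t0'.
      by apply: mule_ge0; [exact: poweR_ge0|rewrite lee_fin invr_ge0 ltW].
    + apply: emeasurable_funM.
        apply: (measurableT_comp (measurable_poweR 1)).
        apply: emeasurable_funM => //; apply/measurable_EFinP.
        by apply: measurable_funTS; exact: measurable_powR.
      apply/measurable_EFinP; apply: (eq_measurable_fun (fun t : R => (t `^ (-1))%R)).
        by move=> t /[!inE] /=; rewrite in_itv/= andbT => t0'; rewrite powR_inv1// ltW.
      by apply: measurable_funTS; exact: measurable_powR.
    + exact: measurable_itv.
    apply: eq_integral => t; rewrite inE => It; have t0' : (0 < t)%R by move: It; rewrite /= in_itv/= andbT.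
    rewrite poweRe1; last by rewrite mule_ge0 ?G0 ?lee_fin ?powR_ge0.
    by rewrite GE -!EFinM /phi /phi0; congr EFin; ring.
  move=> s t s0 st; have t0' := lt_le_trans s0 st.
  rewrite (Omega_funE bg s0 (phi_ge0 s)) (Omega_funE bg t0' (phi_ge0 t)).
  have simpl_phi u : (0 < u)%R -> (u `^ (- be) * phi u = fine (G u) / Z)%R.
    move=> u0; rewrite /phi /phi0 !mulrA -powRD ?addNr ?eqxx ?gt_eqF// powRr0 mul1r//.
  rewrite (simpl_phi s s0) (simpl_phi t t0').
  have fG u : (0 <= fine (G u) / Z)%R.
    by apply: divr_ge0; [apply/fine_ge0/Gam0|exact: ltW].
  have [gn|gp] := ltP ga 0%R.
    rewrite (le_xpowR_neg gn (fG s) (fG t)) ler_pM2r ?invr_gt0//.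
    by apply: fine_le; rewrite ?Gam_fin ?powR_ge0//; apply: Gcmp.1.
  have gp' : (0 < ga)%R by rewrite lt_neqAle eq_sym gn0.
  rewrite (le_xpowR_pos gp' (fG s) (fG t)) ler_pM2r ?invr_gt0//.
  by apply: fine_le; rewrite ?Gam_fin ?powR_ge0//; apply: Gcmp.2.
have fe k : (0 <= fine (e k))%R by rewrite fine_ge0.
have em : (e2 (- `|be|) <= 1 :> R)%R by rewrite e2_le1// oppr_le0.
have key k (v : R) : (e2 (- `|be|) * fine (e k) <= v)%R ->
    (e2 (- `|be|) / (C1 * (C2 * K)) * (fine (e k) / S) <= v / Z)%R.
  move=> kv; rewrite ler_pdivlMr//.
  have -> : (e2 (- `|be|) / (C1 * (C2 * K)) * (fine (e k) / S) * Z =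
       e2 (- `|be|) * fine (e k) * (Z / (C1 * (C2 * K) * S)))%R.
    by field; rewrite !gt_eqF.
  apply: le_trans kv; rewrite ler_piMr ?mulr_ge0 ?e2_ge0//.
  by rewrite ler_pdivrMr ?mul1r// !mulr_gt0.
move=> k; have [l1 l2] := low k; split; last exact: (key k _ l2).
apply: (key k _ (le_trans _ l1)).
by rewrite ler_piMl.
Qed.

(** For ga != 0, regularize a unit mass. For ga = 0 the monotonicity condition is only that of t^th,
    so the phi found for exponent 1 serves. *)
Lemma Omega_nonempty th ga : (0 < th)%R -> exists phi, Omega th ga phi.
Proof.
have main g : (0 < th)%R -> g != 0%R -> exists phi, Omega th g phi.
  move=> th0 gn0; have [c _ hc] := Omega_regularize th0 gn0.
  pose e (k : int) : \bar R := if k \in [fset 0%R]%fset then 1 else 0.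
  have e0 k : 0 <= e k by rewrite /e; case: ifP.
  have eS : zsum e = 1 by rewrite zsum_fset// big_seq_fset1.
  by have [||phi Ophi _] := hc e e0; rewrite ?eS ?ltry//; exists phi.
move=> th0; have [->|gn0] := eqVneq ga 0%R; last exact: main.
have [phi [mphi phi0 phi1 _]] := main 1%R th0 (oner_neq0 _).
exists phi; split => // s t s0 st.
rewrite /Omega_fun !xpowR_pos// !powRr0 !mule1 lee_fin.
by apply: ge0_ler_powR; rewrite ?nnegrE ?(ltW th0) ?(ltW s0) ?(ltW (lt_le_trans s0 st)).
Qed.

End Omega_functions.

Section Beurling_levels.
Local Open Scope ereal_scope.
Context d (T : measurableType d) {R : realType} (mu : {measure set T -> \bar R}).
Variables (p th ga : R) (p1 : (1 <= p)%R) (th0 : (0 < th)%R).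
Implicit Types (w a : T -> R) (phi : R -> R).

Let p0 : (0 < p)%R. Proof. exact: lt_le_trans ltr01 p1. Qed.
Let pn0 : p != 0%R. Proof. by rewrite gt_eqF. Qed.

Definition Vpow w a phi : \bar R :=
  \int[mu]_x ((a x)%:E * Omega_fun th ga phi (w x)) `^ p.

Definition psi phi k : \bar R := xpowR (phi (e2 k%:~R)) ga `^ p.

Section fixed.
Variables (w a : T -> R) (phi : R -> R).
Hypotheses (mw : measurable_fun setT w) (ma : measurable_fun setT a).
Hypotheses (w0 : forall x, (0 < w x)%R) (a0 : forall x, (0 <= a x)%R).
Hypothesis Ophi : Omega th ga phi.

Lemma Omega_monotone : monotone_pos (Omega_fun th ga phi).
Proof. by left; case: Ophi. Qed.

Lemma measurable_Omega_comp : measurable_fun setT (fun x => Omega_fun th ga phi (w x)).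
Proof.
apply: (measurable_comp _ _ (monotone_pos_measurable Omega_monotone) mw).
  exact: measurable_itv.
by move=> _ [x _ <-]; rewrite /= in_itv/= w0.
Qed.

Lemma measurable_Vpow_integrand :
  measurable_fun setT (fun x => ((a x)%:E * Omega_fun th ga phi (w x)) `^ p).
Proof.
apply: (measurableT_comp (measurable_poweR p)).
by apply: emeasurable_funM; [apply/measurable_EFinP|exact: measurable_Omega_comp].
Qed.

Lemma Omega_fun_psi k : Omega_fun th ga phi (e2 k%:~R) `^ p =
  (e2 (k%:~R * th * p))%:E * psi phi k.
Proof.
by rewrite /Omega_fun poweRM ?xpowR_ge0 ?lee_fin ?powR_ge0// e2M poweR_EFin e2M.
Qed.

Lemma level_term c k : 0 <= c ->
  \int[mu]_(x in wlevel w k) (c * (a x `^ p)%:E) = c * Ipow mu p (wlevel w k) a.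
Proof.
move=> c0; rewrite ge0_integralZl//.
- exact: measurable_wlevel.
- exact: measurable_powR_EFin.
Qed.

(** On level k, w >= 2^k, and t^th phi(t)^ga is increasing. *)
Lemma Vpow_ge : zsum (fun k => psi phi k * Blevel mu p th w a k) <= Vpow w a phi.
Proof.
rewrite /Vpow (integral_wlevel mu mw w0)//; last 2 first.
- exact: measurable_Vpow_integrand.
- by move=> x _; exact: poweR_ge0.
apply: le_zsum => k; rewrite setTI /Blevel muleCA muleA -Omega_fun_psi.
rewrite -level_term ?poweR_ge0//; apply: ge0_le_integral.
- exact: measurable_wlevel.
- by move=> x _; rewrite mule_ge0 ?poweR_ge0// lee_fin powR_ge0.
- by apply: measurable_funeM; exact: measurable_powR_EFin.
- by apply: measurable_funTS; exact: measurable_Vpow_integrand.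
move=> x; rewrite wlevelE => /andP[kx xk].
rewrite muleC -poweR_EFin -poweRM ?Omega_fun_ge0 ?lee_fin//.
apply: le_poweR; [exact: ltW|by apply: mule_ge0; [rewrite lee_fin|exact: Omega_fun_ge0]|].
by rewrite lee_wpmul2l ?lee_fin//; case: Ophi => _ _ _; apply; rewrite ?e2_gt0.
Qed.

(** Here the upper end 2^(k+1) of the level is used: phi is sampled one index later and the power of
    t costs 2^(th p). *)
Lemma Vpow_le : Vpow w a phi <=
  (e2 (th * p))%:E * zsum (fun k => psi phi (k + 1) * Blevel mu p th w a k).
Proof.
rewrite /Vpow (integral_wlevel mu mw w0)//; last 2 first.
- exact: measurable_Vpow_integrand.
- by move=> x _; exact: poweR_ge0.
rewrite -zsumZl ?lee_fin ?e2_ge0//; last by move=> k; rewrite mule_ge0 ?poweR_ge0 ?Blevel_ge0.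
apply: le_zsum => k; rewrite setTI /Blevel.
have -> : (e2 (th * p))%:E * (psi phi (k + 1) * ((e2 (k%:~R * th * p))%:E * Ipow mu p (wlevel w k) a)) =
    Omega_fun th ga phi (e2 (k + 1)%:~R) `^ p * Ipow mu p (wlevel w k) a.
  rewrite Omega_fun_psi [psi _ _ * _]muleCA !muleA -EFinM -e2D; congr ((e2 _)%:E * _ * _).
  by rewrite intrD; ring.
rewrite -level_term ?poweR_ge0//; apply: ge0_le_integral.
- exact: measurable_wlevel.
- by move=> x _; exact: poweR_ge0.
- by apply: measurable_funTS; exact: measurable_Vpow_integrand.
- by apply: measurable_funeM; exact: measurable_powR_EFin.
move=> x; rewrite wlevelE => /andP[kx xk].
rewrite muleC -poweR_EFin -poweRM ?Omega_fun_ge0 ?lee_fin//.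
apply: le_poweR; [exact: ltW|by apply: mule_ge0; [exact: Omega_fun_ge0|rewrite lee_fin]|].
by rewrite lee_wpmul2r ?lee_fin//; case: Ophi => _ _ _; apply; rewrite ?w0 ?(ltW xk).
Qed.

End fixed.
End Beurling_levels.

(** * Beurling norms and sums over the levels of the weight *)

Section Beurling_equivalence.
Local Open Scope ereal_scope.
Context d (T : measurableType d) {R : realType} (mu : {measure set T -> \bar R}).
Variables (p q th : R) (p1 : (1 <= p)%R) (q0 : (0 < q)%R) (th0 : (0 < th)%R).
Implicit Types (w a : T -> R) (phi : R -> R).
Local Notation ga := (p^-1 - q^-1)%R.
Local Notation r := (q / p)%R.
Local Notation B := (Blevel mu p th).
Local Notation V := (Vpow mu p th ga).

Let p0 : (0 < p)%R. Proof. exact: lt_le_trans ltr01 p1. Qed.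
Let pn0 : p != 0%R. Proof. by rewrite gt_eqF. Qed.
Let qn0 : q != 0%R. Proof. by rewrite gt_eqF. Qed.
Let r0 : (0 < r)%R. Proof. by rewrite divr_gt0. Qed.
Let rn0 : r != 0%R. Proof. by rewrite gt_eqF. Qed.
(** Thus ga <= 0 means r <= 1, and psi behaves as phi^(1 - 1/r), the dual weight for Hoelder's
    inequality between l^1 and l^r. *)
Let gap : (ga * p = 1 - r^-1)%R.
Proof. by field; rewrite qn0 pn0. Qed.

Let rV_ga0 : ga = 0%R -> (r^-1 = 1)%R.
Proof. by move=> g0; apply/eqP; rewrite eq_sym -subr_eq0 -gap g0 mul0r. Qed.
Let r_ga0 : ga = 0%R -> r = 1%R.
Proof. by move=> /rV_ga0/(congr1 GRing.inv); rewrite invrK invr1. Qed.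

Definition level_norm w a : \bar R := zsum (fun k => B w a k `^ r).

Let N0 w a : 0 <= level_norm w a.
Proof. by apply: zsum_ge0 => k; exact: poweR_ge0. Qed.

Lemma psi_ga0 phi k : ga = 0%R -> psi p ga phi k = 1.
Proof. by move=> g0; rewrite /psi g0 xpowR_pos// powRr0 poweR1r. Qed.

Lemma level_norm_ga0 w a : ga = 0%R -> level_norm w a = zsum (B w a).
Proof.
move=> g0; rewrite /level_norm; apply: eq_zsum => k.
by rewrite r_ga0// poweRe1// Blevel_ge0.
Qed.

Lemma psi_pow_lb phi k c : (0 < ga)%R -> (0 <= c)%R -> (c <= phi (e2 k%:~R))%R ->
  (c `^ (1 - r^-1))%:E <= psi p ga phi k.
Proof.
move=> g0 c0 cphi; rewrite -gap /psi xpowR_pos ?(ltW g0)// powRrM.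
have -> : ((c `^ ga) `^ p)%:E = (c `^ ga)%:E `^ p :> \bar R by rewrite poweR_EFin.
apply: le_poweR; rewrite ?(ltW p0) ?lee_fin ?powR_ge0//.
by apply: ge0_ler_powR; rewrite ?nnegrE ?(ltW g0)// (le_trans c0).
Qed.

Lemma psi_pow_ub phi k c : (ga < 0)%R -> (0 < c)%R -> (c <= phi (e2 k%:~R))%R ->
  psi p ga phi k <= (c `^ (1 - r^-1))%:E.
Proof.
move=> g0 c0 cphi; rewrite -gap /psi powRrM (_ : ((c `^ ga) `^ p)%:E = (c `^ ga)%:E `^ p)//.
apply: le_poweR; rewrite ?(ltW p0) ?xpowR_ge0//.
by rewrite -xpowR_gt0// le_xpowR_neg ?(ltW c0)// (le_trans (ltW c0)).
Qed.

(** For r < 1, B^r = (psi B)^r phi^(1-r); apply Hoelder's inequality with exponents 1/r and 1/(1-r),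
    the samples of phi being summable. *)
Lemma Beurling_neg_ge : (ga <= 0)%R ->
  exists2 C : R, (0 < C)%R & forall w a phi, admissible w a -> Omega th ga phi ->
    level_norm w a <= C%:E * V w a phi `^ r.
Proof.
move=> g0; have [g00|gn0] := eqVneq ga 0%R.
  exists 1%R => // w a phi [mw ma w0 a0] Ophi.
  rewrite mul1e r_ga0// poweRe1; last by apply: integral_ge0 => x _; exact: poweR_ge0.
  rewrite level_norm_ga0//; apply: le_trans (Vpow_ge mu p1 mw ma w0 a0 Ophi).
  by apply: le_zsum => k; rewrite psi_ga0// mul1e.
have gn : (ga < 0)%R by rewrite lt_neqAle gn0.
have r1 : (r < 1)%R.
  by rewrite -invf_gt1// -subr_lt0 -gap pmulr_llt0.
have [C C0 hC] := Omega_sum th gn0.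
exists (1 + C)%R; first by rewrite addr_gt0.
move=> w a phi [mw ma w0 a0] Ophi; have [mphi phi0 phiI mono] := Ophi.
have psi0 k : 0 <= psi p ga phi k * B w a k by rewrite mule_ge0 ?poweR_ge0 ?Blevel_ge0.
have Vge := Vpow_ge mu p1 mw ma w0 a0 Ophi.
set X := zsum _ in Vge; have X0 : 0 <= X by exact: zsum_ge0.
apply: (@le_trans _ _ ((1 + C)%:E * X `^ r)); last first.
  by rewrite lee_wpmul2l ?lee_fin ?addr_ge0 ?(ltW C0)// le_poweR ?(ltW r0).
have [XE|Xfin] := eqVneq X +oo.
  by rewrite XE poweRyr// gt0_muley ?leey// lte_fin addr_gt0.
apply: le_trans (zsum_holder _ psi0 (fun k => phi0 _ (e2_gt0 _)) (hC _ Ophi)); last by rewrite r0.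
apply: le_zsum => k; have B0 := Blevel_ge0 mu p th w a k.
have [->|Bn0] := eqVneq (B w a k) 0; first by rewrite poweR0r// mule_ge0 ?poweR_ge0 ?lee_fin ?powR_ge0.
(* A zero of phi makes psi infinite because ga < 0, so B k > 0 would give X = +oo. *)
have [phik|phik] := eqVneq (phi (e2 k%:~R)) 0%R.
  exfalso; move/negP: Xfin; apply; rewrite -leye_eq.
  apply: le_trans (zsum_ge_term k psi0) => /=.
  by rewrite /psi /xpowR phik eqxx gn/= (negbTE pn0) gt0_mulye// lt0e Bn0.
have phip : (0 < phi (e2 k%:~R))%R by rewrite lt_neqAle eq_sym phik phi0 ?e2_gt0.
rewrite poweRM ?poweR_ge0// /psi xpowR_gt0// !poweR_EFin -!powRrM muleAC -EFinM -powRD; last first.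
  by rewrite phik implybT.
have -> : (ga * (p * r) + (1 - r) = 0)%R by field; rewrite qn0 pn0.
by rewrite powRr0 mul1e.
Qed.

(** The extremal choice is phi about B^r/N, with N the level sum: then psi B is at most a multiple
    of N^(1/r - 1) B^r, which sums to N^(1/r). *)
Lemma Beurling_neg_le : (ga <= 0)%R ->
  exists2 C : R, (0 < C)%R & forall w a, admissible w a ->
    exists2 phi, Omega th ga phi & V w a phi <= C%:E * level_norm w a `^ r^-1.
Proof.
move=> g0; have [g00|gn0] := eqVneq ga 0%R.
  exists (e2 (th * p)); first exact: e2_gt0.
  move=> w a [mw ma w0 a0]; have [phi Ophi] := Omega_nonempty ga th0; exists phi => //.
  apply: le_trans (Vpow_le mu p1 mw ma w0 a0 Ophi) _.
  rewrite rV_ga0// poweRe1//; apply: lee_wpmul2l; first by rewrite lee_fin e2_ge0.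
  rewrite level_norm_ga0//; apply: le_zsum => k; by rewrite psi_ga0// mul1e.
have gn : (ga < 0)%R by rewrite lt_neqAle gn0.
have [c c0 hc] := Omega_regularize th0 gn0.
exists (e2 (th * p) * c `^ (1 - r^-1))%R; first by rewrite mulr_gt0 ?e2_gt0 ?powR_gt0.
move=> w a [mw ma w0 a0]; have B0 := Blevel_ge0 mu p th w a.
have Br0 k : 0 <= B w a k `^ r by exact: poweR_ge0.
have [phi Ophi] := Omega_nonempty ga th0.
have C0 : (0 < e2 (th * p) * c `^ (1 - r^-1))%R by rewrite mulr_gt0 ?e2_gt0 ?powR_gt0.
have [NE|Nfin] := eqVneq (level_norm w a) +oo.
  exists phi => //.
  by rewrite NE poweRyr ?invr_neq0// gt0_muley ?leey// lte_fin.
(* All B k vanish, and infinite values of psi do no harm since oo * 0 = 0. *)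
have [NE|Nn0] := eqVneq (level_norm w a) 0.
  exists phi => //; apply: le_trans (Vpow_le mu p1 mw ma w0 a0 Ophi) _.
  rewrite zsum0 ?mule0 ?mule_ge0 ?poweR_ge0 ?lee_fin ?(ltW C0)// => k.
  have /poweR_eq0_eq0 -> // := zsum_eq0 Br0 NE k; first by rewrite mule0.
have Np : 0 < level_norm w a by rewrite lt0e Nn0 N0.
have Noo : level_norm w a < +oo by rewrite ltey.
have [{Ophi}phi' Ophi hphi] := hc _ Br0 Np Noo.
exists phi' => //; apply: le_trans (Vpow_le mu p1 mw ma w0 a0 Ophi) _.
rewrite EFinM -muleA; apply: lee_wpmul2l; first by rewrite lee_fin e2_ge0.
pose N := fine (level_norm w a).
have NE : level_norm w a = N%:E by rewrite fineK// ge0_fin_numE// ltey.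
have N0' : (0 < N)%R by rewrite -lte_fin -NE.
apply: (@le_trans _ _ (zsum (fun k => (c `^ (1 - r^-1) * N `^ (r^-1 - 1))%:E * B w a k `^ r))).
  apply: le_zsum => k.
  have Bfin : B w a k \is a fin_num.
    rewrite ge0_fin_numE//; apply: (@lty_poweRy _ _ r) => //.
    by apply: le_lt_trans (zsum_ge_term k Br0) _; rewrite -/(level_norm w a) NE ltry.
  rewrite -(fineK Bfin); set b := fine _.
  have b0 : (0 <= b)%R by rewrite fine_ge0.
  have [->|bn0] := eqVneq b 0%R; first by rewrite mule0 poweR0r// mule0.
  have bp : (0 < b)%R by rewrite lt_neqAle eq_sym bn0.
  have [_] := hphi k; rewrite -(fineK Bfin) -/b poweR_EFin/= => hk.
  apply: le_trans (lee_wpmul2r _ (psi_pow_ub gn _ hk)) _; rewrite ?lee_fin//.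
    by rewrite mulr_gt0// divr_gt0// ?powR_gt0// -/(level_norm w a).
  rewrite -/(level_norm w a) -/N powRM ?divr_ge0 ?powR_ge0 ?(ltW c0) ?(ltW N0')//.
  rewrite powRM ?powR_ge0 ?invr_ge0 ?(ltW N0')// -powRrM.
  rewrite -(powR_inv1 (ltW N0')) -powRrM mulN1r opprB -!mulrA ler_pM2l ?powR_gt0//.
  rewrite [X in (X <= _)%R]mulrCA ler_pM2l ?powR_gt0//.
  rewrite -[X in (_ * X <= _)%R](powRr1 b0) -powRD ?bn0 ?implybT//.
  by have -> : (q * (p^-1 * (1 - r^-1)) + 1 = r)%R by field; rewrite qn0 pn0.
rewrite zsumZl ?lee_fin ?mulr_ge0 ?powR_ge0// -/(level_norm w a) NE poweR_EFin -!EFinM lee_fin.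
rewrite -mulrA -[X in (_ * (_ * X) <= _)%R](powRr1 (ltW N0')) -powRD ?subrK//.
by rewrite (gt_eqF N0') implybT.
Qed.

(** For r > 1, psi B = (B^r)^(1/r) phi^(1 - 1/r): Hoelder's inequality with exponent r, against the
    summable samples of phi. *)
Lemma Beurling_pos_le : (0 < ga)%R ->
  exists2 C : R, (0 < C)%R & forall w a phi, admissible w a -> Omega th ga phi ->
    V w a phi <= C%:E * level_norm w a `^ r^-1.
Proof.
move=> gp; have gn0 : ga != 0%R by rewrite gt_eqF.
have r1 : (0 < r^-1 < 1)%R.
  by rewrite invr_gt0 r0/= -subr_gt0 -gap mulr_gt0.
have [C C0 hC] := Omega_sum th gn0.
exists (e2 (th * p) * (1 + C))%R; first by rewrite mulr_gt0 ?e2_gt0 ?addr_gt0.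
move=> w a phi [mw ma w0 a0] Ophi; have [mphi phi0 phiI mono] := Ophi.
apply: le_trans (Vpow_le mu p1 mw ma w0 a0 Ophi) _.
rewrite EFinM -muleA; apply: lee_wpmul2l; first by rewrite lee_fin e2_ge0.
have sumphi : zsum (fun k => (phi (e2 (k + 1)%:~R))%:E) <= C%:E.
  by rewrite (zsum_shift 1 (fun k => (phi (e2 k%:~R))%:E)); exact: hC.
apply: le_trans (zsum_holder r1 (fun k => poweR_ge0 (B w a k) r)
  (fun k => phi0 _ (e2_gt0 _)) sumphi).
apply: le_zsum => k; rewrite poweRK ?Blevel_ge0// muleC lee_wpmul2l ?Blevel_ge0//.
by rewrite /psi xpowR_pos ?(ltW gp)// poweR_EFin -powRrM gap.
Qed.

(** A single phi attains the bound, also when the level sum is infinite. This gives finiteness of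
    the supremum from finiteness for each phi separately. *)
Lemma Beurling_pos_ge : (0 < ga)%R ->
  exists2 C : R, (0 < C)%R & forall w a, admissible w a ->
    exists2 phi, Omega th ga phi & level_norm w a `^ r^-1 <= C%:E * V w a phi.
Proof.
move=> gp; have gn0 : ga != 0%R by rewrite gt_eqF.
have r1 : (1 < r)%R.
  by rewrite -invf_lt1// -subr_gt0 -gap mulr_gt0.
have [c c0 hc] := Omega_regularize th0 gn0.
have cp : (0 < c `^ (1 - r^-1))%R by exact: powR_gt0.
exists (c `^ (1 - r^-1))^-1%R; first by rewrite invr_gt0.
move=> w a [mw ma w0 a0]; have B0 := Blevel_ge0 mu p th w a.
have Br0 k : 0 <= B w a k `^ r by exact: poweR_ge0.
have sg0 : (0 <= 1 - r^-1)%R by rewrite -gap mulr_ge0 ?ltW.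
have main e : (forall k, 0 <= e k) -> 0 < zsum e -> zsum e < +oo ->
    exists2 phi, Omega th ga phi &
      (c `^ (1 - r^-1) * fine (zsum e) `^ (r^-1 - 1))%:E *
        zsum (fun k => e k `^ (1 - r^-1) * B w a k) <= V w a phi.
  move=> e0 S0 Soo; have [phi Ophi hphi] := hc e e0 S0 Soo; exists phi => //.
  have S0' : (0 < fine (zsum e))%R by rewrite fine_gt0// S0 Soo.
  apply: le_trans (Vpow_ge mu p1 mw ma w0 a0 Ophi).
  rewrite -zsumZl ?lee_fin ?mulr_ge0 ?powR_ge0//; last by move=> k; rewrite mule_ge0 ?poweR_ge0.
  apply: le_zsum => k; rewrite muleA lee_wpmul2r//.
  have efin : e k \is a fin_num.
    by rewrite ge0_fin_numE//; apply: le_lt_trans Soo; exact: zsum_ge_term.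
  have ek0 : (0 <= fine (e k))%R by exact: fine_ge0.
  have [hk _] := hphi k.
  apply: le_trans (psi_pow_lb gp _ hk); last by rewrite mulr_ge0 ?(ltW c0)// divr_ge0 ?(ltW S0').
  rewrite -{1}(fineK efin) poweR_EFin -EFinM lee_fin.
  rewrite powRM ?divr_ge0 ?(ltW c0) ?(ltW S0')// powRM ?invr_ge0 ?(ltW S0')//.
  rewrite -(powR_inv1 (ltW S0')) -[((_ `^ _) `^ _)%R]powRrM mulN1r opprB.
  by rewrite -mulrA [X in (_ * X <= _)%R]mulrC.
have [NE|Nfin] := eqVneq (level_norm w a) +oo.
  (* The extremal B^r cannot be normalized here; a summable substitute with divergent pairing yields
     a phi for which V is infinite. *)
  have [e [e0 S0 Soo eB]] := gliding_hump r1 B0 NE.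
  have [phi Ophi] := main e e0 S0 Soo; rewrite eB gt0_muley; last first.
    by rewrite lte_fin mulr_gt0 ?powR_gt0// fine_gt0// S0 Soo.
  rewrite leye_eq => /eqP VE; exists phi => //.
  by rewrite VE gt0_muley ?leey// lte_fin invr_gt0.
have [NE|Nn0] := eqVneq (level_norm w a) 0.
  have [phi Ophi] := Omega_nonempty ga th0; exists phi => //.
  rewrite NE poweR0r ?invr_neq0// mule_ge0 ?lee_fin ?invr_ge0 ?(ltW cp)//.
  by apply: integral_ge0 => x _; exact: poweR_ge0.
have Np : 0 < level_norm w a by rewrite lt0e Nn0 N0.
have Noo : level_norm w a < +oo by rewrite ltey.
have [phi Ophi hV] := main _ Br0 Np Noo; exists phi => //.
pose N := fine (level_norm w a).
have NE : level_norm w a = N%:E by rewrite fineK// ge0_fin_numE// ltey.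
have N0' : (0 < N)%R by rewrite -lte_fin -NE.
rewrite -(@lee_pmul2l _ (c `^ (1 - r^-1))%:E) ?lte_fin//.
rewrite muleA -EFinM mulfV ?gt_eqF// mul1e; apply: le_trans hV.
rewrite -/(level_norm w a) -/N.
have -> : zsum (fun k => (B w a k `^ r) `^ (1 - r^-1) * B w a k) = N%:E.
  rewrite -NE; apply: eq_zsum => k; rewrite -poweRrM.
  rewrite -[X in _ * X](poweRe1 (B0 k)) -poweRD.
    by congr (_ `^ _); field; rewrite qn0 pn0.
  apply: add_neq0_poweRD_def.
  by rewrite (_ : _ + 1 = r)%R//; field; rewrite qn0 pn0.
rewrite NE poweR_EFin -!EFinM lee_fin -mulrA ler_pM2l//.
rewrite -[X in (_ <= _ * X)%R](powRr1 (ltW N0')) -powRD ?subrK//.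
by rewrite (gt_eqF N0') implybT.
Qed.

End Beurling_equivalence.

(** * Rearrangements and the Lorentz norm *)

Section level_sets.
Local Open Scope ereal_scope.
Context d (T : measurableType d) {R : realType} (mu : {measure set T -> \bar R}).
Implicit Types (F kap : T -> R) (p : R).

Definition rearr (nu : set T -> \bar R) F t : \bar R :=
  ereal_inf [set s%:E | s in
    [set s : R | (0 <= s)%R /\ (nu [set x | (s < F x)%R] <= t%:E)%E]].

Definition admissible_pair F kap := [/\ measurable_fun setT F, measurable_fun setT kap,
  forall x, (0 <= F x)%R & forall x, (0 <= kap x)%R].

Definition lev F kap (i : int) : \bar R := density mu kap [set x | (e2 i%:~R < F x)%R].

Definition Jpow F kap p E : \bar R := \int[mu]_(x in E) (F x `^ p * kap x)%:E.

Lemma rearr_ge0 nu F t : 0 <= rearr nu F t.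
Proof. by apply: le_ereal_inf_tmp => _ [s [s0 _] <-]; rewrite lee_fin. Qed.

Lemma rearr_nonincreasing nu F s t : (s <= t)%R -> rearr nu F t <= rearr nu F s.
Proof.
move=> st; apply: ereal_inf_le_tmp => _ [u [u0 us] <-]; exists u => //; split => //.
by apply: le_trans us _; rewrite lee_fin.
Qed.

Lemma rearr_le nu F s t : (0 <= s)%R -> nu [set x | (s < F x)%R] <= t%:E ->
  rearr nu F t <= s%:E.
Proof. by move=> s0 h; apply: ereal_inf_lbound; exists s. Qed.

Section fixed.
Variables (F kap : T -> R) (adm : admissible_pair F kap).

Let mF : measurable_fun setT F. Proof. by case: adm. Qed.
Let mk : measurable_fun setT kap. Proof. by case: adm. Qed.
Let F0 x : (0 <= F x)%R. Proof. by case: adm. Qed.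
Let k0 x : (0 <= kap x)%R. Proof. by case: adm. Qed.

Lemma measurable_superlevel s : measurable [set x | (s < F x)%R].
Proof.
rewrite -[X in measurable X]setTI (_ : [set x | _] = F @^-1` `]s, +oo[).
  by apply: mF => //; exact: measurable_itv.
by apply/seteqP; split => x /=; rewrite in_itv/= andbT.
Qed.

Lemma measurable_kap (E : set T) : measurable_fun E (fun x => (kap x)%:E).
Proof. by apply/measurable_EFinP; exact: measurable_funTS. Qed.

Lemma superlevel_kapE s : (fun x => if (s < F x)%R then (kap x)%:E else 0) =
    (fun x => (kap x)%:E) \_ [set x | (s < F x)%R].
Proof.
apply/funext => x; rewrite patchE; congr (if _ then _ else _).
by apply/idP/idP; rewrite inE.
Qed.

Lemma measurable_superlevel_kap s :
  measurable_fun setT (fun x => if (s < F x)%R then (kap x)%:E else 0).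
Proof.
rewrite superlevel_kapE; apply/(measurable_restrictT _ (measurable_superlevel s)).
exact: measurable_kap.
Qed.

Lemma measurable_Jpow p (E : set T) : measurable_fun E (fun x => (F x `^ p * kap x)%:E).
Proof.
apply/measurable_EFinP; apply: measurable_funTS; apply: measurable_funM => //.
exact: (measurableT_comp (measurable_powR p)).
Qed.

Lemma density_le A A' : measurable A -> measurable A' -> A `<=` A' ->
  density mu kap A <= density mu kap A'.
Proof.
move=> mA mA' AA; apply: ge0_subset_integral => //; first exact: measurable_kap.
by move=> x _; rewrite lee_fin.
Qed.

Lemma lev_ge0 i : 0 <= lev F kap i.
Proof. by apply: integral_ge0 => x _; rewrite lee_fin. Qed.

(** With [rearr_lev_lt], the inversion between distribution function and rearrangement. The two
    directions differ in strictness, which is why the geometric sums come with both strict and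
    nonstrict thresholds. *)
Lemma lev_rearr_le i t : t%:E < lev F kap i -> (e2 i%:~R)%:E <= rearr (density mu kap) F t.
Proof.
move=> ti; apply: le_ereal_inf_tmp => _ [s [s0 hs] <-]; rewrite lee_fin leNgt.
apply/negP => si; have sub : [set x | (e2 i%:~R < F x)%R] `<=` [set x | (s < F x)%R].
  by move=> x /=; exact: lt_trans.
have := density_le (measurable_superlevel _) (measurable_superlevel s) sub.
by move=> /(lt_le_trans ti) /lt_le_trans /(_ hs); rewrite ltxx.
Qed.

Lemma rearr_lev_lt i t : (e2 i%:~R)%:E < rearr (density mu kap) F t -> t%:E < lev F kap i.
Proof.
move=> h; rewrite ltNge; apply/negP => /(rearr_le (e2_ge0 _)) h'.
by have := lt_le_trans h h'; rewrite ltxx.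
Qed.

(** A layer-cake bound: where 2^i < F <= 2^(i+1), F^p is at most 2^p 2^(ip). The predicate retains
    the information on which layers meet E. *)
Lemma Jpow_le_lev p E (P : pred int) : (0 < p)%R -> measurable E ->
  (forall x i, E x -> (e2 i%:~R < F x <= e2 (i + 1)%:~R)%R -> P i) ->
  Jpow F kap p E <=
  (e2 p)%:E * zsum (fun i => if P i then (e2 (i%:~R * p))%:E * lev F kap i else 0).
Proof.
move=> p0 mE hP.
pose f i x : \bar R := if P i then (e2 (i%:~R * p))%:E *
   (if (e2 i%:~R < F x)%R then (kap x)%:E else 0) else 0.
have f0 i x : 0 <= f i x.
  by rewrite /f; case: ifP => // _; rewrite mule_ge0 ?lee_fin ?e2_ge0//; case: ifP; rewrite ?lee_fin.
have mf i : measurable_fun E (f i).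
  rewrite /f; case: (P i); last exact: measurable_cst.
  by apply: measurable_funeM; apply: measurable_funTS; exact: measurable_superlevel_kap.
apply: (@le_trans _ _ (\int[mu]_(x in E) ((e2 p)%:E * zsum (fun i => f i x)))).
  apply: ge0_le_integral => //.
  - by move=> x _; rewrite lee_fin mulr_ge0 ?powR_ge0.
  - exact: measurable_Jpow.
  - by apply: measurable_funeM; exact: measurable_zsum.
  move=> x Ex; have := F0 x; rewrite le_eqVlt => /predU1P[<-|Fx0].
    by rewrite powR0 ?gt_eqF// mul0r mule_ge0 ?zsum_ge0 ?lee_fin ?e2_ge0.
  have [i hi] := e2_floor_lt (@ltr01 R) Fx0; rewrite !mul1r in hi.
  have Pi : P i by exact: hP hi.
  apply: (@le_trans _ _ ((e2 p)%:E * f i x)); last first.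
    by rewrite lee_wpmul2l ?lee_fin ?e2_ge0//; exact: (@zsum_ge_term _ (fun i => f i x)).
  move: hi => /andP[hi1 hi2]; rewrite /f Pi hi1 -!EFinM lee_fin mulrA ler_wpM2r//.
  rewrite -e2D (_ : p + i%:~R * p = (i + 1)%:~R * p)%R; last by rewrite intrD; ring.
  by rewrite -e2M; apply: ge0_ler_powR; rewrite ?nnegrE ?e2_ge0 ?(ltW p0).
rewrite ge0_integralZl ?lee_fin ?e2_ge0//; last 2 first.
- exact: measurable_zsum.
- by move=> x _; exact: zsum_ge0.
rewrite lee_wpmul2l ?lee_fin ?e2_ge0// integral_zsum//.
apply: le_zsum => i; rewrite /f; case: (P i); last by rewrite integral0.
have mr : measurable_fun E (fun x => if (e2 i%:~R < F x)%R then (kap x)%:E else 0).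
  by apply: measurable_funTS; exact: measurable_superlevel_kap.
have r0 x : 0 <= if (e2 i%:~R < F x)%R then (kap x)%:E else 0 by case: ifP; rewrite ?lee_fin.
rewrite ge0_integralZl ?lee_fin ?e2_ge0// lee_wpmul2l ?lee_fin ?e2_ge0//.
rewrite superlevel_kapE -integral_mkcondr; apply: ge0_subset_integral => //.
- by apply: measurableI => //; exact: measurable_superlevel.
- exact: measurable_superlevel.
- exact: measurable_kap.
- by move=> x _; rewrite lee_fin.
Qed.

End fixed.

(** At each point the thresholds below F form a geometric progression with sum at most C F^p. *)
Lemma lev_le_Jpow p : (0 < p)%R ->
  exists2 C : R, (0 < C)%R & forall F kap, admissible_pair F kap ->
    zsum (fun i => (e2 (i%:~R * p))%:E * lev F kap i) <= C%:E * Jpow F kap p setT.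
Proof.
move=> p0; have [C C0 hC] := geometric_sum_le (@ltr01 R) p0.
exists C => // F kap adm; have [mF mk F0 k0] := adm.
pose f i x : \bar R := (e2 (i%:~R * p))%:E *
   (if (e2 i%:~R < F x)%R then (kap x)%:E else 0).
have f0 i x : 0 <= f i x.
  by rewrite /f; rewrite mule_ge0 ?lee_fin ?e2_ge0//; case: ifP; rewrite ?lee_fin.
have mr i := measurable_superlevel_kap adm (e2 i%:~R).
have mf i : measurable_fun setT (f i) by apply: measurable_funeM.
rewrite (_ : zsum _ = \int[mu]_x zsum (fun i => f i x)); last first.
  rewrite integral_zsum//; apply: eq_zsum => i.
  rewrite /f ge0_integralZl ?lee_fin ?e2_ge0//; last by move=> x _; case: ifP; rewrite ?lee_fin.
  by rewrite superlevel_kapE -integral_mkcond.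
rewrite -ge0_integralZl ?lee_fin ?(ltW C0)//; last 2 first.
- exact: measurable_Jpow adm _ _.
- by move=> x _; rewrite lee_fin mulr_ge0 ?powR_ge0.
apply: ge0_le_integral => //.
- by move=> x _; exact: zsum_ge0.
- exact: measurable_zsum.
- by apply: measurable_funeM; exact: measurable_Jpow adm _ _.
move=> x _; rewrite EFinM muleA; apply: le_trans (_ : zsum (fun i =>
  (if (e2 (1 * i%:~R))%:E <= (F x)%:E then (e2 (1 * i%:~R * p))%:E else 0) * (kap x)%:E) <= _).
  apply: le_zsum => i; rewrite /f !mul1r lee_fin; case: ifPn => Fi.
    by rewrite (ltW Fi).
  by rewrite mule0 mule_ge0 ?lee_fin//; case: ifP; rewrite ?lee_fin ?e2_ge0.
rewrite zsumZr ?lee_fin//; last by move=> i; case: ifP; rewrite ?lee_fin ?e2_ge0.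
by rewrite lee_wpmul2r ?lee_fin// hC ?lee_fin.
Qed.

(** Rounding m down to a power 2^(al j) < m costs 2^al, and m <= 2^(al k) forces j < k. Applied to
    the measure of a superlevel set, this brings in the arguments of the rearrangement. *)
Lemma dyadic_sum_below (al : R) (m : \bar R) (k : int) : (0 < al)%R -> 0 <= m ->
  (if m <= (e2 (al * k%:~R))%:E then m else 0) <=
  (e2 al)%:E * zsum (fun j => if (j < k)%R && ((e2 (al * j%:~R))%:E < m) then (e2 (al * j%:~R))%:E else 0).
Proof.
move=> a0 m0; set g := fun j => _.
have g0 j : 0 <= g j by rewrite /g; case: ifP; rewrite ?lee_fin ?e2_ge0.
have R0 : 0 <= (e2 al)%:E * zsum g by rewrite mule_ge0 ?zsum_ge0 ?lee_fin ?e2_ge0.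
case: ifPn => // mk; case: m m0 mk @g g0 R0 => [m| |]// m0 mk g g0 R0.
move: m0; rewrite lee_fin le_eqVlt => /predU1P[<-//|m0].
have [j /andP[jm mj]] := e2_floor_lt a0 m0.
apply: (@le_trans _ _ ((e2 al)%:E * g j)); last first.
  by rewrite lee_wpmul2l ?lee_fin ?e2_ge0//; exact: zsum_ge_term.
have jk : (j < k)%R.
  by have := lt_le_trans jm mk; rewrite lt_e2 ltr_pM2l// ltr_int.
rewrite /g jk lte_fin jm /= -EFinM lee_fin -e2D; apply: le_trans mj _.
by rewrite le_e2 intrD mulrDr mulr1 addrC.
Qed.

Lemma dyadic_sum_above (al : R) (m : \bar R) (k : int) : (0 < al)%R -> 0 <= m ->
  (if m <= (e2 (al * k%:~R))%:E then 0 else m) <=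
  (e2 al)%:E * zsum (fun j => if (k <= j)%R && ((e2 (al * j%:~R))%:E < m) then (e2 (al * j%:~R))%:E else 0).
Proof.
move=> a0 m0; set g := fun j => _.
have g0 j : 0 <= g j by rewrite /g; case: ifP; rewrite ?lee_fin ?e2_ge0.
have R0 : 0 <= (e2 al)%:E * zsum g by rewrite mule_ge0 ?zsum_ge0 ?lee_fin ?e2_ge0.
case: ifPn => //; rewrite -ltNge; case: m m0 @g g0 R0 => [m| |]// m0 g g0 R0 km; last first.
  suff -> : zsum g = +oo by rewrite gt0_muley ?leey// lte_fin e2_gt0.
  apply/eqyP => M /e2_surj[y ->]; pose j := Num.max k (Num.ceil (y / al)).
  apply: le_trans (zsum_ge_term j g0).
  rewrite /g ltry le_max lexx/= lee_fin le_e2 mulrC -ler_pdivrMr//.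
  have /andP[_ h] := ceil_itv (y / al); apply: le_trans h _.
  by rewrite ler_int le_max lexx orbT.
have m0' : (0 < m)%R by rewrite -lte_fin; apply: lt_trans km; rewrite lte_fin e2_gt0.
have [j /andP[jm mj]] := e2_floor_lt a0 m0'.
apply: (@le_trans _ _ ((e2 al)%:E * g j)); last first.
  by rewrite lee_wpmul2l ?lee_fin ?e2_ge0//; exact: zsum_ge_term.
have jk : (k <= j)%R.
  by move: km; rewrite lte_fin => km; have := lt_le_trans km mj; rewrite lt_e2 ltr_pM2l// ltr_int; lia.
rewrite /g jk lte_fin jm /= -EFinM lee_fin -e2D; apply: le_trans mj _.
by rewrite le_e2 intrD mulrDr mulr1 addrC.
Qed.

(** After exchanging the sums, the heights 2^i whose superlevel set has measure above 2^(al j) are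
    at most the rearrangement there, and their p-th powers sum geometrically. [Q] selects the range
    of j relative to k. *)
Lemma lev_sum_rearr p (al : R) : (0 < p)%R -> (0 < al)%R ->
  exists2 C : R, (0 < C)%R & forall F kap (Q : int -> int -> bool) (k : int), admissible_pair F kap ->
    zsum (fun i => (e2 (i%:~R * p))%:E * zsum (fun j =>
      if Q k j && ((e2 (al * j%:~R))%:E < lev F kap i) then (e2 (al * j%:~R))%:E else 0)) <=
    C%:E * zsum (fun j => if Q k j then (e2 (al * j%:~R))%:E *
      rearr (density mu kap) F (e2 (al * j%:~R)) `^ p else 0).
Proof.
move=> p0 a0; have [C C0 hC] := geometric_sum_le (@ltr01 R) p0.
exists C => // F kap Q k adm.
have t0 i j : 0 <= if Q k j && ((e2 (al * j%:~R))%:E < lev F kap i) then (e2 (al * j%:~R))%:E else 0 :> \bar R.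
  by case: ifP; rewrite ?lee_fin ?e2_ge0.
rewrite (_ : zsum _ = zsum (fun j => if Q k j then (e2 (al * j%:~R))%:E * zsum (fun i =>
    if (e2 (al * j%:~R))%:E < lev F kap i then (e2 (i%:~R * p))%:E else 0) else 0)); last first.
  under eq_zsum => i do rewrite -zsumZl ?lee_fin ?e2_ge0//.
  rewrite zsum_exchange; last by move=> i j; rewrite mule_ge0 ?lee_fin ?e2_ge0.
  apply: eq_zsum => j; case: ifP => Qj /=; last by rewrite /zsum esum1// => i _; rewrite mule0.
  rewrite -zsumZl ?lee_fin ?e2_ge0//; last by move=> i; case: ifP; rewrite ?lee_fin ?e2_ge0.
  by apply: eq_zsum => i; case: ifP; rewrite ?mule0// muleC.
rewrite -zsumZl ?lee_fin ?(ltW C0)//; last first.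
  by move=> j; case: ifP => // _; rewrite mule_ge0 ?poweR_ge0 ?lee_fin ?e2_ge0.
apply: le_zsum => j; case: ifP => _; last by rewrite mule0.
rewrite muleCA lee_wpmul2l ?lee_fin ?e2_ge0//.
apply: le_trans (hC _ (rearr_ge0 _ _ _)).
apply: le_zsum => i; rewrite !mul1r; case: ifPn => h; last by case: ifP; rewrite ?lee_fin ?e2_ge0.
by rewrite (lev_rearr_le adm h).
Qed.

End level_sets.

(** * The K-functional and the Lorentz norm for distinct exponents *)

Section Lorentz_equivalence.
Local Open Scope ereal_scope.
Context d (T : measurableType d) {R : realType} (mu : {measure set T -> \bar R}).
Variables (p0 p1 p q th : R).
Hypotheses (p0_ge1 : (1 <= p0)%R) (p01 : (p0 < p1)%R) (q_gt0 : (0 < q)%R).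
Hypotheses (th0 : (0 < th)%R) (th1 : (th < 1)%R).
Hypothesis pE : (p^-1 = (1 - th) / p0 + th / p1)%R.
Implicit Types (w a : T -> R).

Let p0_gt0 : (0 < p0)%R. Proof. exact: lt_le_trans ltr01 p0_ge1. Qed.
Let p1_gt0 : (0 < p1)%R. Proof. exact: lt_trans p0_gt0 p01. Qed.
Let pV_gt0 : (0 < p^-1)%R.
Proof. by rewrite pE addr_gt0 ?divr_gt0 ?subr_gt0. Qed.
Let p_gt0 : (0 < p)%R. Proof. by rewrite -invr_gt0. Qed.
Let p0n : p0 != 0%R. Proof. by rewrite gt_eqF. Qed.
Let p1n : p1 != 0%R. Proof. by rewrite gt_eqF. Qed.
Let pn : p != 0%R. Proof. by rewrite gt_eqF. Qed.
Let p10n : (p1 - p0 != 0)%R. Proof. by rewrite subr_eq0 gt_eqF. Qed.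

(** 1/al = 1/p0 - 1/p1, the exponent relating measure to time for a couple of L^p spaces: the time
    2^k corresponds to the measure 2^(al k). *)
Definition lor_exp : R := (p0 * p1 / (p1 - p0))%R.
Local Notation al := lor_exp.

Lemma lor_exp_gt0 : (0 < al)%R.
Proof. by rewrite /lor_exp divr_gt0 ?mulr_gt0 ?subr_gt0. Qed.

Let al_p0 : (al * (p^-1 - p0^-1) = - th)%R.
Proof. by rewrite pE /lor_exp; field; rewrite p10n p1n p0n. Qed.
Let al_p1 : (al * (p^-1 - p1^-1) = 1 - th)%R.
Proof. by rewrite pE /lor_exp; field; rewrite p10n p1n p0n. Qed.

Definition lorF w a x : R := (w x `^ (p1 / (p1 - p0)) * a x)%R.
Definition lork w x : R := (w x `^ (- al))%R.

Lemma adm_pair w a : admissible w a -> admissible_pair (lorF w a) (lork w).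
Proof.
move=> [mw ma w0 a0]; split.
- apply: measurable_funM => //; exact: (measurableT_comp (measurable_powR _)).
- exact: (measurableT_comp (measurable_powR _)).
- by move=> x; rewrite mulr_ge0 ?powR_ge0.
- by move=> x; rewrite powR_ge0.
Qed.

(** One identity covers s = p0, p, p1, with t = 0, th, 1 respectively. *)
Lemma lor_pointwise w a s t x : (0 < w x)%R -> (0 <= a x)%R ->
  ((s - p0) * p1 / (p1 - p0) = t * s)%R ->
  (lorF w a x `^ s * lork w x = (w x `^ t * a x) `^ s)%R.
Proof.
move=> w0 a0 st; rewrite /lorF /lork !powRM ?powR_ge0// -!powRrM mulrAC -powRD; last first.
  by rewrite (gt_eqF w0) implybT.
by congr (_ `^ _ * _)%R; rewrite -st /lor_exp; field.
Qed.

Lemma Jpow_p0 w a E : admissible w a -> Jpow mu (lorF w a) (lork w) p0 E = Ipow mu p0 E a.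
Proof.
move=> [mw ma w0 a0]; apply: eq_integral => x _.
by rewrite (@lor_pointwise w a p0 0) ?powRr0 ?mul1r// subrr !mul0r.
Qed.

Lemma Jpow_p1 w a E : admissible w a ->
  Jpow mu (lorF w a) (lork w) p1 E = Ipow mu p1 E (fun x => w x * a x)%R.
Proof.
move=> [mw ma w0 a0]; apply: eq_integral => x _.
by rewrite (@lor_pointwise w a p1 1) ?powRr1 ?(ltW (w0 x))//; field.
Qed.

Lemma Jpow_p w a E : admissible w a ->
  Jpow mu (lorF w a) (lork w) p E = Ipow mu p E (fun x => w x `^ th * a x)%R.
Proof.
move=> [mw ma w0 a0]; apply: eq_integral => x _.
rewrite (@lor_pointwise w a p th)//.
have : (p0 * p1 * p * (p^-1) = p0 * p1 * p * ((1 - th) / p0 + th / p1))%R by rewrite pE.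
have -> : (p0 * p1 * p * (p^-1) = p0 * p1)%R by field.
have -> : (p0 * p1 * p * ((1 - th) / p0 + th / p1) = p1 * p * (1 - th) + p0 * p * th)%R.
  by field; rewrite p1n p0n.
move=> h; apply: (mulIf p10n); rewrite divfK// mulrBl h; ring.
Qed.

Local Notation nu w := (density mu (lork w)).
Local Notation Fs w a k := (rearr (nu w) (lorF w a) (e2 (al * k%:~R))).
Definition lor_term w a k : \bar R := (e2 (al * k%:~R / p))%:E * Fs w a k.
Definition lor_sum w a : \bar R := zsum (fun k => lor_term w a k `^ q).

Lemma lor_term_ge0 w a k : 0 <= lor_term w a k.
Proof. by rewrite mule_ge0 ?rearr_ge0// lee_fin e2_ge0. Qed.

(* Chebyshev's inequality on E and its complement *)
Lemma superlevel_le w a E s t v : admissible w a -> measurable E -> (0 < s)%R -> (0 <= v)%R -> (0 < t)%R ->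
  Ipow mu p0 E a <= (v `^ p0)%:E ->
  Ipow mu p1 (~` E) (fun x => w x * a x)%R <= ((v / t) `^ p1)%:E ->
  nu w [set x | (s < lorF w a x)%R] <= ((v / s) `^ p0 + (v / (t * s)) `^ p1)%:E.
Proof.
move=> wa mE s0 v0 t0 X Y; have ap := adm_pair wa; have [mF mk F0 k0] := ap.
have mS := measurable_superlevel ap s; set S := [set x | _] in mS *.
have piece p' A : (0 < p')%R -> measurable A ->
    density mu (lork w) (S `&` A) <= (s `^ (- p'))%:E * Jpow mu (lorF w a) (lork w) p' A.
  move=> p'0 mA; rewrite /Jpow -ge0_integralZl//; last 2 first.
  - exact: measurable_Jpow ap _ _.
  - by move=> x _; rewrite lee_fin mulr_ge0 ?powR_ge0.
  apply: (@le_trans _ _ (\int[mu]_(x in S `&` A) ((s `^ (- p'))%:E * (lorF w a x `^ p' * lork w x)%:E))).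
    apply: ge0_le_integral => //; first exact: measurableI.
    - by move=> x _; rewrite lee_fin.
    - exact: measurable_kap ap _.
    - by apply: measurable_funeM; exact: measurable_Jpow ap _ _.
    move=> x [Sx _]; rewrite -EFinM lee_fin mulrA -[leLHS]mul1r ler_wpM2r//.
    rewrite powRN mulrC ler_pdivlMr ?powR_gt0// mul1r.
    by apply: ge0_ler_powR; rewrite ?nnegrE ?(ltW p'0) ?(ltW s0)// ltW.
  apply: ge0_subset_integral => //; first exact: measurableI.
  - by apply: measurable_funeM; exact: measurable_Jpow ap _ _.
  - by move=> x _; rewrite -EFinM lee_fin !mulr_ge0 ?powR_ge0.
have -> : nu w S = nu w (S `&` E) + nu w (S `&` ~` E).
  rewrite /density -ge0_integral_setU//.
  - by rewrite -setIUr setUCr setIT.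
  - exact: measurableI.
  - by apply: measurableI => //; exact: measurableC.
  - exact: measurable_kap ap _.
  - by move=> x _; rewrite lee_fin.
  - by apply/disj_set2P; rewrite -subset0 => x [[_ Ex] [_ nEx]].
have div0 (z r : R) : (0 <= z)%R -> ((z / s) `^ r = s `^ (- r) * z `^ r)%R.
  by move=> z0; rewrite powRM ?invr_ge0 ?(ltW s0)// -powR_inv1 ?(ltW s0)// -powRrM mulN1r mulrC.
rewrite EFinD; apply: leeD.
  apply: le_trans (piece p0 E p0_gt0 mE) _; rewrite Jpow_p0// div0// EFinM.
  by rewrite lee_wpmul2l// lee_fin powR_ge0.
apply: le_trans (piece p1 (~` E) p1_gt0 (measurableC mE)) _; rewrite Jpow_p1//.
rewrite invfM mulrA div0 ?divr_ge0 ?(ltW t0)// EFinM.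
by rewrite lee_wpmul2l// lee_fin powR_ge0.
Qed.

(** If a splitting costs v, Chebyshev's inequality shows that F exceeds a multiple of 2^(-al k/p0) v
    only on a set of measure at most 2^(al k). *)
Lemma rearr_le_Kset w a (k : int) : admissible w a ->
  Fs w a k <= (2 * e2 (- (al * k%:~R / p0)))%:E * Kset mu p0 p1 w a (e2 k%:~R).
Proof.
(* The 2 makes each of the two Chebyshev terms at most half of 2^(al k), by (1/2)^r <= 1/2 for r >=
   1. *)
move=> wa; set c := (2 * _)%R; have c0 : (0 < c)%R by rewrite mulr_gt0 ?e2_gt0.
rewrite -(@lee_pmul2l _ c^-1%:E) ?lte_fin ?invr_gt0// muleA -EFinM mulVf ?gt_eqF// mul1e.
apply: Kset_ge => E mE; set X := Ipow mu p0 E a; set Y := Ipow mu p1 (~` E) _.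
have X0 : 0 <= X := Ipow_ge0 _ _ _ _; have Y0 : 0 <= Y := Ipow_ge0 _ _ _ _.
have e20' x : 0 <= (e2 x : R)%:E by rewrite lee_fin e2_ge0.
rewrite -(@lee_pmul2l _ c%:E) ?lte_fin// muleA -EFinM mulfV ?gt_eqF// mul1e.
set V := _ + _; have V0 : 0 <= V by rewrite adde_ge0 ?mule_ge0 ?poweR_ge0.
have [VE|Vfin] := eqVneq V +oo; first by rewrite VE gt0_muley ?leey ?lte_fin.
have VE : V = (fine V)%:E by rewrite fineK// ge0_fin_numE// ltey.
set v := fine V in VE; have v0 : (0 <= v)%R by rewrite fine_ge0.
have Xle : X <= (v `^ p0)%:E.
  rewrite -[leLHS](@poweRVK _ p0)// -poweR_EFin; apply: le_poweR; rewrite ?poweR_ge0 ?(ltW p0_gt0)//.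
  by rewrite -VE /V leeDl// mule_ge0 ?poweR_ge0.
have Yle : Y <= ((v / e2 k%:~R) `^ p1)%:E.
  rewrite -[leLHS](@poweRVK _ p1)// -poweR_EFin; apply: le_poweR; rewrite ?poweR_ge0 ?(ltW p1_gt0)//.
  rewrite mulrC EFinM lee_pdivlMl ?e2_gt0// -VE /V leeDr// poweR_ge0//.
(* The slack keeps the level s positive when v = 0. *)
rewrite VE -EFinM; apply/lee_addgt0Pr => eps eps0; rewrite -EFinD.
set s := (c * v + eps)%R; have s0 : (0 < s)%R by rewrite ltr_wpDl// mulr_ge0 ?(ltW c0).
apply: rearr_le; first exact: ltW.
apply: le_trans (superlevel_le wa mE s0 v0 (e2_gt0 _) Xle Yle) _.
rewrite lee_fin.
have vs : (v / s <= c^-1)%R.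
  by rewrite ler_pdivrMr// mulrC ler_pdivlMr// mulrC lerDl ltW.
have half (u r : R) : (1 <= r)%R -> ((2^-1 * e2 u) `^ r <= 2^-1 * e2 (u * r))%R.
  move=> r1; rewrite powRM ?e2_ge0// e2M ler_wpM2r ?e2_ge0//.
  by apply: ge1r_powR => //; rewrite invr_gt0 ltr0n /= invf_le1 ?ler1n ?ltr0n.
have -> : e2 (al * k%:~R) = (2^-1 * e2 (al * k%:~R / p0 * p0) +
     2^-1 * e2 ((al * k%:~R / p0 - k%:~R) * p1) : R)%R.
  rewrite divfK// (_ : (_ - _) * p1 = al * k%:~R)%R; last by rewrite /lor_exp; field; rewrite p0n p10n.
  by field.
have cV : (c^-1 = 2^-1 * e2 (al * k%:~R / p0))%R by rewrite /c invfM e2N invrK.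
apply: lerD.
  apply: le_trans (half _ _ p0_ge1); rewrite -cV.
  by apply: ge0_ler_powR; rewrite ?nnegrE ?divr_ge0 ?invr_ge0 ?(ltW s0) ?(ltW c0) ?(ltW p0_gt0).
apply: le_trans (half _ _ (le_trans p0_ge1 (ltW p01))).
rewrite e2D e2N mulrA -cV invfM mulrCA mulrC.
apply: ge0_ler_powR; rewrite ?nnegrE ?mulr_ge0 ?divr_ge0 ?invr_ge0 ?e2_ge0 ?(ltW s0) ?(ltW c0) ?(ltW p1_gt0)//.
by rewrite ler_wpM2r ?invr_ge0 ?e2_ge0.
Qed.

Lemma lor_sum_le_Ksum : exists2 C : R, (0 < C)%R & forall w a, admissible w a ->
  lor_sum w a <= C%:E * Ksum mu p0 p1 th q w a.
Proof.
exists (2 `^ q)%R; first exact: powR_gt0.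
move=> w a wa; rewrite -zsumZl ?lee_fin ?powR_ge0//; last by move=> k; exact: poweR_ge0.
apply: le_zsum => k; rewrite -poweR_EFin -poweRM ?mule_ge0 ?Kset_ge0 ?lee_fin ?e2_ge0//.
apply: le_poweR; rewrite ?(ltW q_gt0) ?lor_term_ge0//.
apply: le_trans (lee_wpmul2l _ (rearr_le_Kset k wa)) _; first by rewrite lee_fin e2_ge0.
rewrite !muleA -!EFinM lee_wpmul2r ?Kset_ge0 ?e2_ge0// lee_fin mulrCA -e2D.
rewrite ler_pM2l// le_e2 -al_p0.
by rewrite le_eqVlt; apply/orP; left; apply/eqP; ring.
Qed.

Lemma Ksum_le_lor_sum : exists2 C : R, (0 < C)%R & forall w a, admissible w a ->
  Ksum mu p0 p1 th q w a <= C%:E * lor_sum w a.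
Proof.
have al0 := lor_exp_gt0.
have s00 : (0 < p0 * th)%R by rewrite mulr_gt0.
have s10 : (0 < p1 * (1 - th))%R by rewrite mulr_gt0// subr_gt0.
have [CY0 CY00 hY0] := zsum_young s00 (divr_gt0 q_gt0 p0_gt0).
have [CY1 CY10 hY1] := zsum_young s10 (divr_gt0 q_gt0 p1_gt0).
have [C0 C00 hC0] := lev_sum_rearr mu p0_gt0 al0.
have [C1 C10 hC1] := lev_sum_rearr mu p1_gt0 al0.
have [CD CD0 hCD] := poweRD_le (R := R) q_gt0.
(* The factors come from rounding F, from rounding the measures of its superlevel sets, and from the
   exchange of sums. *)
pose M0 := (e2 p0 * (e2 al * C0))%R; pose M1 := (e2 p1 * (e2 al * C1))%R.
have M00 : (0 < M0)%R by rewrite !mulr_gt0 ?e2_gt0.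
have M10 : (0 < M1)%R by rewrite !mulr_gt0 ?e2_gt0.
exists (CD * (M0 `^ (q / p0) * CY0 + M1 `^ (q / p1) * CY1))%R.
  by rewrite mulr_gt0// addr_gt0// mulr_gt0// powR_gt0.
move=> w a wa; have ap := adm_pair wa; have [mF mk F0 k0] := ap.
have c0 k := lor_term_ge0 w a k.
have e2p x : 0 <= (e2 x)%:E :> \bar R by rewrite lee_fin e2_ge0.
pose Z p' s k := zsum (fun j => (e2 (- s * `|(j - k)%:~R|))%:E * lor_term w a j `^ p').
have Z0 p' s k : 0 <= Z p' s k by apply: zsum_ge0 => j; rewrite mule_ge0 ?poweR_ge0.
have L0 := lev_ge0 mu ap.
(* A dyadic version of the set where F exceeds its rearrangement at 2^(al k); as a countable union
   of superlevel sets it is measurable. *)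
pose E k := [set x | exists i : int, (e2 i%:~R < lorF w a x)%R /\
                       (lev mu (lorF w a) (lork w) i <= (e2 (al * k%:~R))%:E)].
have mE k : measurable (E k).
  rewrite (_ : E k = \bigcup_n if lev mu (lorF w a) (lork w) (nat_to_int n) <= (e2 (al * k%:~R))%:E
      then [set x | (e2 (nat_to_int n)%:~R < lorF w a x)%R] else set0); last first.
    have [_ _ surj] := nat_to_int_bij.
    apply/seteqP; split => x; last first.
      by move=> [n _]; case: ifPn => // h hx; exists (nat_to_int n).
    move=> [i0 [hx hi]]; have [n _ ni] := surj i0 I; exists n => //.
    by rewrite ni hi.
  apply: bigcupT_measurable => n; case: ifP => // _.
  exact: measurable_superlevel ap _.
have X_le k : (e2 (k%:~R * - th * p0))%:E * Ipow mu p0 (E k) a <= M0%:E * Z p0 (p0 * th)%R k.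
  rewrite -(Jpow_p0 (E k) wa).
  have h1 := @Jpow_le_lev _ _ _ mu _ _ ap p0 (E k)
    (fun i0 => lev mu (lorF w a) (lork w) i0 <= (e2 (al * k%:~R))%:E) p0_gt0 (mE k).
  have {h1} h1 := h1 _.
  apply: le_trans (lee_wpmul2l (e2p _) (h1 _)) _.
    (* A point of E lies above some height 2^i1 with small superlevel set; its own layer i0 is at
       least i1, so its superlevel set is small too. Hence only j < k occur, with decay rate p0
       th. *)
    move=> x i0 [i1 [hx hi1]] /andP[_ xi0]; apply: le_trans hi1.
    apply: (density_le mu ap); [exact: measurable_superlevel ap _|exact: measurable_superlevel ap _|].
    have i10 : (i1 <= i0)%R by rewrite -ltzD1 -(ltr_int R) -lt_e2; exact: lt_le_trans hx xi0.
    by move=> y /=; apply: le_lt_trans; rewrite le_e2 ler_int.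
  have h2 := hC0 _ _ (fun k j : int => (j < k)%R) k ap.
  apply: (@le_trans _ _ ((e2 (k%:~R * - th * p0))%:E * ((e2 p0)%:E * ((e2 al)%:E *
     (C0%:E * zsum (fun j => if (j < k)%R then (e2 (al * j%:~R))%:E * Fs w a j `^ p0 else 0)))))).
    apply: lee_wpmul2l => //; apply: lee_wpmul2l => //.
    apply: le_trans (lee_wpmul2l (e2p _) h2).
    rewrite -zsumZl//; last first.
      by move=> i0; rewrite mule_ge0// zsum_ge0// => j; case: ifP => // _; rewrite lee_fin e2_ge0.
    apply: le_zsum => i0; rewrite muleCA.
    have := dyadic_sum_below k al0 (L0 i0); case: ifPn => h h3.
      by apply: lee_wpmul2l.
    by apply: mule_ge0 => //; exact: le_trans h3.
  rewrite [leLHS](_ : _ = M0%:E * ((e2 (k%:~R * - th * p0))%:E *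
     zsum (fun j => if (j < k)%R then (e2 (al * j%:~R))%:E * Fs w a j `^ p0 else 0))); last first.
    by rewrite /M0 !EFinM !muleA; congr (_ * _); rewrite -!muleA [LHS]muleC !muleA.
  apply: lee_wpmul2l; first by rewrite lee_fin ltW.
  rewrite -zsumZl//; last by move=> j; case: ifP => // _; rewrite mule_ge0 ?poweR_ge0.
  apply: le_zsum => j; case: ifPn => jk; last by rewrite mule0 mule_ge0 ?poweR_ge0.
  rewrite /lor_term poweRM ?rearr_ge0// poweR_EFin e2M !muleA lee_wpmul2r ?poweR_ge0//.
  rewrite -!EFinM -!e2D lee_fin le_e2 ltr0_norm; last by rewrite ltrz0 subr_lt0.
  rewrite intrB le_eqVlt; apply/orP; left; apply/eqP.
  rewrite (_ : th = - (al * (p^-1 - p0^-1)))%R; last by rewrite al_p0 opprK.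
  by field; rewrite pn p0n.
have Y_le k : (e2 ((k%:~R * - th + k%:~R) * p1))%:E *
    Ipow mu p1 (~` E k) (fun x => w x * a x)%R <= M1%:E * Z p1 (p1 * (1 - th))%R k.
  rewrite -(Jpow_p1 (~` E k) wa).
  have h1 := @Jpow_le_lev _ _ _ mu _ _ ap p1 (~` E k)
    (fun i0 => ~~ (lev mu (lorF w a) (lork w) i0 <= (e2 (al * k%:~R))%:E)) p1_gt0 (measurableC (mE k)).
  have {h1} h1 := h1 _.
  apply: le_trans (lee_wpmul2l (e2p _) (h1 _)) _.
    (* Off E every dyadic height below F x has a superlevel set of measure above 2^(al k), so only j
       >= k occur, with decay rate p1 (1 - th). *)
    move=> x i0 Ex /andP[ix _]; apply/negP => hi; apply: Ex; exists i0; split => //.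
  have h2 := hC1 _ _ (fun k j : int => (k <= j)%R) k ap.
  apply: (@le_trans _ _ ((e2 ((k%:~R * - th + k%:~R) * p1))%:E * ((e2 p1)%:E * ((e2 al)%:E *
     (C1%:E * zsum (fun j => if (k <= j)%R then (e2 (al * j%:~R))%:E * Fs w a j `^ p1 else 0)))))).
    apply: lee_wpmul2l => //; apply: lee_wpmul2l => //.
    apply: le_trans (lee_wpmul2l (e2p _) h2).
    rewrite -zsumZl//; last first.
      by move=> i0; rewrite mule_ge0// zsum_ge0// => j; case: ifP => // _; rewrite lee_fin e2_ge0.
    apply: le_zsum => i0; rewrite muleCA.
    have := dyadic_sum_above k al0 (L0 i0); case: ifPn => h h3 /=.
      by apply: mule_ge0 => //; exact: le_trans h3.
    by apply: lee_wpmul2l.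
  rewrite [leLHS](_ : _ = M1%:E * ((e2 ((k%:~R * - th + k%:~R) * p1))%:E *
     zsum (fun j => if (k <= j)%R then (e2 (al * j%:~R))%:E * Fs w a j `^ p1 else 0))); last first.
    by rewrite /M1 !EFinM !muleA; congr (_ * _); rewrite -!muleA [LHS]muleC !muleA.
  apply: lee_wpmul2l; first by rewrite lee_fin ltW.
  rewrite -zsumZl//; last by move=> j; case: ifP => // _; rewrite mule_ge0 ?poweR_ge0.
  apply: le_zsum => j; case: ifPn => jk; last by rewrite mule0 mule_ge0 ?poweR_ge0.
  rewrite /lor_term poweRM ?rearr_ge0// poweR_EFin e2M !muleA lee_wpmul2r ?poweR_ge0//.
  rewrite -!EFinM -!e2D lee_fin le_e2 ger0_norm; last by rewrite ler0z subr_ge0.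
  rewrite intrB le_eqVlt; apply/orP; left; apply/eqP.
  rewrite (_ : th = 1 - (al * (p^-1 - p1^-1)))%R; last by rewrite al_p1; ring.
  by field; rewrite pn p1n.
have root p' (p'0 : (0 < p')%R) (x : R) X : 0 <= X -> (e2 x)%:E * X `^ p'^-1 = ((e2 (x * p'))%:E * X) `^ p'^-1.
  by move=> X0; rewrite poweRM// poweR_EFin e2M mulfK// gt_eqF.
have term k : ((e2 (k%:~R * - th))%:E * Kset mu p0 p1 w a (e2 k%:~R)) `^ q <=
    CD%:E * ((M0%:E * Z p0 (p0 * th)%R k) `^ (q / p0) + (M1%:E * Z p1 (p1 * (1 - th))%R k) `^ (q / p1)).
  have Kle := Kset_le mu p0 p1 w a (e2 k%:~R) (mE k).
  have := lee_wpmul2l (e2p (k%:~R * - th)%R) Kle.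
  rewrite ge0_muleDr ?poweR_ge0 ?mule_ge0 ?poweR_ge0// muleA -EFinM -e2D.
  rewrite !root ?Ipow_ge0// => h.
  apply: (@le_trans _ _ (((M0%:E * Z p0 (p0 * th)%R k) `^ p0^-1 + (M1%:E * Z p1 (p1 * (1 - th))%R k) `^ p1^-1) `^ q)).
    apply: le_poweR; rewrite ?(ltW q_gt0) ?mule_ge0 ?Kset_ge0 ?e2_ge0//.
    apply: le_trans h _; apply: leeD; apply: le_poweR; rewrite ?invr_ge0 ?(ltW p0_gt0) ?(ltW p1_gt0) ?mule_ge0 ?Ipow_ge0//.
  apply: le_trans (hCD _ _ (poweR_ge0 _ _) (poweR_ge0 _ _)) _.
  by rewrite -!poweRrM ![(_^-1 * q)%R]mulrC.
apply: le_trans (le_zsum term) _.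
rewrite zsumZl ?lee_fin ?(ltW CD0)//; last by move=> k; rewrite adde_ge0 ?poweR_ge0.
rewrite [(CD * _)%:E]EFinM -[leRHS]muleA lee_wpmul2l ?lee_fin ?(ltW CD0)//.
rewrite zsumD//; try by move=> k; exact: poweR_ge0.
rewrite EFinD ge0_muleDl ?lee_fin ?mulr_ge0 ?powR_ge0 ?(ltW CY00) ?(ltW CY10)//.
have fin (p' s M CY : R) (p'0 : (0 < p')%R) : (0 < M)%R ->
   (forall x : int -> \bar R, (forall j, 0 <= x j) ->
    zsum (fun k => (zsum (fun j => (e2 (- s * `|(j - k)%:~R|))%:E * x j)) `^ (q / p'))
    <= CY%:E * zsum (fun j => x j `^ (q / p'))) ->
   zsum (fun k => (M%:E * Z p' s k) `^ (q / p')) <= (M `^ (q / p') * CY)%:E * lor_sum w a.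
  move=> M0' h; have -> : zsum (fun k => (M%:E * Z p' s k) `^ (q / p')) =
      (M `^ (q / p'))%:E * zsum (fun k => Z p' s k `^ (q / p')).
    rewrite -zsumZl ?lee_fin ?powR_ge0//; last by move=> k; exact: poweR_ge0.
    by apply: eq_zsum => k; rewrite poweRM ?lee_fin ?(ltW M0').
  rewrite EFinM -muleA lee_wpmul2l ?lee_fin ?powR_ge0//.
  apply: le_trans (h (fun j => lor_term w a j `^ p') _) _; first by move=> j; exact: poweR_ge0.
  rewrite (_ : zsum _ = lor_sum w a)//; apply: eq_zsum => j.
  by rewrite -poweRrM; congr (_ `^ _); field; rewrite gt_eqF.
by apply: leeD; apply: fin.
Qed.

Lemma Ksum_lor_sum : comparable_on (@admissible_pairs d T R)
  (fun wa => Ksum mu p0 p1 th q wa.1 wa.2) (fun wa => lor_sum wa.1 wa.2).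
Proof.
have [M M0 hM] := Ksum_le_lor_sum; have [N N0 hN] := lor_sum_le_Ksum.
apply: (comparable_on_le M0 N0) => -[w a] wa.
by split; [apply: zsum_ge0 => k; exact: poweR_ge0..|exact: hM|exact: hN].
Qed.

End Lorentz_equivalence.

(** * The Lorentz norm with equal indices is a Lebesgue norm *)

Section Lorentz_diagonal.
Local Open Scope ereal_scope.
Context d (T : measurableType d) {R : realType} (mu : {measure set T -> \bar R}).
Variables (p0 p1 p th : R).
Hypotheses (p0_ge1 : (1 <= p0)%R) (p01 : (p0 < p1)%R).
Hypotheses (th0 : (0 < th)%R) (th1 : (th < 1)%R).
Hypothesis pE : (p^-1 = (1 - th) / p0 + th / p1)%R.
Implicit Types (w a : T -> R).
Local Notation al := (lor_exp p0 p1).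

Let p0_gt0 : (0 < p0)%R. Proof. exact: lt_le_trans ltr01 p0_ge1. Qed.
Let p1_gt0 : (0 < p1)%R. Proof. exact: lt_trans p0_gt0 p01. Qed.
Let pV_gt0 : (0 < p^-1)%R.
Proof. by rewrite pE addr_gt0 ?divr_gt0 ?subr_gt0. Qed.
Let p_gt0 : (0 < p)%R. Proof. by rewrite -invr_gt0. Qed.
Let pn : p != 0%R. Proof. by rewrite gt_eqF. Qed.

Let termE w a j : lor_term mu p0 p1 p w a j `^ p =
  (e2 (al * j%:~R))%:E * rearr (density mu (lork p0 p1 w)) (lorF p0 p1 w a) (e2 (al * j%:~R)) `^ p.
Proof.
by rewrite /lor_term poweRM ?rearr_ge0 ?lee_fin ?e2_ge0// poweR_EFin e2M divfK.
Qed.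

(** Layer-cake in the height 2^i, then each measure [lev] is bounded by the sum of the powers 2^(al
    j) below it, and the sums are exchanged. *)
Lemma Ipow_le_lor_sum : exists2 C : R, (0 < C)%R & forall w a, admissible w a ->
  Ipow mu p setT (fun x => w x `^ th * a x)%R <= C%:E * lor_sum mu p0 p1 p p w a.
Proof.
have al0 := lor_exp_gt0 p0_ge1 p01.
have [C0 C00 hC0] := lev_sum_rearr mu p_gt0 al0.
have [C1 C10 hC1] := geometric_sum_ge al0 (@ltr01 R).
exists (e2 p * (C1 * C0))%R; first by rewrite !mulr_gt0 ?e2_gt0.
move=> w a wa; have ap := adm_pair p0 p1 wa.
rewrite -(Jpow_p mu p0_ge1 p01 th0 th1 pE setT wa).
have L0 := lev_ge0 mu ap.
apply: le_trans (@Jpow_le_lev _ _ _ mu _ _ ap p setT xpredT p_gt0 measurableT _) _ => //.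
rewrite !EFinM -!muleA lee_wpmul2l ?lee_fin ?e2_ge0//.
have := hC0 _ _ (fun _ _ => true) 0%R ap => h.
have -> : lor_sum mu p0 p1 p p w a = zsum (fun j => (e2 (al * j%:~R))%:E *
   rearr (density mu (lork p0 p1 w)) (lorF p0 p1 w a) (e2 (al * j%:~R)) `^ p).
  by apply: eq_zsum => j; rewrite termE.
apply: le_trans (lee_wpmul2l _ h); last by rewrite lee_fin ltW.
rewrite -zsumZl ?lee_fin ?(ltW C10)//; last first.
  move=> i0; rewrite mule_ge0 ?lee_fin ?e2_ge0// zsum_ge0// => j.
  by case: ifP; rewrite ?lee_fin ?e2_ge0.
apply: le_zsum => i0; rewrite muleCA lee_wpmul2l ?lee_fin ?e2_ge0//.
have := hC1 _ (L0 i0); rewrite poweRe1// => h1; apply: le_trans h1 _.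
rewrite lee_wpmul2l ?lee_fin ?(ltW C10)//; apply: le_zsum => j.
by rewrite /= mulr1.
Qed.

(** The reverse order: expand the p-th power of the rearrangement over the heights below it,
    exchange, and sum the measures 2^(al j) geometrically up to [lev]. *)
Lemma lor_sum_le_Ipow : exists2 C : R, (0 < C)%R & forall w a, admissible w a ->
  lor_sum mu p0 p1 p p w a <= C%:E * Ipow mu p setT (fun x => w x `^ th * a x)%R.
Proof.
have al0 := lor_exp_gt0 p0_ge1 p01.
have [C0 C00 hC0] := lev_le_Jpow mu p_gt0.
have [C1 C10 hC1] := geometric_sum_ge (@ltr01 R) p_gt0.
have [C2 C20 hC2] := geometric_sum_le al0 (@ltr01 R).
exists (C1 * (C2 * C0))%R; first by rewrite !mulr_gt0.
move=> w a wa; have ap := adm_pair p0 p1 wa.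
rewrite -(Jpow_p mu p0_ge1 p01 th0 th1 pE setT wa).
have L0 := lev_ge0 mu ap.
have e2p x : 0 <= (e2 x)%:E :> \bar R by rewrite lee_fin e2_ge0.
set F := lorF p0 p1 w a; set kp := lork p0 p1 w.
rewrite !EFinM -!muleA.
apply: le_trans (lee_wpmul2l _ (lee_wpmul2l _ (hC0 _ _ ap))); rewrite ?lee_fin ?(ltW C10) ?(ltW C20)//.
pose t i j : \bar R := if (e2 (al * j%:~R))%:E <= lev mu F kp i then (e2 (al * j%:~R))%:E else 0.
have t0 i j : 0 <= t i j by rewrite /t; case: ifP.
apply: (@le_trans _ _ (C1%:E * zsum (fun j => zsum (fun i => (e2 (i%:~R * p))%:E * t i j)))).
  rewrite -zsumZl ?lee_fin ?(ltW C10)//; last by move=> j; apply: zsum_ge0 => i0; rewrite mule_ge0.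
  apply: le_zsum => j; rewrite termE -/F -/kp.
  apply: le_trans (lee_wpmul2l (e2p _) (hC1 _ (rearr_ge0 _ _ _))) _.
  rewrite muleCA lee_wpmul2l ?lee_fin ?(ltW C10)//.
  rewrite -zsumZl//; last by move=> i0; case: ifP.
  apply: le_zsum => i0; rewrite !mul1r; case: ifPn => h; last by rewrite mule0 mule_ge0.
  by rewrite /t (ltW (rearr_lev_lt h)) muleC.
rewrite lee_wpmul2l ?lee_fin ?(ltW C10)// zsum_exchange; last by move=> j i0; rewrite mule_ge0.
rewrite -zsumZl ?lee_fin ?(ltW C20)//; last by move=> i0; rewrite mule_ge0.
apply: le_zsum => i0; rewrite zsumZl// muleCA lee_wpmul2l//.
have := hC2 _ (L0 i0); rewrite poweRe1// -/F -/kp => h2; apply: le_trans h2.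
by apply: le_zsum => j; rewrite /t mulr1.
Qed.

Lemma lor_sum_Ipow : comparable_on (@admissible_pairs d T R)
  (fun wa => lor_sum mu p0 p1 p p wa.1 wa.2)
  (fun wa => Ipow mu p setT (fun x => wa.1 x `^ th * wa.2 x)%R).
Proof.
have [M M0 hM] := lor_sum_le_Ipow; have [N N0 hN] := Ipow_le_lor_sum.
apply: (comparable_on_le M0 N0) => -[w a] wa.
split; [|exact: Ipow_ge0|exact: hM|exact: hN].
by apply: zsum_ge0 => k; exact: poweR_ge0.
Qed.

End Lorentz_diagonal.

(** * The diagonal case *)

Section diagonal_K_sum.
Local Open Scope ereal_scope.
Context d (T : measurableType d) {R : realType} (mu : {measure set T -> \bar R}).
Implicit Types (w a : T -> R).

(** The symmetry K(t; X0, X1) = t K(1/t; X1, X0): complement E and take w a as the function, so that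
    the new weight is 1/w. *)
Lemma Kset_swap_le p0 p1 w a t : (forall x, 0 < w x)%R -> (0 < t)%R ->
  t%:E * Kset mu p1 p0 (fun x => (w x)^-1)%R (fun x => w x * a x)%R (t^-1)%R <= Kset mu p0 p1 w a t.
Proof.
move=> w0 t0; apply: Kset_ge => E mE.
apply: le_trans (lee_wpmul2l _ (Kset_le mu p1 p0 _ _ (t^-1)%R (measurableC mE))) _.
  by rewrite lee_fin ltW.
rewrite setCK ge0_muleDr ?mule_ge0 ?poweR_ge0 ?lee_fin ?invr_ge0 ?(ltW t0)//.
rewrite muleA -EFinM divff ?gt_eqF// mul1e addeC.
have -> : (fun x => (w x)^-1 * (w x * a x))%R = a.
  by apply/funext => x; rewrite mulKf// gt_eqF.
exact: lexx.
Qed.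

Lemma Kset_swap p0 p1 w a t : (forall x, 0 < w x)%R -> (0 < t)%R ->
  Kset mu p0 p1 w a t = t%:E * Kset mu p1 p0 (fun x => (w x)^-1)%R (fun x => w x * a x)%R (t^-1)%R.
Proof.
move=> w0 t0; apply/eqP; rewrite eq_le Kset_swap_le// andbT.
have := @Kset_swap_le p1 p0 (fun x => (w x)^-1)%R (fun x => w x * a x)%R (t^-1)%R.
have -> : (fun x => (w x)^-1^-1)%R = w by apply/funext => x; rewrite invrK.
have -> : (fun x => (w x)^-1 * (w x * a x))%R = a.
  by apply/funext => x; rewrite mulKf// gt_eqF.
rewrite invrK => h; rewrite -(@lee_pmul2l _ (t^-1)%:E) ?lte_fin ?invr_gt0//.
rewrite muleA -EFinM mulVf ?gt_eqF// mul1e; apply: h; last by rewrite invr_gt0.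
by move=> x; rewrite invr_gt0.
Qed.

Lemma Ksum_swap p0 p1 th q w a : (forall x, 0 < w x)%R ->
  Ksum mu p0 p1 th q w a =
  Ksum mu p1 p0 (1 - th)%R q (fun x => (w x)^-1)%R (fun x => w x * a x)%R.
Proof.
move=> w0; rewrite /Ksum -[RHS]zsum_opp; apply: eq_zsum => k; congr (_ `^ _).
rewrite Kset_swap ?e2_gt0// muleA -EFinM -e2D -e2N -intrN; congr ((e2 _)%:E * _).
by rewrite intrN; ring.
Qed.

Lemma Vpow_ga0 p th phi w a : admissible w a ->
  Vpow mu p th 0 w a phi = Ipow mu p setT (fun x => w x `^ th * a x)%R.
Proof.
move=> [_ _ w0 a0]; apply: eq_integral => x _.
by rewrite /Omega_fun xpowR_pos// powRr0 mule1 -EFinM poweR_EFin mulrC.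
Qed.

Lemma Ksum_diagonal p0 p1 q th : (1 <= p0)%R -> (1 <= p1)%R -> (0 < th)%R -> (th < 1)%R ->
  (q^-1 = (1 - th) / p0 + th / p1)%R ->
  comparable_on (@admissible_pairs d T R) (fun wa => Ksum mu p0 p1 th q wa.1 wa.2)
    (fun wa => Ipow mu q setT (fun x => wa.1 x `^ th * wa.2 x)%R).
Proof.
have lt_case p p' th' : (1 <= p)%R -> (1 <= p')%R -> (0 < th')%R -> (th' < 1)%R ->
    (q^-1 = (1 - th') / p + th' / p')%R -> (p < p')%R ->
    comparable_on (@admissible_pairs d T R) (fun wa => Ksum mu p p' th' q wa.1 wa.2)
      (fun wa => Ipow mu q setT (fun x => wa.1 x `^ th' * wa.2 x)%R).
  move=> pge1 pge1' t0 t1 qE pp'.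
  have q0 : (0 < q)%R.
    by rewrite -invr_gt0 qE addr_gt0// divr_gt0 ?subr_gt0// (lt_le_trans ltr01).
  exact: (comparable_on_trans (Ksum_lor_sum mu pge1 pp' q0 t0 t1 qE)
    (lor_sum_Ipow mu pge1 pp' t0 t1 qE)).
move=> p0_ge1 p1_ge1 th0 th1 qE; have [p01|p10|p01] := ltgtP p0 p1.
- exact: lt_case.
- have qE' : (q^-1 = (1 - (1 - th)) / p1 + (1 - th) / p0)%R by rewrite qE; ring.
  have [||C C0 h] := lt_case p1 p0 (1 - th)%R p1_ge1 p0_ge1 _ _ qE' p10.
  + by rewrite subr_gt0.
  + by rewrite ltrBlDr ltrDl.
  exists C => // -[w a] wa; have [mw ma w0 a0] := wa; rewrite /= (Ksum_swap p0 p1 th q a w0).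
  have wa' : admissible (fun x => (w x)^-1)%R (fun x => w x * a x)%R.
    split.
    + have -> : (fun x => (w x)^-1)%R = (fun x => w x `^ (-1))%R.
        by apply/funext => x; rewrite powR_inv1// ltW.
      exact: (measurableT_comp (measurable_powR _)).
    + exact: measurable_funM.
    + by move=> x; rewrite invr_gt0.
    + by move=> x; rewrite mulr_ge0// ltW.
  have -> : (fun x => w x `^ th * a x)%R = (fun x => (w x)^-1 `^ (1 - th) * (w x * a x))%R.
    apply/funext => x; rewrite mulrA; congr (_ * _)%R.
    rewrite -powR_inv1 ?(ltW (w0 x))// -powRrM -[X in (_ = _ * X)%R]powRr1 ?(ltW (w0 x))//.
    by rewrite -powRD ?(gt_eqF (w0 x)) ?implybT//; congr (_ `^ _)%R; ring.
  exact: (h (_, _) wa').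
(* For p0 = p1 the Beurling exponent ga is 0 and [Vpow] is the integral of (w^th a)^q whatever phi
   is, so the two Beurling bounds give the claim. *)
have qp : q = p0.
  by apply: invr_inj; rewrite qE -p01; field; rewrite gt_eqF// (lt_le_trans ltr01).
rewrite -p01 qp; have p00 : (0 < p0)%R := lt_le_trans ltr01 p0_ge1.
have th01 : (0 < th < 1)%R by rewrite th0.
apply: (comparable_on_trans (Ksum_same mu p0_ge1 p00 th01)).
have g0 : (p0^-1 - p0^-1 <= 0)%R by rewrite subrr.
have [C C0 h] := Beurling_neg_ge mu th p0_ge1 p00 g0.
have [D D0 k] := Beurling_neg_le mu p0_ge1 p00 th0 g0.
have r1 : (p0 / p0 = 1)%R by rewrite divff// gt_eqF.
apply: (comparable_on_le C0 D0) => -[w a]; rewrite /admissible_pairs /= => wa.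
have L0 : 0 <= level_norm mu p0 p0 th w a by apply: zsum_ge0 => j; exact: poweR_ge0.
split; [exact: L0|exact: Ipow_ge0| |].
  have [phi Ophi] := Omega_nonempty (p0^-1 - p0^-1)%R th0.
  have := h w a phi wa Ophi; rewrite subrr Vpow_ga0// => H; apply: le_trans H _.
  by rewrite r1 poweRe1 ?Ipow_ge0.
have [phi Ophi] := k w a wa; rewrite subrr Vpow_ga0// => H; apply: le_trans H _.
by rewrite r1 invr1 (poweRe1 L0) /level_norm r1.
Qed.

End diagonal_K_sum.

(** * Linear algebra and measurability of complex matrices *)

Local Open Scope complex_scope.
Local Open Scope sesquilinear_scope.

Section unitary_diagonalization.
Context {C : numClosedFieldType}.

Lemma ctmxM m n p (A : 'M[C]_(m, n)) (B : 'M[C]_(n, p)) : (A *m B)^t* = B^t* *m A^t*.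
Proof. by rewrite trmx_mul map_mxM. Qed.

Lemma unitarymx_ct n (U : 'M[C]_n) : U \is unitarymx -> U^t* *m U = 1%:M.
Proof. by move=> Uu; rewrite -(invmx_unitary Uu) mulVmx ?unitarymx_unit. Qed.

Lemma unitarymx_tc n (U : 'M[C]_n) : U \is unitarymx -> U *m U^t* = 1%:M.
Proof. by move=> Uu; rewrite -(invmx_unitary Uu) mulmxV ?unitarymx_unit. Qed.

Lemma unitarymx_tstar n (U : 'M[C]_n) : U \is unitarymx -> U^t* \is unitarymx.
Proof. by move=> Uu; apply/unitarymxP; rewrite trmxCK; exact: unitarymx_ct. Qed.

Lemma hermsymP n (A : 'M[C]_n) : reflect (A^t* = A) (A \is hermsymmx).
Proof.
rewrite is_hermitianmxE expr0 scale1r; apply: (iffP eqP) => [h|h]; first by rewrite -h.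
by rewrite h.
Qed.

Lemma gram_entry_ge0 n m (A : 'M[C]_(m, n)) j : 0 <= (A^t* *m A) j j.
Proof.
rewrite mxE sumr_ge0// => i _; rewrite !mxE mulrC.
by rewrite -normCK exprn_ge0.
Qed.

Lemma diag_mx_ct n (w : 'rV[C]_n) : (forall j, 0 <= w 0 j) -> (diag_mx w)^t* = diag_mx w.
Proof.
move=> w0; apply/matrixP => i j; rewrite !mxE eq_sym; case: eqVneq => [->|_].
  by rewrite !mulr1n geC0_conj.
by rewrite !mulr0n rmorph0.
Qed.

(* a unitary intertwining two diagonal matrices also intertwines f of them *)
Lemma diag_calculus n (V P : 'M[C]_n) (a b : 'rV[C]_n) (f : C -> C) :
  V \is unitarymx -> P \is unitarymx ->
  V^t* *m diag_mx a *m V = P^t* *m diag_mx b *m P ->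
  V^t* *m diag_mx (map_mx f a) *m V = P^t* *m diag_mx (map_mx f b) *m P.
Proof.
move=> Vu Pu E; pose Q := P *m V^t*.
have Qw : Q *m diag_mx a = diag_mx b *m Q.
  transitivity (P *m (V^t* *m diag_mx a *m V) *m V^t*).
    by rewrite /Q -!mulmxA unitarymx_tc// mulmx1.
  by rewrite E /Q !mulmxA unitarymx_tc// mul1mx.
have Qf : Q *m diag_mx (map_mx f a) = diag_mx (map_mx f b) *m Q.
  apply/matrixP => i j; have h : Q i j * a 0 j = b 0 i * Q i j.
    by have /matrixP/(_ i j) := Qw; rewrite mul_mx_diag mul_diag_mx [LHS]mxE [RHS]mxE.
  rewrite mul_mx_diag mul_diag_mx [LHS]mxE [RHS]mxE ![map_mx _ _ _ _]mxE.
  have [->|Qn0] := eqVneq (Q i j) 0; first by rewrite mul0r mulr0.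
  have -> : b 0 i = a 0 j by apply: (mulIf Qn0); rewrite -h mulrC.
  by rewrite mulrC.
have VE : V^t* = P^t* *m Q by rewrite /Q mulmxA unitarymx_ct// mul1mx.
rewrite [in LHS]VE -[P^t* *m Q *m _]mulmxA Qf.
by rewrite /Q !mulmxA -[_ *m V^t* *m V]mulmxA unitarymx_ct// mulmx1.
Qed.

(** The diagonal factor is itself the Gram matrix of A P^-1, hence has nonnegative entries. *)
Lemma gram_spectral n (A : 'M[C]_n) (M := A^t* *m A) :
  M = (spectralmx M)^t* *m diag_mx (spectral_diag M) *m spectralmx M /\
  forall j, 0 <= spectral_diag M 0 j.
Proof.
have Mh : M \is hermsymmx by apply/hermsymP; rewrite /M ctmxM trmxCK.
have /hermitian_normalmx/orthomx_spectralP := Mh.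
set P := spectralmx M; set dd := spectral_diag M => ME.
have Pu : P \is unitarymx := spectral_unitarymx _.
rewrite (invmx_unitary Pu) in ME; split => // j.
have ddE : diag_mx dd = (A *m P^t*)^t* *m (A *m P^t*).
  rewrite ctmxM trmxCK !mulmxA -(mulmxA P) -/M ME !mulmxA unitarymx_tc// mul1mx.
  by rewrite -mulmxA unitarymx_tc// mulmx1.
by have := gram_entry_ge0 (A *m P^t*) j; rewrite -ddE mxE eqxx mulr1n.
Qed.

(** Here P^-1 diag(s) P is the square root of the Gram matrix of A. Invertibility of A excludes zero
    entries of D. *)
Lemma diag_factor_gt0 n (A P U D : 'M[C]_n) (s : 'rV[C]_n) :
  A \in unitmx -> P \is unitarymx -> U \is unitarymx -> is_diag_mx D ->
  (forall j, 0 <= s 0 j) ->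
  A^t* *m A = P^t* *m diag_mx (\row_j (s 0 j * s 0 j)) *m P ->
  P^t* *m diag_mx s *m P = U *m D *m U^t* ->
  [/\ forall j, 0 < D j j, D = diag_mx (\row_j D j j) &
      A^t* *m A = (D *m U^t*)^t* *m (D *m U^t*)].
Proof.
move=> Au Pu Uu /is_diag_mxP Dd s0 AA SU.
have UU := unitarymx_ct Uu; have PP := unitarymx_tc Pu.
(* D is only assumed diagonal; being congruent to diag(s) makes its entries nonnegative. *)
have DE : D = (P *m U)^t* *m diag_mx s *m (P *m U).
  transitivity (U^t* *m (P^t* *m diag_mx s *m P) *m U); last by rewrite ctmxM !mulmxA.
  by rewrite SU !mulmxA UU mul1mx -mulmxA UU mulmx1.
have Ddiag : D = diag_mx (\row_j D j j).
  apply/matrixP => i j; rewrite !mxE; case: eqVneq => [->|ij]; first by rewrite mulr1n.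
  by rewrite mulr0n Dd.
have D0 j : 0 <= D j j.
  rewrite DE mxE sumr_ge0// => i _; rewrite mul_mx_diag !mxE.
  by rewrite mulrAC mulr_ge0// mulrC -normCK exprn_ge0.
have Dct : D^t* = D by rewrite Ddiag diag_mx_ct// => j; rewrite mxE.
have SS : A^t* *m A = (U *m D *m U^t*) *m (U *m D *m U^t*).
  rewrite -SU AA !mulmxA -[_ *m P *m P^t*]mulmxA PP mulmx1.
  congr (_ *m _); rewrite -mulmxA; congr (_ *m _); rewrite mulmx_diag; congr diag_mx.
have Du : D \in unitmx.
  have : A^t* *m A \in unitmx by rewrite unitmx_mul Au andbT map_unitmx unitmx_tr.
  by rewrite SS !unitmx_mul (unitarymx_unit Uu) (unitarymx_unit (unitarymx_tstar Uu)) andbT/= andbb.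
split => //.
  move=> j; rewrite lt_neqAle D0 andbT eq_sym; apply/negP => /eqP wz.
  have : D *m delta_mx j (ord0 : 'I_1) = 0.
    apply/matrixP => i k; rewrite Ddiag mul_diag_mx !mxE.
    by case: eqVneq => [->|_]; rewrite ?wz ?mul0r ?mulr0.
  move/(congr1 (mulmx (invmx D))); rewrite mulKmx// mulmx0 => /matrixP/(_ j ord0).
  by rewrite !mxE !eqxx => /eqP; rewrite oner_eq0.
rewrite SS ctmxM trmxCK Dct !mulmxA; congr (_ *m _ *m _).
by rewrite -[_ *m U^t* *m U]mulmxA UU mulmx1.
Qed.

End unitary_diagonalization.

Section pointwise_linear_algebra.
Context {R : realType}.
Local Notation C := R[i].

Lemma normc_sq (z : C) : ((Normc.normc z) ^+ 2)%:C = Num.conj z * z.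
Proof. by rewrite mulrC -normCK normc_def -rmorphXn; case: z. Qed.

Lemma cvnorm_ge0 n (v : 'cV[C]_n) : 0 <= cvnorm v.
Proof. exact: sqrtr_ge0. Qed.

Lemma cvnorm_sq n (v : 'cV[C]_n) : ((cvnorm v) ^+ 2)%:C = (v^t* *m v) ord0 ord0.
Proof.
rewrite /cvnorm sqr_sqrtr; last by apply: sumr_ge0 => i _; rewrite sqr_ge0.
by rewrite mxE rmorph_sum; apply: eq_bigr => i _; rewrite /= !mxE normc_sq.
Qed.

(** The norm of A v depends on A through its Gram matrix only; this takes the place of a polar
    decomposition. *)
Lemma cvnorm_gram m n p (A : 'M[C]_(m, n)) (B : 'M[C]_(p, n)) (v : 'cV[C]_n) :
  A^t* *m A = B^t* *m B -> cvnorm (A *m v) = cvnorm (B *m v).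
Proof.
move=> AB; suff h : (cvnorm (A *m v)) ^+ 2 = (cvnorm (B *m v)) ^+ 2.
  by apply/eqP; rewrite -(@eqrXn2 _ 2)// ?cvnorm_ge0// h.
apply: (@complexI R); rewrite !cvnorm_sq !ctmxM -!mulmxA (mulmxA _ A) (mulmxA _ B) AB.
reflexivity.
Qed.

Lemma cvnorm_unitary n (U : 'M[C]_n) (v : 'cV[C]_n) : U \is unitarymx -> cvnorm (U *m v) = cvnorm v.
Proof.
move=> Uu; rewrite -[v in RHS]mul1mx; apply: cvnorm_gram.
by rewrite (unitarymx_ct Uu) mulmx1 trmx1 map_mx1.
Qed.

Definition rdiag n (w : 'I_n -> R) : 'M[C]_n := diag_mx (\row_j (w j)%:C).

Lemma rdiag_mul n (w : 'I_n -> R) (v : 'cV[C]_n) : rdiag w *m v = \col_j ((w j)%:C * v j ord0).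
Proof. by apply/colP => j; rewrite /rdiag mul_diag_mx !mxE. Qed.

Lemma ge0_complexE (z : C) : 0 <= z -> 0 <= complex.Re z /\ z = (complex.Re z)%:C.
Proof.
move=> z0; have := ger0_Im z0; move: z0; rewrite lecE => /andP[_ h].
by case: z h => x y /= h ->.
Qed.

(** [mxpowR] uses its own choice of diagonalization; the lemma transfers the absolute value and its
    powers to the given U and D. *)
Lemma mxabs_diag n (A U D : 'M[C]_n) (th : R) :
  A \in unitmx -> U \is unitarymx -> is_diag_mx D -> mxabs A = U *m D *m U^t* ->
  let w j := complex.Re (D j j) in
  [/\ forall j, 0 < w j,
      forall v : 'cV[C]_n, cvnorm (A *m v) = cvnorm (rdiag w *m U^t* *m v) &
      mxpowR (mxabs A) th = U *m rdiag (fun j => w j `^ th) *m U^t*].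
Proof.
move=> Au Uu Dd UDU w.
have [ME dd0] := gram_spectral A.
have Pu := spectral_unitarymx (A^t* *m A).
have SE : mxabs A = (spectralmx (A^t* *m A))^t* *m
    diag_mx (map_mx (fun z : C => (complex.Re z `^ 2^-1)%:C) (spectral_diag (A^t* *m A))) *m
    spectralmx (A^t* *m A).
  by rewrite -(invmx_unitary Pu).
move: (spectralmx _) (spectral_diag _) ME dd0 Pu SE => P dd ME dd0 Pu SE.
set s := map_mx _ dd in SE.
have sE j : s 0 j = (Num.sqrt (complex.Re (dd 0 j)))%:C.
  by have [d0 _] := ge0_complexE (dd0 j); rewrite /s mxE powR12_sqrt.
have s0 j : 0 <= s 0 j by rewrite sE ler0c sqrtr_ge0.
have ddE : dd = \row_j (s 0 j * s 0 j).
  apply/rowP => j; have [d0 dE] := ge0_complexE (dd0 j).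
  by rewrite [RHS]mxE sE -rmorphM -expr2 sqr_sqrtr.
rewrite ddE in ME; rewrite SE in UDU.
have [D0 Ddiag AA] := diag_factor_gt0 Au Pu Uu Dd s0 ME UDU.
have w0 j : 0 < w j by have := D0 j; rewrite ltcE => /andP[].
have DD : D = rdiag w.
  rewrite Ddiag /rdiag; congr diag_mx; apply/rowP => j; rewrite [LHS]mxE [RHS]mxE.
  by have [_ ->] := ge0_complexE (ltW (D0 j)).
split; first exact: w0.
  by move=> v; apply: cvnorm_gram; rewrite AA DD.
have Utu := unitarymx_tstar Uu.
have Sh : mxabs A \is hermsymmx.
  apply/hermsymP; rewrite SE UDU !ctmxM trmxCK mulmxA; congr (_ *m _ *m _).
  by rewrite Ddiag; apply: diag_mx_ct => j; rewrite mxE ltW.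
have /hermitian_normalmx/orthomx_spectralP := Sh.
have Qu := spectral_unitarymx (mxabs A).
(* Two diagonalizations of |A|, by U and by [spectralmx]. U is written as a double adjoint to match
   the shape of [diag_calculus]. *)
rewrite (invmx_unitary Qu) {1}SE UDU DD -{1}[U]trmxCK => E.
have := diag_calculus (fun z : C => (complex.Re z `^ th)%:C) Utu Qu E.
rewrite /mxpowR (invmx_unitary Qu) => <-; rewrite trmxCK; congr (_ *m diag_mx _ *m _).
by apply/rowP => j; rewrite [LHS]mxE [RHS]mxE [(\row__ _) _ _]mxE.
Qed.

Lemma posdefmx_unit n (A : 'M[C]_n) : posdefmx A -> A \in unitmx.
Proof.
move=> [_ pd]; rewrite -unitmx_tr -row_free_unit -kermx_eq0.
apply/negP => /negP/rowV0Pn[u /sub_kermxP uA un0].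
have vn0 : u^T != 0 by rewrite -trmx0 (inj_eq trmx_inj).
have := pd _ vn0; rewrite -mulmxA -[A *m u^T]trmxK trmx_mul trmxK uA trmx0 mulmx0.
by rewrite mxE ltxx.
Qed.

(** The interface to the analysis, which uses the matrices through these norm identities. The last
    clause serves the measurability of the weight |W1 W0^-1|^theta W0. *)
Lemma matrix_weight_pointwise n (W0 W1 U D : 'M[C]_n) (th : R) :
  posdefmx W0 -> posdefmx W1 -> U \is unitarymx -> is_diag_mx D ->
  mxabs (W1 *m invmx W0) = U *m D *m invmx U ->
  let w j := complex.Re (D j j) in
  [/\ forall j, 0 < w j,
      forall v : 'cV[C]_n, cvnorm (W0 *m v) = cvnorm (invmx U *m W0 *m v),
      forall v : 'cV[C]_n, cvnorm (W1 *m v) =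
        cvnorm (\col_j ((w j)%:C * (invmx U *m W0 *m v) j ord0)),
      forall v : 'cV[C]_n, cvnorm (mxpowR (mxabs (W1 *m invmx W0)) th *m W0 *m v) =
        cvnorm (\col_j ((w j `^ th)%:C * (invmx U *m W0 *m v) j ord0)) &
      mxpowR (mxabs (W1 *m invmx W0)) th = U *m rdiag (fun j => w j `^ th) *m invmx U].
Proof.
move=> /posdefmx_unit W0u /posdefmx_unit W1u Uu Dd.
have Au : W1 *m invmx W0 \in unitmx by rewrite unitmx_mul W1u unitmx_inv.
have Utu := unitarymx_tstar Uu.
rewrite (invmx_unitary Uu) => UDU w.
have [w0 Av Apow] := mxabs_diag th Au Uu Dd UDU.
split; first exact: w0.
- by move=> v; rewrite -(mulmxA _ W0 v) (cvnorm_unitary _ Utu).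
- move=> v; rewrite -rdiag_mul -(mulmxA _ W0 v) mulmxA -Av.
  by rewrite -(mulmxA W1) (mulmxA (invmx W0)) mulVmx ?mul1mx.
- move=> v; rewrite -rdiag_mul Apow -!mulmxA.
  rewrite (cvnorm_unitary _ Uu).
  reflexivity.
exact: Apow.
Qed.

Lemma normc_ge0 (z : C) : 0 <= Normc.normc z.
Proof. by case: z => a b; exact: sqrtr_ge0. Qed.

Lemma normc_le_cvnorm n (v : 'cV[C]_n) j : Normc.normc (v j ord0) <= cvnorm v.
Proof.
rewrite -(@ler_pXn2r _ 2) ?nnegrE ?normc_ge0 ?cvnorm_ge0//.
rewrite /cvnorm sqr_sqrtr; last by apply: sumr_ge0 => i _; rewrite sqr_ge0.
by rewrite (bigD1 j)//= lerDl sumr_ge0// => i _; rewrite sqr_ge0.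
Qed.

Lemma cvnorm_le_sum n (v : 'cV[C]_n) : cvnorm v <= \sum_(j < n) Normc.normc (v j ord0).
Proof.
have s0 : 0 <= \sum_(j < n) Normc.normc (v j ord0) by apply: sumr_ge0 => j _; exact: normc_ge0.
rewrite -(@ler_pXn2r _ 2) ?nnegrE ?cvnorm_ge0//.
rewrite /cvnorm sqr_sqrtr; last by apply: sumr_ge0 => i _; rewrite sqr_ge0.
rewrite expr2 mulr_suml; apply: ler_sum => i _; rewrite expr2.
apply: ler_wpM2l; first exact: normc_ge0.
by rewrite (bigD1 i)//= lerDl sumr_ge0// => j _; exact: normc_ge0.
Qed.

Lemma normc_real_mul (x : R) (z : C) : 0 <= x -> Normc.normc (x%:C * z) = x * Normc.normc z.
Proof.
move=> x0; rewrite Normc.normcM; congr (_ * _).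
by rewrite /Normc.normc /= expr0n/= addr0 sqrtr_sqr ger0_norm.
Qed.

End pointwise_linear_algebra.

(** * Measurability of complex and matrix-valued functions *)

Section measurable_complex.
Context d (T : measurableType d) (R : realType).
Local Notation C := R[i].
Implicit Types f g : T -> C.

Lemma measurable_cfun_cst (c : C) : measurable_cfun (fun _ : T => c).
Proof. by split. Qed.

Lemma measurable_cfun_real (w : T -> R) : measurable_fun setT w ->
  measurable_cfun (fun x => (w x)%:C).
Proof. by move=> mw; split. Qed.

Lemma measurable_cfunD f g : measurable_cfun f -> measurable_cfun g ->
  measurable_cfun (fun x => f x + g x).
Proof.
move=> [fr fi] [gr gi]; split.
  rewrite (_ : (fun x => _) = (fun x => complex.Re (f x)) \+ (fun x => complex.Re (g x))).
    exact: measurable_funD.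
  by apply/funext => x /=; case: (f x); case: (g x).
rewrite (_ : (fun x => _) = (fun x => complex.Im (f x)) \+ (fun x => complex.Im (g x))).
  exact: measurable_funD.
by apply/funext => x /=; case: (f x); case: (g x).
Qed.

Lemma measurable_cfunM f g : measurable_cfun f -> measurable_cfun g ->
  measurable_cfun (fun x => f x * g x).
Proof.
move=> [fr fi] [gr gi]; split.
  rewrite (_ : (fun x => _) = (fun x => complex.Re (f x)) \* (fun x => complex.Re (g x))
                              \- (fun x => complex.Im (f x)) \* (fun x => complex.Im (g x))).
    by apply: measurable_funB; exact: measurable_funM.
  by apply/funext => x /=; case: (f x); case: (g x).
rewrite (_ : (fun x => _) = (fun x => complex.Re (f x)) \* (fun x => complex.Im (g x))
                              \+ (fun x => complex.Im (f x)) \* (fun x => complex.Re (g x))).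
  by apply: measurable_funD; exact: measurable_funM.
by apply/funext => x /=; case: (f x); case: (g x).
Qed.

Lemma measurable_cfunB f g : measurable_cfun f -> measurable_cfun g ->
  measurable_cfun (fun x => f x - g x).
Proof.
move=> mf mg; have -> : (fun x => f x - g x) = (fun x => f x + -1 * g x).
  by apply/funext => x; rewrite mulN1r.
by apply: measurable_cfunD => //; apply: measurable_cfunM => //; exact: measurable_cfun_cst.
Qed.

Lemma measurable_cfun_sum (I : Type) (r : seq I) (F : I -> T -> C) :
  (forall i, measurable_cfun (F i)) -> measurable_cfun (fun x => \sum_(i <- r) F i x).
Proof.
move=> mF; elim: r => [|i r ih].
  by under eq_fun do rewrite big_nil; exact: measurable_cfun_cst.
by under eq_fun do rewrite big_cons; exact: measurable_cfunD.
Qed.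

Lemma measurable_cfun_prod (I : Type) (r : seq I) (F : I -> T -> C) :
  (forall i, measurable_cfun (F i)) -> measurable_cfun (fun x => \prod_(i <- r) F i x).
Proof.
move=> mF; elim: r => [|i r ih].
  by under eq_fun do rewrite big_nil; exact: measurable_cfun_cst.
by under eq_fun do rewrite big_cons; exact: measurable_cfunM.
Qed.

Lemma measurable_cfunV f : measurable_cfun f -> measurable_cfun (fun x => (f x)^-1).
Proof.
move=> [fr fi].
pose m x := (complex.Re (f x) ^+ 2 + complex.Im (f x) ^+ 2) `^ (-1).
have mm : measurable_fun setT m.
  apply: (measurableT_comp (measurable_powR _)).
  by apply: measurable_funD; exact: measurable_funX.
have mE x : m x = (complex.Re (f x) ^+ 2 + complex.Im (f x) ^+ 2)^-1.
  by rewrite /m powR_inv1// addr_ge0// sqr_ge0.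
split.
  rewrite (_ : (fun x => _) = (fun x => complex.Re (f x)) \* m); first exact: measurable_funM.
  by apply/funext => x /=; rewrite mE; case: (f x).
rewrite (_ : (fun x => _) = (fun x => - (complex.Im (f x))) \* m).
  by apply: measurable_funM => //; exact: measurableT_comp.
by apply/funext => x /=; rewrite mE; case: (f x) => a b /=; rewrite mulNr.
Qed.

Lemma measurable_cfun_if f g (b : T -> bool) : measurable_fun setT b ->
  measurable_cfun f -> measurable_cfun g -> measurable_cfun (fun x => if b x then f x else g x).
Proof.
move=> mb [fr fi] [gr gi]; split.
  rewrite (_ : (fun x => _) = (fun x => if b x then complex.Re (f x) else complex.Re (g x))).
    exact: measurable_fun_ifT.
  by apply/funext => x; case: (b x).
rewrite (_ : (fun x => _) = (fun x => if b x then complex.Im (f x) else complex.Im (g x))).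
  exact: measurable_fun_ifT.
by apply/funext => x; case: (b x).
Qed.

Lemma measurable_normc f : measurable_cfun f -> measurable_fun setT (fun x => Normc.normc (f x)).
Proof.
move=> [fr fi]; rewrite (_ : (fun x => _) =
    (fun x => (complex.Re (f x) ^+ 2 + complex.Im (f x) ^+ 2) `^ 2^-1)).
  apply: (measurableT_comp (measurable_powR _)).
  by apply: measurable_funD; exact: measurable_funX.
apply/funext => x; rewrite powR12_sqrt ?addr_ge0 ?sqr_ge0//.
by case: (f x).
Qed.

Lemma measurable_cfun_neq0 f : measurable_cfun f -> measurable_fun setT (fun x => f x != 0).
Proof.
move=> mf; rewrite (_ : (fun x => _) = (fun x => 0 < Normc.normc (f x))).
  by apply: measurable_fun_ltr => //; exact: measurable_normc.
apply/funext => x; rewrite lt_def normc_ge0 andbT; congr (~~ _).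
apply/eqP/eqP => [->|/Normc.eq0_normc//]; exact: Normc.normc0.
Qed.

End measurable_complex.

Section measurable_matrices.
Context d (T : measurableType d) (R : realType).
Local Notation C := R[i].

Lemma measurable_mxfunB m n (F G : T -> 'M[C]_(m, n)) :
  measurable_mxfun F -> measurable_mxfun G -> measurable_mxfun (fun x => F x - G x).
Proof.
move=> mF mG i j; rewrite (_ : (fun x => _) = (fun x => F x i j - G x i j)).
  exact: measurable_cfunB.
by apply/funext => x; rewrite !mxE.
Qed.

Lemma measurable_mulmx m n p (F : T -> 'M[C]_(m, n)) (G : T -> 'M[C]_(n, p)) :
  measurable_mxfun F -> measurable_mxfun G -> measurable_mxfun (fun x => F x *m G x).
Proof.
move=> mF mG i j; rewrite (_ : (fun x => _) = (fun x => \sum_k F x i k * G x k j)).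
  by apply: measurable_cfun_sum => k; exact: measurable_cfunM.
by apply/funext => x; rewrite mxE.
Qed.

Lemma measurable_det n (F : T -> 'M[C]_n) :
  measurable_mxfun F -> measurable_cfun (fun x => \det (F x)).
Proof.
move=> mF; apply: measurable_cfun_sum => s; apply: measurable_cfunM.
  exact: measurable_cfun_cst.
by apply: measurable_cfun_prod => i; exact: mF.
Qed.

Lemma measurable_invmx n (F : T -> 'M[C]_n) :
  measurable_mxfun F -> measurable_mxfun (fun x => invmx (F x)).
Proof.
move=> mF i j; rewrite (_ : (fun x => _) = (fun x =>
    (* Cramer's formula; on singular matrices [invmx] returns its argument. *)
    if \det (F x) != 0 then (\det (F x))^-1 * cofactor (F x) j i else F x i j)).
  apply: measurable_cfun_if.
  - by apply: measurable_cfun_neq0; exact: measurable_det.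
  - apply: measurable_cfunM.
      by apply: measurable_cfunV; exact: measurable_det.
    apply: measurable_cfunM; first exact: measurable_cfun_cst.
    apply: measurable_det => k l.
    by under eq_fun do rewrite !mxE; exact: mF.
  - exact: mF.
apply/funext => x; rewrite /invmx unitmxE unitfE; case: ifP => _ //.
by rewrite !mxE.
Qed.

Lemma measurable_cvnorm n (f : T -> 'cV[C]_n) :
  measurable_mxfun f -> measurable_fun setT (fun x => cvnorm (f x)).
Proof.
move=> mf; rewrite (_ : (fun x => _) =
    (fun x => (\sum_(i < n) Normc.normc (f x i ord0) ^+ 2) `^ 2^-1)).
  apply: (measurableT_comp (measurable_powR _)).
  apply: measurable_sum => i; apply: measurable_funX; apply: measurable_normc; exact: mf.
apply/funext => x; rewrite powR12_sqrt//.
by apply: sumr_ge0 => i _; rewrite sqr_ge0.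
Qed.

End measurable_matrices.

Section almost_everywhere.
Context d (T : measurableType d) (R : realType) (mu : {measure set T -> \bar R}).

Lemma ae_measurable_real (f g : T -> R) : measure_is_complete mu ->
  {ae mu, forall x, f x = g x} -> measurable_fun setT f -> measurable_fun setT g.
Proof.
move=> cmu fg mf; apply/measurable_EFinP; apply: (@ae_measurable_fun _ _ _ mu cmu setT (EFin \o f)).
  by apply: filterS fg => x /= -> _.
exact/measurable_EFinP.
Qed.

Lemma ae_measurable_mxfun m n (F G : T -> 'M[R[i]]_(m, n)) : measure_is_complete mu ->
  {ae mu, forall x, F x = G x} -> measurable_mxfun F -> measurable_mxfun G.
Proof.
move=> cmu FG mF i j; have [mr mi] := mF i j.
split; [apply: ae_measurable_real cmu _ mr|apply: ae_measurable_real cmu _ mi];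
  by apply: filterS FG => x /= ->.
Qed.

End almost_everywhere.

(** * The vector-valued K-functional *)

Section Ipow_bounds.
Local Open Scope ereal_scope.
Context d (T : measurableType d) (R : realType) (mu : {measure set T -> \bar R}).

Lemma Lnorm_Ipow p (F : T -> R) : (forall x, 0 <= F x)%R ->
  Lnorm mu p%:E (fun x => (F x)%:E) = Ipow mu p setT F `^ p^-1.
Proof.
move=> F0; rewrite unlock; congr (_ `^ _); apply: eq_integral => x _.
by rewrite abse_EFin ger0_norm.
Qed.

Lemma ae_Ipow_le p E c (a b : T -> R) : (0 < p)%R -> (0 <= c)%R -> measurable E ->
  measurable_fun setT a -> measurable_fun setT b ->
  (forall x, 0 <= a x)%R -> (forall x, 0 <= b x)%R ->
  {ae mu, forall x, E x -> (a x <= c * b x)%R} ->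
  Ipow mu p E a `^ p^-1 <= c%:E * Ipow mu p setT b `^ p^-1.
Proof.
move=> p0 c0 mE ma mb a0 b0 ab.
have -> : c%:E = ((c `^ p)%:E : \bar R) `^ p^-1.
  by rewrite poweR_EFin -powRrM divff ?gt_eqF// powRr1.
rewrite -poweRM ?Ipow_ge0//; apply: le_poweR; rewrite ?Ipow_ge0 ?invr_ge0 ?(ltW p0)//.
rewrite /Ipow -ge0_integralZl//; last exact: measurable_powR_EFin.
apply: (@le_trans _ _ (\int[mu]_(x in E) ((c `^ p)%:E * (b x `^ p)%:E))); last first.
  apply: ge0_subset_integral => //.
    by apply: measurable_funeM; exact: measurable_powR_EFin.
  by move=> x _; rewrite -EFinM lee_fin mulr_ge0 ?powR_ge0.
apply: ae_ge0_le_integral => //.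
- by apply: measurable_funTS; exact: measurable_powR_EFin.
- by move=> x _; rewrite -EFinM lee_fin mulr_ge0 ?powR_ge0.
- by apply: measurable_funTS; apply: measurable_funeM; exact: measurable_powR_EFin.
apply: filterS ab => x abx Ex; rewrite -EFinM lee_fin -powRM//.
by apply: ge0_ler_powR; rewrite ?nnegrE ?mulr_ge0 ?(ltW p0) ?abx.
Qed.

Lemma Ipow_sum_le p n : (0 < p)%R -> exists2 C : R, (0 < C)%R &
  forall b : 'I_n -> T -> R, (forall j, measurable_fun setT (b j)) ->
    (forall j x, 0 <= b j x)%R ->
  Ipow mu p setT (fun x => \sum_(j < n) b j x)%R `^ p^-1 <=
    C%:E * \sum_(j < n) Ipow mu p setT (b j) `^ p^-1.
Proof.
move=> p0; have pV0 : (0 < p^-1)%R by rewrite invr_gt0.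
have [C1 C10 h1] := @poweR_sum_le R n _ p0; have [C2 C20 h2] := @poweR_sum_le R n _ pV0.
exists (C1 `^ p^-1 * C2)%R; first by rewrite mulr_gt0 ?powR_gt0.
move=> b mb b0.
have sI0 : 0 <= \sum_(j < n) Ipow mu p setT (b j) by apply: sume_ge0 => j _; exact: Ipow_ge0.
have le1 : Ipow mu p setT (fun x => \sum_(j < n) b j x)%R <=
    C1%:E * \sum_(j < n) Ipow mu p setT (b j).
  rewrite /Ipow -ge0_integral_sum//; last by move=> j; exact: measurable_powR_EFin.
  rewrite -ge0_integralZl//; last 3 first.
  - by apply: emeasurable_sum => j; exact: measurable_powR_EFin.
  - by move=> x _; apply: sume_ge0 => j _; exact: powR_EFin_ge0.
  - by rewrite lee_fin ltW.
  apply: ge0_le_integral => //.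
  - by apply: measurable_powR_EFin; exact: measurable_sum.
  - by apply: measurable_funeM; apply: emeasurable_sum => j; exact: measurable_powR_EFin.
  move=> x _; rewrite (_ : (_ `^ p)%:E = (\sum_(j < n) (b j x)%:E) `^ p).
    by apply: (h1 (fun j => (b j x)%:E)) => j; rewrite lee_fin.
  by rewrite sumEFin.
apply: le_trans (le_poweR (ltW pV0) (Ipow_ge0 _ _ _ _) le1) _.
rewrite poweRM ?lee_fin ?(ltW C10)// poweR_EFin EFinM -muleA.
apply: lee_wpmul2l; first exact: powR_EFin_ge0.
by apply: (h2 (fun j => Ipow mu p setT (b j))) => j; exact: Ipow_ge0.
Qed.

Lemma Ipow_restrict p E (a : T -> R) : (p != 0)%R ->
  Ipow mu p setT (fun x => if x \in E then a x else 0%R) = Ipow mu p E a.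
Proof.
move=> pn0; rewrite /Ipow [RHS]integral_mkcond; apply: eq_integral => x _.
by rewrite patchE; case: ifP => // _; rewrite powR0.
Qed.

End Ipow_bounds.

Definition coord {T : Type} {R : realType} n (G : T -> 'M[R[i]]_n) (f : T -> 'cV[R[i]]_n)
  (j : 'I_n) (x : T) : R := Normc.normc ((G x *m f x) j ord0).

(** * Weighted vector norms in terms of coordinates *)

Section coordinatewise_norm.
Local Open Scope ereal_scope.
Context d (T : measurableType d) (R : realType) (mu : {measure set T -> \bar R}).
Local Notation C := R[i].
Variables (n : nat) (p : R) (M G : T -> 'M[C]_n) (v : 'I_n -> T -> R).
Hypotheses (p_gt0 : (0 < p)%R) (mM : measurable_mxfun M) (mG : measurable_mxfun G).
Hypotheses (mv : forall j, measurable_fun setT (v j)) (v0 : forall j x, (0 < v j x)%R).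
Hypothesis ME : {ae mu, forall x (u : 'cV[C]_n), cvnorm (M x *m u) =
  cvnorm (\col_j ((v j x)%:C * (G x *m u) j ord0)%R)}.
Implicit Types f : T -> 'cV[C]_n.

Lemma coord_ge0 f j x : (0 <= coord G f j x)%R. Proof. exact: normc_ge0. Qed.

Lemma measurable_coord f j : measurable_mxfun f -> measurable_fun setT (coord G f j).
Proof. by move=> mf; apply: measurable_normc; exact: (measurable_mulmx mG mf). Qed.

(** The section is applied with (M, v) equal to (W0, 1), (W1, w) and (|W1 W0^-1|^theta W0, w^theta).
    The majorants b_j will be the pieces of a coordinate on a set or its complement. *)
Lemma fnorm_weighted_le f (b : 'I_n -> T -> R) : measurable_mxfun f ->
  (forall j, measurable_fun setT (b j)) -> (forall j x, 0 <= b j x)%R ->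
  {ae mu, forall x j, (v j x * coord G f j x <= b j x)%R} ->
  fnorm (weighted (Lp mu n p) M) f <= Ipow mu p setT (fun x => \sum_(j < n) b j x)%R `^ p^-1.
Proof.
move=> mf mb b0 fb; rewrite /fnorm/= Lnorm_Ipow; last by move=> x; exact: cvnorm_ge0.
rewrite -[leRHS]mul1e; apply: ae_Ipow_le => //.
- by apply: measurable_cvnorm; exact: measurable_mulmx.
- exact: measurable_sum.
- by move=> x; exact: cvnorm_ge0.
- by move=> x; apply: sumr_ge0 => j _; exact: b0.
apply: filterS2 ME fb => x h fbx _; rewrite mul1r h.
apply: (le_trans (cvnorm_le_sum _)); apply: ler_sum => j _.
by rewrite mxE normc_real_mul ?(ltW (v0 j x)).
Qed.

Lemma Ipow_le_fnorm_weighted f j (E : set T) (a : T -> R) c : measurable_mxfun f ->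
  measurable E -> measurable_fun setT a -> (forall x, 0 <= a x)%R -> (0 <= c)%R ->
  {ae mu, forall x, E x -> (a x <= c * (v j x * coord G f j x))%R} ->
  Ipow mu p E a `^ p^-1 <= c%:E * fnorm (weighted (Lp mu n p) M) f.
Proof.
move=> mf mE ma a0 c0 h; rewrite /fnorm/= Lnorm_Ipow; last by move=> x; exact: cvnorm_ge0.
apply: ae_Ipow_le => //.
- by apply: measurable_cvnorm; exact: measurable_mulmx.
- by move=> x; exact: cvnorm_ge0.
apply: filterS2 ME h => x e hx Ex; rewrite e; apply: le_trans (hx Ex) _.
apply: ler_wpM2l => //; rewrite -(normc_real_mul _ (ltW (v0 j x))).
by have := normc_le_cvnorm (\col_j0 ((v j0 x)%:C * (G x *m f x) j0 ord0)%R) j; rewrite mxE.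
Qed.

End coordinatewise_norm.

Section comparability.
Local Open Scope ereal_scope.
Context {R : realType}.

Lemma comparable_on_sum (F : Type) n (P : set F) (A B : F -> 'I_n -> \bar R) :
  (forall f j, P f -> 0 <= A f j) -> (forall f j, P f -> 0 <= B f j) ->
  comparable_on [set fj | P fj.1] (fun fj => A fj.1 fj.2) (fun fj => B fj.1 fj.2) ->
  comparable_on P (fun f => \sum_(j < n) A f j) (fun f => \sum_(j < n) B f j).
Proof.
move=> A0 B0 [M M0 h]; exists M => // f Pf; split.
  rewrite ge0_sume_distrr; last by move=> j _; exact: B0.
  by apply: lee_sum => j _; have [] := h (f, j) Pf.
rewrite ge0_sume_distrr; last by move=> j _; exact: A0.
by apply: lee_sum => j _; have [] := h (f, j) Pf.
Qed.

Lemma sume_const n (x : \bar R) : 0 <= x -> \sum_(j < n) x = (n%:R)%:E * x.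
Proof.
move=> x0; rewrite (eq_bigr (fun=> 1%:E * x)); last by move=> j _; rewrite mul1e.
by rewrite -ge0_sume_distrl// sumEFin sumr_const card_ord.
Qed.

Lemma comparable_on_poweR_sum (F : Type) n (P : set F) q (A : F -> 'I_n -> \bar R) : (0 < q)%R ->
  (forall f j, P f -> 0 <= A f j) ->
  comparable_on P (fun f => (\sum_(j < n) A f j) `^ q) (fun f => \sum_(j < n) A f j `^ q).
Proof.
move=> q0 A0; have [M M0 h] := @poweR_sum_le R n _ q0.
exists (M + n.+1%:R)%R; first by rewrite addr_gt0.
move=> f Pf; split.
  apply: le_trans (h _ _) _; first by move=> j; exact: A0.
  apply: lee_wpmul2r; first by apply: sume_ge0 => j _; exact: poweR_ge0.
  by rewrite lee_fin lerDl.
apply: (@le_trans _ _ (\sum_(j < n) (\sum_(i < n) A f i) `^ q)).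
  apply: lee_sum => j _; apply: le_poweR; [exact: ltW|exact: A0|].
  by rewrite (bigD1 j)//= leeDl// sume_ge0// => i _; exact: A0.
rewrite sume_const; last exact: poweR_ge0.
apply: lee_wpmul2r; first exact: poweR_ge0.
by rewrite lee_fin ler_wpDl ?(ltW M0)// ler_nat.
Qed.

(** When the carriers consist of the elements of P of finite norm, a comparison on all of P,
    infinite values included, also identifies the carriers. *)
Lemma eq_fspace_comparable T V (X Y : fspace R T V) (P : set (T -> V)) q : (0 < q)%R ->
  (forall f, fcarrier X f <-> P f /\ fnorm X f < +oo) ->
  (forall f, fcarrier Y f <-> P f /\ fnorm Y f < +oo) ->
  (forall f, P f -> 0 <= fnorm X f) -> (forall f, P f -> 0 <= fnorm Y f) ->
  comparable_on P (fun f => fnorm X f `^ q) (fun f => fnorm Y f `^ q) ->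
  eq_fspace X Y.
Proof.
move=> q0 cX cY X0 Y0 [M M0 h].
pose c := (M `^ q^-1)%R; have c0 : (0 < c)%R by exact: powR_gt0.
have root x y : 0 <= x -> 0 <= y -> x `^ q <= M%:E * y `^ q -> x <= c%:E * y.
  move=> x0 y0 /(le_poweRV q0 x0); rewrite mule_ge0 ?poweR_ge0 ?lee_fin ?(ltW M0)// => /(_ isT).
  by rewrite poweRM ?poweR_ge0 ?lee_fin ?(ltW M0)// poweRK// gt_eqF.
have XY f : P f -> fnorm X f <= c%:E * fnorm Y f.
  by move=> Pf; apply: root; [exact: X0|exact: Y0|exact: (h f Pf).1].
have YX f : P f -> fnorm Y f <= c%:E * fnorm X f.
  by move=> Pf; apply: root; [exact: Y0|exact: X0|exact: (h f Pf).2].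
split.
  apply/seteqP; split => f; rewrite cX cY => -[Pf fin]; split => //.
    by apply: le_lt_trans (YX f Pf) _; rewrite lte_mul_pinfty ?lee_fin ?(ltW c0).
  by apply: le_lt_trans (XY f Pf) _; rewrite lte_mul_pinfty ?lee_fin ?(ltW c0).
exists c^-1%R, c; split => //; first by rewrite invr_gt0.
move=> f /cX[Pf _]; split; last exact: XY.
by rewrite -(@lee_pmul2l _ c%:E)// muleA -EFinM divff ?gt_eqF// mul1e; exact: YX.
Qed.

End comparability.

(** * Reduction of the vector K-functional to scalar set splittings *)

Section vector_K_functional.
Local Open Scope ereal_scope.
Context d (T : measurableType d) (R : realType) (mu : {measure set T -> \bar R}).
Local Notation C := R[i].
Variables (n : nat) (p0 p1 : R) (W0 W1 G V : T -> 'M[C]_n) (w : 'I_n -> T -> R).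
Hypotheses (p0_gt0 : (0 < p0)%R) (p1_gt0 : (0 < p1)%R).
Hypotheses (mW0 : measurable_mxfun W0) (mW1 : measurable_mxfun W1).
Hypotheses (mG : measurable_mxfun G) (mV : measurable_mxfun V).
Hypotheses (mw : forall j, measurable_fun setT (w j)) (w0 : forall j x, (0 < w j x)%R).
Hypothesis W0E : {ae mu, forall x (v : 'cV[C]_n), cvnorm (W0 x *m v) = cvnorm (G x *m v)}.
Hypothesis W1E : {ae mu, forall x (v : 'cV[C]_n), cvnorm (W1 x *m v) =
  cvnorm (\col_j ((w j x)%:C * (G x *m v) j ord0)%R)}.
Hypothesis GV : {ae mu, forall x, G x *m V x = 1%:M}.

Local Notation X0 := (weighted (Lp mu n p0) W0).
Local Notation X1 := (weighted (Lp mu n p1) W1).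
Local Notation coord := (coord G).

Let W0E1 : {ae mu, forall x (u : 'cV[C]_n), cvnorm (W0 x *m u) =
  cvnorm (\col_j (1%:C * (G x *m u) j ord0)%R)}.
Proof.
apply: filterS W0E => x h u; rewrite h; congr cvnorm.
by apply/colP => j; rewrite [RHS]mxE mul1r.
Qed.

Lemma Kset_le_Kfun (f : T -> 'cV[C]_n) j t : measurable_mxfun f -> (0 < t)%R ->
  Kset mu p0 p1 (w j) (coord f j) t <= 2%:E * Kfun mu X0 X1 t f.
Proof.
move=> mf t0; rewrite -(@lee_pmul2l _ (2^-1)%:E) ?lte_fin ?invr_gt0// muleA -EFinM mulVf// mul1e.
apply: le_ereal_inf_tmp => _ [[f0 f1] /= [[mf0 _] [mf1 _] ff] <-].
(* On E the coordinate is at most twice that of f0; off E, by the triangle inequality, it is at most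
   twice that of f1. *)
pose E := [set x | (coord f j x <= 2 * coord f0 j x)%R].
have mE : measurable E.
  have mb : measurable_fun setT (fun x => 2 * coord f0 j x)%R.
    by apply: measurable_funM => //; exact: measurable_coord.
  have := measurable_fun_ler (measurable_coord mG j mf) mb.
  by move=> /(_ measurableT [set true] I); rewrite setTI.
rewrite -(@lee_pmul2l _ 2%:E)// muleA -EFinM divff// mul1e.
apply: le_trans (Kset_le _ _ _ _ _ _ mE) _.
rewrite ge0_muleDr ?mule_ge0 ?lee_fin ?(ltW t0)//; last 2 first.
- exact: Lnorm_ge0.
- exact: Lnorm_ge0.
apply: leeD.
  apply: (Ipow_le_fnorm_weighted p0_gt0 mW0 (fun _ _ => ltr01) W0E1 (j := j)) => //.
  - exact: measurable_coord.
  - exact: coord_ge0.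
  by apply: aeW => x; rewrite mul1r.
rewrite muleCA; apply: lee_wpmul2l; first by rewrite lee_fin ltW.
apply: (Ipow_le_fnorm_weighted p1_gt0 mW1 w0 W1E (j := j)) => //.
- exact: measurableC.
- by apply: measurable_funM => //; exact: measurable_coord.
- by move=> x; rewrite mulr_ge0 ?coord_ge0// ltW.
apply: filterS ff => x fx Ex; rewrite mulrCA ler_pM2l//.
move: Ex => /negP; rewrite -ltNge => Ex.
have : (coord f j x <= coord f0 j x + coord f1 j x)%R.
  by rewrite /coord fx mulmxDr mxE; exact: le_normcD.
by move: Ex; lra.
Qed.

(** Almost optimal sets are chosen for each coordinate separately and glued into one decomposition
    of f by means of V, the inverse of G. *)
Lemma Kfun_le_Kset : exists2 M : R, (0 < M)%R & forall f t, measurable_mxfun f -> (0 < t)%R ->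
  Kfun mu X0 X1 t f <= M%:E * \sum_(j < n) Kset mu p0 p1 (w j) (coord f j) t.
Proof.
have [C0 C00 h0] := Ipow_sum_le mu n p0_gt0; have [C1 C10 h1] := Ipow_sum_le mu n p1_gt0.
exists (C0 + C1)%R; first exact: addr_gt0.
move=> f t mf t0; pose K j := Kset mu p0 p1 (w j) (coord f j) t.
pose tm j E := Ipow mu p0 E (coord f j) `^ p0^-1
  + t%:E * Ipow mu p1 (~` E) (fun x => w j x * coord f j x)%R `^ p1^-1.
have K0 j : 0 <= K j by apply: Kset_ge0; exact: ltW.
have tm0 j E : 0 <= tm j E by rewrite adde_ge0 ?mule_ge0 ?poweR_ge0 ?lee_fin ?(ltW t0).
have C0' : (0 < C0 + C1)%R := addr_gt0 C00 C10.
suff main (E : 'I_n -> set T) : (forall j, measurable (E j)) ->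
    Kfun mu X0 X1 t f <= (C0 + C1)%:E * \sum_(j < n) tm j (E j).
  rewrite -/K; have [|inf] := ltP (\sum_(j < n) K j) +oo; last first.
    by move: inf; rewrite leye_eq => /eqP ->; rewrite gt0_muley ?lte_fin// leey.
  move=> fin.
  have Kf j : K j \is a fin_num.
    rewrite ge0_fin_numE//; apply: le_lt_trans fin.
    by rewrite (bigD1 j)//= leeDl// sume_ge0.
  apply/lee_addgt0Pr => e e0.
  (* The slack e is distributed over the n coordinates; n+1 avoids a zero denominator. *)
  pose del := (e / ((C0 + C1) * n.+1%:R))%R.
  have del0 : (0 < del)%R by rewrite divr_gt0// mulr_gt0.
  have /choice[E hE] : forall j, exists E, measurable E /\ tm j E <= K j + del%:E.
    move=> j; have [_ [E mE <-] h] := lb_ereal_inf_adherent del0 (Kf j).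
    by exists E; split => //; exact: ltW.
  apply: le_trans (main E (fun j => (hE j).1)) _.
  apply: (@le_trans _ _ ((C0 + C1)%:E * \sum_(j < n) (K j + del%:E))).
    apply: lee_wpmul2l; first by rewrite lee_fin ltW.
    by apply: lee_sum => j _; exact: (hE j).2.
  rewrite big_split/= ge0_muleDr ?sume_ge0//; last by move=> j _; rewrite lee_fin ltW.
  rewrite leeD2l// sumEFin -EFinM lee_fin sumr_const card_ord -mulr_natr.
  have -> : ((C0 + C1) * (del * n%:R) = e * (n%:R / n.+1%:R))%R.
    by rewrite /del; field; rewrite gt_eqF//= gt_eqF.
  by rewrite ler_piMr ?(ltW e0)// ler_pdivrMr// mul1r ler_nat.
move=> mE.
have [|inf] := ltP (\sum_(j < n) tm j (E j)) +oo; last first.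
  by move: inf; rewrite leye_eq => /eqP ->; rewrite gt0_muley ?lte_fin// leey.
move=> fin.
(* Truncation takes place in the coordinates of G f; applying V brings it back, and f1 is the
   remainder, so f = f0 + f1 everywhere. *)
pose h x : 'cV[C]_n := \col_j if x \in E j then (G x *m f x) j ord0 else 0%R.
pose f0 x : 'cV[C]_n := (V x *m h x)%R; pose f1 x : 'cV[C]_n := (f x - f0 x)%R.
have mEj j : measurable_fun setT (fun x => x \in E j).
  apply: (measurable_fun_bool true); rewrite setTI [X in measurable X](_ : _ = E j)//.
  by apply/seteqP; split => x /=; [move/set_mem|move/mem_set].
have mh : measurable_mxfun h.
  move=> i j; rewrite (_ : (fun x => _) = fun x => if x \in E i then (G x *m f x) i ord0 else 0%R).
    by apply: measurable_cfun_if => //; exact: measurable_mulmx.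
  by apply/funext => x; rewrite mxE.
have mf0 : measurable_mxfun f0 by exact: measurable_mulmx.
have mf1 : measurable_mxfun f1 by exact: measurable_mxfunB.
pose b0 j x := if x \in E j then coord f j x else 0%R.
pose b1 j x := if x \in ~` E j then (w j x * coord f j x)%R else 0%R.
have n0 : fnorm X0 f0 <= C0%:E * \sum_(j < n) Ipow mu p0 (E j) (coord f j) `^ p0^-1.
  have mb0 j : measurable_fun setT (b0 j).
    by apply: measurable_fun_ifT => //; exact: measurable_coord.
  have b00 j x : (0 <= b0 j x)%R by rewrite /b0; case: ifP => // _; exact: coord_ge0.
  apply: le_trans (fnorm_weighted_le p0_gt0 mW0 (fun _ _ => ltr01) W0E1 mf0 mb0 b00 _) _.
    apply: filterS GV => x GVx j; rewrite mul1r /coord /f0 mulmxA GVx mul1mx mxE /b0.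
    by case: ifP => // _; rewrite Normc.normc0.
  apply: le_trans (h0 _ mb0 b00) _; apply: lee_wpmul2l; first by rewrite lee_fin ltW.
  by apply: lee_sum => j _; rewrite Ipow_restrict ?gt_eqF.
have n1 : fnorm X1 f1 <=
    C1%:E * \sum_(j < n) Ipow mu p1 (~` E j) (fun x => w j x * coord f j x)%R `^ p1^-1.
  have mb1 j : measurable_fun setT (b1 j).
    apply: measurable_fun_ifT => //; last first.
      by apply: measurable_funM => //; exact: measurable_coord.
    rewrite (_ : (fun x => _) = (fun x => ~~ (x \in E j))); last by apply/funext => x; rewrite in_setC.
    exact: measurable_neg.
  have b10 j x : (0 <= b1 j x)%R.
    by rewrite /b1; case: ifP => // _; rewrite mulr_ge0 ?coord_ge0// ltW.
  apply: le_trans (fnorm_weighted_le p1_gt0 mW1 w0 W1E mf1 mb1 b10 _) _.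
    apply: filterS GV => x GVx j; rewrite /coord /f1 /f0 mulmxBr mulmxA GVx mul1mx.
    rewrite mxE [X in (_ + X)%R]mxE [X in (_ - X)%R]mxE /b1 in_setC.
    case: (x \in E j) => /=; last by rewrite subr0.
    by rewrite subrr Normc.normc0 mulr0.
  apply: le_trans (h1 _ mb1 b10) _; apply: lee_wpmul2l; first by rewrite lee_fin ltW.
  by apply: lee_sum => j _; rewrite Ipow_restrict ?gt_eqF.
pose S0 := \sum_(j < n) Ipow mu p0 (E j) (coord f j) `^ p0^-1.
pose S1 := \sum_(j < n) Ipow mu p1 (~` E j) (fun x => w j x * coord f j x)%R `^ p1^-1.
have S00 : 0 <= S0 by apply: sume_ge0 => j _; exact: poweR_ge0.
have S10 : 0 <= S1 by apply: sume_ge0 => j _; exact: poweR_ge0.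
have SE : \sum_(j < n) tm j (E j) = S0 + t%:E * S1.
  by rewrite big_split/= ge0_sume_distrr// => j _; exact: poweR_ge0.
have S0f : S0 < +oo.
  apply: le_lt_trans fin; rewrite SE leeDl// mule_ge0// lee_fin; exact: ltW.
have S1f : S1 < +oo.
  rewrite ltNge leye_eq; apply/eqP => S1oo; move: fin.
  by rewrite SE S1oo gt0_muley ?lte_fin// addey// gt_eqF// (lt_le_trans _ S00)// ltNyr.
rewrite SE; apply: (@le_trans _ _ (fnorm X0 f0 + t%:E * fnorm X1 f1)).
  apply: ereal_inf_lbound; exists (f0, f1) => //=; split.
  - split => //; split; first exact: measurable_mulmx.
    by apply: le_lt_trans n0 _; rewrite lte_mul_pinfty ?lee_fin ?(ltW C00).
  - split => //; split; first exact: measurable_mulmx.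
    by apply: le_lt_trans n1 _; rewrite lte_mul_pinfty ?lee_fin ?(ltW C10).
  - by apply: aeW => x; rewrite /f1 addrC subrK.
apply: (@le_trans _ _ (C0%:E * S0 + t%:E * (C1%:E * S1))).
  by apply: leeD => //; apply: lee_wpmul2l => //; rewrite lee_fin ltW.
rewrite ge0_muleDr ?mule_ge0 ?lee_fin ?(ltW t0)// muleCA; apply: leeD.
  by apply: lee_wpmul2r => //; rewrite lee_fin lerDl ltW.
by apply: lee_wpmul2r; rewrite ?mule_ge0 ?lee_fin ?(ltW t0)// lerDr ltW.
Qed.

Lemma Kfun_ge0 t f : (0 <= t)%R -> 0 <= Kfun mu X0 X1 t f.
Proof.
move=> t0; apply: le_ereal_inf_tmp => _ [f01 _ <-].
by rewrite adde_ge0 ?mule_ge0 ?lee_fin ?Lnorm_ge0.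
Qed.

Lemma Kfun_nondecreasing s t f : (0 < s)%R -> (s <= t)%R ->
  Kfun mu X0 X1 s f <= Kfun mu X0 X1 t f.
Proof.
move=> s0 st; apply: le_ereal_inf_tmp => _ [f01 df <-].
apply: le_trans (_ : fnorm X0 f01.1 + s%:E * fnorm X1 f01.2 <= _).
  by apply: ereal_inf_lbound; exists f01.
by apply: leeD => //; apply: lee_wpmul2r; [exact: Lnorm_ge0|rewrite lee_fin].
Qed.

Variables (th q : R).
Hypothesis q_gt0 : (0 < q)%R.

Local Notation interp := (real_interp mu X0 X1 th q).
Local Notation measurable_vec := [set f : T -> 'cV[C]_n | measurable_mxfun f].

Definition Ksum_coord (f : T -> 'cV[C]_n) : \bar R :=
  \sum_(j < n) Ksum mu p0 p1 th q (w j) (coord f j).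

Let Ksample f := zsum (fun k => ((e2 (k%:~R * - th))%:E * Kfun mu X0 X1 (e2 k%:~R) f) `^ q).

Lemma fnorm_interp_ge0 f : 0 <= fnorm interp f.
Proof. exact: poweR_ge0. Qed.

Let Ksample_comparable : comparable_on setT (fun f => fnorm interp f `^ q) Ksample.
Proof.
have [M M0 h] := @discretize1 R (- th) q q_gt0; exists M => // f _.
have mono : monotone_pos (fun t => Kfun mu X0 X1 t f).
  by left => s t s0 st; exact: Kfun_nondecreasing.
have [h1 h2] := h _ (fun t t0 => Kfun_ge0 f (ltW t0)) mono.
rewrite /fnorm/= poweRVK ?gt_eqF//; apply: integral_ge0 => t.
by rewrite /= in_itv/= andbT => t0; rewrite mule_ge0 ?poweR_ge0// lee_fin invr_ge0 ltW.
Qed.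

Lemma interp_Ksum : comparable_on measurable_vec (fun f => fnorm interp f `^ q) Ksum_coord.
Proof.
apply: (@comparable_on_trans _ _ _ Ksample).
  by have [M M0 h] := Ksample_comparable; exists M => // f _; exact: h.
have [M M0 hM] := Kfun_le_Kset.
have [C C0 hC] := @poweR_sum_le R n _ q_gt0.
have K0 f j k : 0 <= Kset mu p0 p1 (w j) (coord f j) (e2 k).
  by apply: Kset_ge0; exact: e2_ge0.
exists (M `^ q * C + n%:R * 2 `^ q + 1)%R.
  by rewrite addr_gt0// ltr_wpDr ?mulr_ge0 ?powR_ge0// mulr_gt0// powR_gt0.
move=> f mf; split.
  apply: (@le_trans _ _ ((M `^ q * C)%:E * Ksum_coord f)); last first.
    apply: lee_wpmul2r; last by rewrite lee_fin -addrA lerDl addr_ge0 ?mulr_ge0 ?powR_ge0.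
    by apply: sume_ge0 => j _; apply: zsum_ge0 => k; exact: poweR_ge0.
  rewrite /Ksum_coord -zsum_sum; last by move=> j k; exact: poweR_ge0.
  rewrite -zsumZl ?lee_fin ?mulr_ge0 ?powR_ge0 ?(ltW C0)//; last first.
    by move=> k; apply: sume_ge0 => j _; exact: poweR_ge0.
  apply: le_zsum => k; rewrite EFinM -muleA.
  have e0 : 0 <= (e2 (k%:~R * - th))%:E :> \bar R by rewrite lee_fin e2_ge0.
  apply: (@le_trans _ _ (((e2 (k%:~R * - th))%:E *
      (M%:E * \sum_(j < n) Kset mu p0 p1 (w j) (coord f j) (e2 k%:~R))) `^ q)).
    apply: le_poweR; [exact: ltW|by rewrite mule_ge0// Kfun_ge0// e2_ge0|].
    by apply: lee_wpmul2l => //; apply: hM => //; exact: e2_gt0.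
  rewrite [X in X `^ q]muleCA [X in (_ * X) `^ q]ge0_sume_distrr// poweRM ?lee_fin ?(ltW M0)//; last first.
    by apply: sume_ge0 => j _; rewrite mule_ge0.
  rewrite poweR_EFin; apply: lee_wpmul2l; first exact: powR_EFin_ge0.
  by apply: (hC (fun j => _ * _)) => j; rewrite mule_ge0.
apply: (@le_trans _ _ ((n%:R * 2 `^ q)%:E * Ksample f)); last first.
  apply: lee_wpmul2r; first by apply: zsum_ge0 => k; exact: poweR_ge0.
  by rewrite lee_fin -addrA addrCA lerDl addr_ge0 ?mulr_ge0 ?powR_ge0 ?(ltW C0).
apply: (@le_trans _ _ (\sum_(j < n) ((2 `^ q)%:E * Ksample f))); last first.
  rewrite sume_const; first by rewrite muleA -EFinM.
  apply: mule_ge0; first exact: powR_EFin_ge0.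
  by apply: zsum_ge0 => k; exact: poweR_ge0.
apply: lee_sum => j _; rewrite /Ksample -zsumZl ?powR_EFin_ge0//; last first.
  by move=> k; exact: poweR_ge0.
apply: le_zsum => k; rewrite -poweR_EFin -poweRM ?lee_fin//; last first.
  by rewrite mule_ge0 ?lee_fin ?e2_ge0// Kfun_ge0// e2_ge0.
apply: le_poweR; [exact: ltW|by rewrite mule_ge0 ?lee_fin ?e2_ge0|].
rewrite muleCA; apply: lee_wpmul2l; first by rewrite lee_fin e2_ge0.
by apply: Kset_le_Kfun => //; exact: e2_gt0.
Qed.

(** A finite norm already provides a decomposition: without one, K is an infimum over the empty set,
    hence +oo, and so is the norm. *)
Lemma interp_carrier f :
  fcarrier interp f <-> measurable_mxfun f /\ fnorm interp f < +oo.
Proof.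
split=> [[mf _ fin]//|[mf fin]]; split => //; apply: contrapT => nodec.
have [M M0 h] := Ksample_comparable.
have : Ksample f < +oo.
  apply: le_lt_trans (h f I).2 _; rewrite lte_mul_pinfty ?lee_fin ?(ltW M0)//.
  by rewrite poweR_lty.
rewrite ltNge leye_eq => /negP; apply; rewrite -leye_eq.
apply: le_trans (zsum_ge_term 0 _); last by move=> k; exact: poweR_ge0.
rewrite (_ : Kfun _ _ _ _ _ = +oo); last first.
  rewrite /Kfun -[RHS]ereal_inf0; congr ereal_inf.
  by apply/seteqP; split => // y [f01 dec _]; apply: nodec; exists f01.1, f01.2.
by rewrite gt0_muley ?lte_fin ?e2_gt0// poweRyr// gt_eqF.
Qed.

Lemma interp_eq (Y : fspace R T 'cV[C]_n) :
  (forall f, fcarrier Y f <-> measurable_mxfun f /\ fnorm Y f < +oo) ->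
  (forall f, measurable_mxfun f -> 0 <= fnorm Y f) ->
  comparable_on measurable_vec (fun f => fnorm Y f `^ q) Ksum_coord ->
  eq_fspace interp Y.
Proof.
move=> cY Y0 hY; apply: (@eq_fspace_comparable _ _ _ _ _ measurable_vec q) => //.
- exact: interp_carrier.
- by move=> f _; exact: fnorm_interp_ge0.
- exact: comparable_on_trans interp_Ksum (comparable_on_sym hY).
Qed.

(** Reduces the identification of the interpolation space to a scalar comparison, uniform in the
    function and the index. *)
Lemma interp_eq_direct_sum (X : 'I_n -> fspace R T C) :
  (forall j h, measurable_cfun h -> fcarrier (X j) h <-> fnorm (X j) h < +oo) ->
  (forall j h, measurable_cfun h -> 0 <= fnorm (X j) h) ->
  comparable_on [set hj : (T -> C) * 'I_n | measurable_cfun hj.1]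
    (fun hj => fnorm (X hj.2) hj.1 `^ q)
    (fun hj => Ksum mu p0 p1 th q (w hj.2) (fun x => Normc.normc (hj.1 x))) ->
  eq_fspace interp (weighted (direct_sum X) G).
Proof.
move=> cX X0' hX; pose g (f : T -> 'cV[C]_n) j x := (G x *m f x) j ord0.
have mg f j : measurable_mxfun f -> measurable_cfun (g f j).
  by move=> mf; exact: (measurable_mulmx mG mf).
have s0 f j : measurable_mxfun f -> 0 <= fnorm (X j) (g f j) by move=> mf; exact/X0'/mg.
apply: interp_eq.
- move=> f; split=> [[mf cf]|[mf fin]]; split => //.
    rewrite /fnorm/=; apply/lte_sum_pinfty => j _.
    by apply/cX; [exact: (mg f j mf)|exact: cf].
  move=> j; apply/cX; first exact: (mg f j mf).
  apply: le_lt_trans fin; rewrite /fnorm/= (bigD1 j)//= leeDl// sume_ge0// => i _.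
  exact: (s0 f i mf).
- by move=> f mf; apply: sume_ge0 => j _; exact: (s0 f j mf).
apply: (comparable_on_trans (comparable_on_poweR_sum q_gt0 s0)).
apply: comparable_on_sum.
- by move=> f j mf; exact: poweR_ge0.
- by move=> f j mf; apply: zsum_ge0 => k; exact: poweR_ge0.
by have [M M0 h] := hX; exists M => // -[f j] mf; apply: (h (g f j, j)); exact: (mg f j mf).
Qed.

End vector_K_functional.

(** * Lorentz and Beurling spaces *)

Section complete_measure.
Local Open Scope ereal_scope.
Context d (T : measurableType d) (R : realType) (mu : {measure set T -> \bar R}).
Hypothesis cmu : measure_is_complete mu.

Lemma complete_ae_eq_integral (f g : T -> \bar R) : measurable_fun setT f ->
  (forall x, 0 <= f x) -> (forall x, 0 <= g x) -> {ae mu, forall x, f x = g x} ->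
  \int[mu]_x f x = \int[mu]_x g x.
Proof.
move=> mf f0 g0 fg; apply: ge0_ae_eq_integral => //.
  by apply: (ae_measurable_fun cmu _ mf); apply: filterS fg => x ->.
by apply: filterS fg => x ->.
Qed.

Lemma ae_density (k k' : T -> R) (A A' : set T) : measurable A' ->
  measurable_fun setT k' -> (forall x, 0 <= k x)%R -> (forall x, 0 <= k' x)%R ->
  {ae mu, forall x, k x = k' x /\ (A x <-> A' x)} -> density mu k A = density mu k' A'.
Proof.
move=> mA mk k0 k'0 h; rewrite /density integral_mkcond [RHS]integral_mkcond; apply/esym.
apply: complete_ae_eq_integral.
- apply/(measurable_restrictT _ mA); apply: measurable_funTS; exact/measurable_EFinP.
- by move=> x; rewrite patchE; case: ifP => // _; rewrite lee_fin.
- by move=> x; rewrite patchE; case: ifP => // _; rewrite lee_fin.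
apply: filterS h => x [kx Ax]; rewrite !patchE kx.
by have -> : (x \in A) = (x \in A'); [apply/idP/idP; rewrite !inE => /Ax|].
Qed.

Section Lorentz_norm.
Variables (I : Type) (w w' : I -> T -> R).
Hypotheses (mw' : forall i, measurable_fun setT (w' i)) (w'0 : forall i x, (0 < w' i x)%R).
Hypothesis ww' : forall i, {ae mu, forall x, w i x = w' i x}.
Variables (p0 p1 q th : R).
Hypotheses (p0_ge1 : (1 <= p0)%R) (p01 : (p0 < p1)%R) (q_gt0 : (0 < q)%R).
Hypotheses (th0 : (0 < th)%R) (th1 : (th < 1)%R).

Let p := ((1 - th) / p0 + th / p1)^-1%R.

Definition Lorentz_summand i : fspace R T R[i] :=
  scalar_weighted
    (Lorentz (density mu (fun x => w i x `^ (- (p0 * p1 / (p1 - p0))))%R) p q)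
    (fun x => w i x `^ (p1 / (p1 - p0)))%R.

Let adm i h : measurable_cfun h -> admissible (w' i) (fun x => Normc.normc (h x)).
Proof.
by move=> mh; split => //; [exact: measurable_normc|move=> x; exact: normc_ge0].
Qed.

Lemma Lorentz_summand_ge0 i h : 0 <= fnorm (Lorentz_summand i) h.
Proof. exact: poweR_ge0. Qed.

Lemma Lorentz_summand_carrier i h : measurable_cfun h ->
  fcarrier (Lorentz_summand i) h <-> fnorm (Lorentz_summand i) h < +oo.
Proof.
move=> mh; split=> [[_ []]//|fin]; split => //; split => //.
apply: measurable_cfunM => //; apply: measurable_cfun_real.
apply: (ae_measurable_real cmu (f := fun x => (w' i x `^ (p1 / (p1 - p0)))%R)).
  by apply: filterS (ww' i) => x /= ->.
exact: (measurableT_comp (measurable_powR _)).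
Qed.

(** Replacing w by its everywhere positive version w' changes the superlevel sets and the density
    only on null sets, so their measures agree. *)
Lemma rearrangement_Lorentz i h t : measurable_cfun h ->
  rearrangement (density mu (fun x => w i x `^ (- (p0 * p1 / (p1 - p0))))%R)
    (fun x => (w i x `^ (p1 / (p1 - p0)))%:C * h x)%R t =
  rearr (density mu (lork p0 p1 (w' i))) (lorF p0 p1 (w' i) (fun x => Normc.normc (h x))) t.
Proof.
move=> mh; have [mF mk F0 k0] := adm_pair p0 p1 (adm i mh).
have E s : density mu (fun x => w i x `^ (- (p0 * p1 / (p1 - p0))))%R
     [set x | (s < Normc.normc ((w i x `^ (p1 / (p1 - p0)))%:C * h x))%R] =
   density mu (lork p0 p1 (w' i))
     [set x | (s < lorF p0 p1 (w' i) (fun x => Normc.normc (h x)) x)%R].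
  apply: ae_density => //; [exact: (measurable_superlevel (adm_pair p0 p1 (adm i mh)))|by move=> x; exact: powR_ge0|].
  apply: filterS (ww' i) => x wx; split; rewrite /= wx//.
  by rewrite normc_real_mul ?powR_ge0.
apply: (congr1 (fun S => ereal_inf (EFin @` S))); apply/funext => s /=.
exact: (congr1 (fun z => (0 <= s)%R /\ z <= t%:E) (E s)).
Qed.

Lemma Lorentz_Ksum : comparable_on [set hi : (T -> R[i]) * I | measurable_cfun hi.1]
    (fun hi => fnorm (Lorentz_summand hi.2) hi.1 `^ q)
    (fun hi => Ksum mu p0 p1 th q (w' hi.2) (fun x => Normc.normc (hi.1 x))).
Proof.
have pE : (p^-1 = (1 - th) / p0 + th / p1)%R by rewrite invrK.
have al0 := lor_exp_gt0 p0_ge1 p01.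
apply: (@comparable_on_trans _ _ _ (fun hi =>
    lor_sum mu p0 p1 p q (w' hi.2) (fun x => Normc.normc (hi.1 x)))).
  (* Sampling at 2^(al k), the measures paired with the times 2^k, turns the Lorentz integral into
     [lor_sum]. *)
  have [M M0 hM] := discretize p^-1 al0 q_gt0.
  suff key h i : measurable_cfun h ->
      fnorm (Lorentz_summand i) h `^ q <=
        M%:E * lor_sum mu p0 p1 p q (w' i) (fun x => Normc.normc (h x)) /\
      lor_sum mu p0 p1 p q (w' i) (fun x => Normc.normc (h x)) <=
        M%:E * fnorm (Lorentz_summand i) h `^ q.
    by exists M => // -[h i]; exact: key.
  move=> mh; pose g t := rearr (density mu (lork p0 p1 (w' i)))
    (lorF p0 p1 (w' i) (fun x => Normc.normc (h x))) t.
  have mono : monotone_pos g.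
    by right => s t _ st; exact: rearr_nonincreasing.
  have [h1 h2] := hM g (fun t _ => rearr_ge0 _ _ _) mono.
  have -> : fnorm (Lorentz_summand i) h = (\int[lebesgue_measure]_(t in `]0%R, +oo[)
      (((t `^ p^-1)%:E * g t) `^ q * (t^-1)%:E)) `^ q^-1.
    rewrite -(_ : rearrangement (density mu (fun x => w i x `^ (- (p0 * p1 / (p1 - p0))))%R)
      (fun x => (w i x `^ (p1 / (p1 - p0)))%:C * h x)%R = g); first by [].
    by apply/funext => t; exact: rearrangement_Lorentz.
  rewrite poweRVK ?gt_eqF//; apply: integral_ge0 => t; rewrite /= in_itv/= andbT => t0.
  by rewrite mule_ge0 ?poweR_ge0// lee_fin invr_ge0 ltW.
apply: comparable_on_sym.
apply: (comparable_on_comp (e := fun hi => (w' hi.2, fun x => Normc.normc (hi.1 x))) _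
  (Ksum_lor_sum mu p0_ge1 p01 q_gt0 th0 th1 pE)) => -[h i]; exact: adm.
Qed.

End Lorentz_norm.

Section Beurling_norm.
Variables (I : Type) (w w' : I -> T -> R).
Hypotheses (mw' : forall i, measurable_fun setT (w' i)) (w'0 : forall i x, (0 < w' i x)%R).
Hypothesis ww' : forall i, {ae mu, forall x, w i x = w' i x}.
Variables (p q th : R).
Hypotheses (p_ge1 : (1 <= p)%R) (q_gt0 : (0 < q)%R).
Hypotheses (th0 : (0 < th)%R) (th1 : (th < 1)%R).

Let ga := (p^-1 - q^-1)%R.
Let p_gt0 : (0 < p)%R. Proof. exact: lt_le_trans ltr01 p_ge1. Qed.

Let adm i h : measurable_cfun h -> admissible (w' i) (fun x => Normc.normc (h x)).
Proof.
by move=> mh; split => //; [exact: measurable_normc|move=> x; exact: normc_ge0].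
Qed.

Let Vp i h phi := Vpow mu p th ga (w' i) (fun x => Normc.normc (h x)) phi.
Let L i (h : T -> R[i]) := level_norm mu p q th (w' i) (fun x => Normc.normc (h x)).

Let Vp_ge0 i h phi : 0 <= Vp i h phi.
Proof. by apply: integral_ge0 => x _; exact: poweR_ge0. Qed.
Let L_ge0 i h : 0 <= L i h.
Proof. by apply: zsum_ge0 => k; exact: poweR_ge0. Qed.

Lemma scalar_Lp_Vpow i h phi : measurable_cfun h -> Omega th ga phi ->
  fnorm (scalar_Lp mu p (fun x => Omega_fun th ga phi (w i x))) h = Vp i h phi `^ p^-1.
Proof.
move=> mh Ophi; rewrite /fnorm/= unlock; congr (_ `^ _).
have [_ ma _ a0] := adm i mh; apply/esym; apply: complete_ae_eq_integral.
- exact: (measurable_Vpow_integrand _ (mw' i) ma (w'0 i) Ophi).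
- by move=> x; exact: poweR_ge0.
- by move=> x; exact: poweR_ge0.
apply: filterS (ww' i) => x ->; rewrite gee0_abs// mule_ge0 ?lee_fin//.
exact: Omega_fun_ge0.
Qed.

Let rE : (q / p = p^-1 * q)%R. Proof. by rewrite mulrC. Qed.
Let r_gt0 : (0 < q / p)%R. Proof. exact: divr_gt0. Qed.

Let Vp_norm i h phi : (Vp i h phi `^ p^-1) `^ q = Vp i h phi `^ (q / p).
Proof. by rewrite -poweRrM rE. Qed.

Let root_bound (c : R) x y : (0 < c)%R -> 0 <= x -> 0 <= y ->
  x <= c%:E * y `^ (q / p)^-1 -> x `^ (q / p) <= (c `^ (q / p))%:E * y.
Proof.
move=> c0 x0 y0 h; apply: le_trans (le_poweR (ltW r_gt0) x0 h) _.
by rewrite poweRM ?lee_fin ?poweR_ge0 ?(ltW c0)// poweR_EFin poweRVK// gt_eqF.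
Qed.

(** The carrier statement is proved along with the bounds because for ga > 0 it depends on them:
    finiteness of a supremum is derived from finiteness for each phi. *)
Lemma Beurling_bounds : exists2 M : R, (0 < M)%R & forall i h, measurable_cfun h ->
  [/\ fcarrier (Beurling mu p th q (w i)) h <-> fnorm (Beurling mu p th q (w i)) h < +oo,
      0 <= fnorm (Beurling mu p th q (w i)) h,
      fnorm (Beurling mu p th q (w i)) h `^ q <= M%:E * L i h &
      L i h <= M%:E * fnorm (Beurling mu p th q (w i)) h `^ q].
Proof.
rewrite /Beurling -/ga; have [ga_le0|ga_gt0] := leP ga 0%R.
  have [C C0 hC] := Beurling_neg_ge mu th p_ge1 q_gt0 ga_le0.
  have [D D0 hD] := Beurling_neg_le mu p_ge1 q_gt0 th0 ga_le0.
  exists (C + D `^ (q / p))%R; first by rewrite addr_gt0// powR_gt0.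
  move=> i h mh; rewrite /fnorm/=.
  set N := ereal_inf _.
  have N_le phi : Omega th ga phi -> N <= Vp i h phi `^ p^-1.
    move=> Ophi; rewrite -scalar_Lp_Vpow//; apply: ereal_inf_lbound.
    by exists phi.
  have N_ge y : (forall phi, Omega th ga phi -> y <= Vp i h phi `^ p^-1) -> y <= N.
    move=> hy; apply: le_ereal_inf_tmp => _ [phi Ophi <-].
    by have := hy phi Ophi; rewrite -scalar_Lp_Vpow.
  have N0 : 0 <= N by apply: N_ge => phi _; exact: poweR_ge0.
  split => //.
  - split=> [[phi Ophi [_ fin]]|/ereal_inf_lt[_ [phi Ophi <-] fin]]; last first.
      by exists phi => //; split.
    by apply: le_lt_trans fin; apply: ereal_inf_lbound; exists phi.
  - have [phi Ophi hphi] := hD _ _ (adm i mh).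
    apply: le_trans (le_poweR (ltW q_gt0) N0 (N_le phi Ophi)) _; rewrite Vp_norm.
    apply: le_trans (root_bound D0 (Vp_ge0 i h phi) (L_ge0 i h) hphi) _.
    by apply: lee_wpmul2r => //; rewrite lee_fin lerDr ltW.
  apply: (@le_trans _ _ (C%:E * N `^ q)); last first.
    by apply: lee_wpmul2r; rewrite ?poweR_ge0// lee_fin lerDl powR_ge0.
  rewrite -(@lee_pmul2l _ (C^-1)%:E) ?lte_fin ?invr_gt0// muleA -EFinM mulVf ?gt_eqF// mul1e.
  have CL0 : 0 <= (C^-1)%:E * L i h by rewrite mule_ge0// lee_fin invr_ge0 ltW.
  rewrite -(@poweRVK _ q ((C^-1)%:E * L i h)) ?gt_eqF//.
  apply: le_poweR; [exact: ltW|exact: poweR_ge0|]; apply: N_ge => phi Ophi.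
  rewrite -(@poweRK _ q (_ `^ p^-1)) ?gt_eqF ?poweR_ge0// Vp_norm.
  apply: le_poweR => //; first by rewrite invr_ge0 ltW.
  rewrite -(@lee_pmul2l _ C%:E)// muleA -EFinM divff ?gt_eqF// mul1e.
  exact: hC (adm i mh) Ophi.
have [C C0 hC] := Beurling_pos_le mu th p_ge1 q_gt0 ga_gt0.
have [D D0 hD] := Beurling_pos_ge mu p_ge1 q_gt0 th0 ga_gt0.
exists (C `^ (q / p) + D `^ (q / p))%R; first by rewrite addr_gt0// powR_gt0.
move=> i h mh; rewrite /fnorm/=.
set N := ereal_sup _.
have N_ge phi : Omega th ga phi -> Vp i h phi `^ p^-1 <= N.
  move=> Ophi; rewrite -scalar_Lp_Vpow//; apply: ereal_sup_ubound.
  by exists phi.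
have N_le y : (forall phi, Omega th ga phi -> Vp i h phi `^ p^-1 <= y) -> N <= y.
  move=> hy; apply: ge_ereal_sup => _ [phi Ophi <-].
  by have := hy phi Ophi; rewrite -scalar_Lp_Vpow.
have N0 : 0 <= N.
  by have [phi Ophi] := Omega_nonempty ga th0; apply: le_trans (N_ge phi Ophi); exact: poweR_ge0.
have NL : N `^ q <= (C `^ (q / p))%:E * L i h.
  have CL0 : 0 <= (C `^ (q / p))%:E * L i h by rewrite mule_ge0.
  rewrite -(@poweRVK _ q (_ * L i h)) ?gt_eqF//; apply: le_poweR; [exact: ltW|by []|].
  apply: N_le => phi Ophi; apply: le_poweRV; rewrite ?poweR_ge0// Vp_norm.
  by apply: root_bound => //; exact: hC (adm i mh) Ophi.
(* An almost extremal phi for this h: finiteness for it alone bounds the level sum, hence the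
   supremum. *)
have [psi0 Opsi hpsi] := hD _ _ (adm i mh).
have LN : L i h <= (D `^ (q / p))%:E * (Vp i h psi0 `^ p^-1) `^ q.
  rewrite Vp_norm; have := le_poweR (ltW r_gt0) (poweR_ge0 _ _) hpsi.
  have V0 := Vp_ge0 i h psi0.
  rewrite (@poweRVK _ _ (L i h)) ?gt_eqF ?L_ge0// poweRM ?lee_fin ?(ltW D0)//; exact.
split => //.
- split=> [hall|fin phi Ophi]; last first.
    split => //; apply: le_lt_trans fin; apply: ereal_sup_ubound; by exists phi.
  have fin : Vp i h psi0 `^ p^-1 < +oo by rewrite -scalar_Lp_Vpow//; case: (hall _ Opsi).
  have Lfin : L i h < +oo.
    by apply: le_lt_trans LN _; rewrite lte_mul_pinfty ?lee_fin ?powR_ge0// poweR_lty.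
  have Nq : N `^ q < +oo.
    by apply: le_lt_trans NL _; rewrite lte_mul_pinfty ?lee_fin ?powR_ge0.
  by rewrite -(@poweRK _ q N) ?gt_eqF// poweR_lty.
- by apply: le_trans NL _; apply: lee_wpmul2r => //; rewrite lee_fin lerDl powR_ge0.
apply: le_trans LN _; apply: (@le_trans _ _ ((D `^ (q / p))%:E * N `^ q)).
  by apply: lee_wpmul2l; [exact: powR_EFin_ge0|]; apply: le_poweR; [exact: ltW|exact: poweR_ge0|exact: N_ge].
by apply: lee_wpmul2r; rewrite ?poweR_ge0// lee_fin lerDr powR_ge0.
Qed.

Lemma Beurling_Ksum : comparable_on [set hi : (T -> R[i]) * I | measurable_cfun hi.1]
    (fun hi => fnorm (Beurling mu p th q (w hi.2)) hi.1 `^ q)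
    (fun hi => Ksum mu p p th q (w' hi.2) (fun x => Normc.normc (hi.1 x))).
Proof.
apply: (@comparable_on_trans _ _ _ (fun hi => L hi.2 hi.1)).
  by have [M M0 hM] := Beurling_bounds; exists M => // -[h i] /= mh; have [] := hM i h mh.
have th01 : (0 < th < 1)%R by rewrite th0.
apply: comparable_on_sym.
apply: (comparable_on_comp (e := fun hi => (w' hi.2, fun x => Normc.normc (hi.1 x))) _
  (Ksum_same mu p_ge1 q_gt0 th01)) => -[h i]; exact: adm.
Qed.

End Beurling_norm.

End complete_measure.

(** * The interpolation theorem *)

Section diagonal_norm.
Local Open Scope ereal_scope.
Context d (T : measurableType d) (R : realType) (mu : {measure set T -> \bar R}).
Local Notation C := R[i].
Variables (n : nat) (q : R) (M G : T -> 'M[C]_n) (v : 'I_n -> T -> R).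
Hypotheses (q_gt0 : (0 < q)%R) (mM : measurable_mxfun M) (mG : measurable_mxfun G).
Hypotheses (mv : forall j, measurable_fun setT (v j)) (v0 : forall j x, (0 < v j x)%R).
Hypothesis ME : {ae mu, forall x (u : 'cV[C]_n), cvnorm (M x *m u) =
  cvnorm (\col_j ((v j x)%:C * (G x *m u) j ord0)%R)}.

Lemma weighted_Lp_Ipow :
  comparable_on [set f : T -> 'cV[C]_n | measurable_mxfun f]
    (fun f => fnorm (weighted (Lp mu n q) M) f `^ q)
    (fun f => \sum_(j < n) Ipow mu q setT (fun x => v j x * coord G f j x)%R).
Proof.
pose b f j x := (v j x * coord G f j x)%R.
have mb f j : measurable_mxfun f -> measurable_fun setT (b f j).
  by move=> mf; apply: measurable_funM => //; exact: measurable_coord.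
have b0 f j x : (0 <= b f j x)%R by rewrite mulr_ge0 ?coord_ge0// ltW.
have N0 f : 0 <= fnorm (weighted (Lp mu n q) M) f by exact: Lnorm_ge0.
have qV0 : (0 < q^-1)%R by rewrite invr_gt0.
have rootK f j : (Ipow mu q setT (b f j) `^ q^-1) `^ q = Ipow mu q setT (b f j).
  by rewrite poweRVK ?gt_eqF ?Ipow_ge0.
have [C1 C10 h1] := Ipow_sum_le mu n q_gt0.
have [C2 C20 h2] := @poweR_sum_le R n _ q_gt0.
exists (C1 `^ q * C2 + n%:R)%R; first by rewrite ltr_wpDr// mulr_gt0 ?powR_gt0.
move=> f mf; have I0 : 0 <= \sum_(j < n) Ipow mu q setT (b f j).
  by apply: sume_ge0 => j _; exact: Ipow_ge0.
split.
  apply: (@le_trans _ _ ((C1 `^ q * C2)%:E * \sum_(j < n) Ipow mu q setT (b f j))); last first.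
    by apply: lee_wpmul2r => //; rewrite lee_fin lerDl.
  have := fnorm_weighted_le q_gt0 mM v0 ME mf (fun j => mb f j mf) (b0 f) _.
  move=> /(_ (aeW _ (fun x j => lexx _))) hN.
  have := le_poweR (ltW q_gt0) (N0 f) (le_trans hN (h1 _ (fun j => mb f j mf) (b0 f))).
  rewrite poweRM ?lee_fin ?(ltW C10)//; last by apply: sume_ge0 => j _; exact: poweR_ge0.
  move=> h; apply: le_trans h _; rewrite EFinM -muleA poweR_EFin.
  apply: lee_wpmul2l; first exact: powR_EFin_ge0.
  apply: le_trans (h2 _ _) _; first by move=> j; exact: poweR_ge0.
  by under eq_bigr do rewrite rootK.
apply: (@le_trans _ _ (n%:R%:E * fnorm (weighted (Lp mu n q) M) f `^ q)); last first.
  by apply: lee_wpmul2r; rewrite ?poweR_ge0// lee_fin lerDr mulr_ge0 ?powR_ge0 ?ltW.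
rewrite -sume_const ?poweR_ge0//; apply: lee_sum => j _; rewrite -rootK.
apply: le_poweR; [exact: ltW|exact: poweR_ge0|].
rewrite -[leRHS]mul1e.
apply: (Ipow_le_fnorm_weighted q_gt0 mM v0 ME (j := j)) => //; first exact: mb.
by apply: aeW => x _; rewrite mul1r.
Qed.

End diagonal_norm.

Section weighted_interpolation.
Context disp (T : measurableType disp) (R : realType) (mu : {measure set T -> \bar R}).
Hypothesis cmu : measure_is_complete mu.
Variables (n : nat) (p0 p1 theta q : R).
Hypotheses (p0_ge1 : 1 <= p0) (p1_ge1 : 1 <= p1).
Hypotheses (theta_gt0 : 0 < theta) (theta_lt1 : theta < 1) (q_ge1 : 1 <= q).
Variables (W0 W1 U D : T -> 'M[R[i]]_n).
Hypotheses (W0_weight : matrix_weight mu W0) (W1_weight : matrix_weight mu W1).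
Hypotheses (U_meas : measurable_mxfun U) (D_meas : measurable_mxfun D).
Hypothesis U_unitary : {ae mu, forall x, U x \is unitarymx}.
Hypothesis D_diag : {ae mu, forall x, is_diag_mx (D x)}.
Hypothesis UDU : {ae mu, forall x, mxabs (W1 x *m invmx (W0 x)) = U x *m D x *m invmx (U x)}.

Let p0_gt0 : 0 < p0. Proof. exact: lt_le_trans ltr01 p0_ge1. Qed.
Let p1_gt0 : 0 < p1. Proof. exact: lt_le_trans ltr01 p1_ge1. Qed.
Let q_gt0 : 0 < q. Proof. exact: lt_le_trans ltr01 q_ge1. Qed.

Let G x := invmx (U x) *m W0 x.
Let V x := invmx (W0 x) *m U x.
Let w j x := complex.Re (D x j j).
(* The eigenvalues of |W1 W0^-1|, made positive on the exceptional null set. *)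
Let w' j x := if 0 < w j x then w j x else 1.
Let M x := mxpowR (mxabs (W1 x *m invmx (W0 x))) theta *m W0 x.

Let mw j : measurable_fun setT (w j).
Proof. by case: (D_meas j j). Qed.

Let mw' j : measurable_fun setT (w' j).
Proof. by apply: measurable_fun_ifT => //; exact: measurable_fun_ltr. Qed.

Let w'0 j x : 0 < w' j x.
Proof. by rewrite /w'; case: ifP. Qed.

Let mG : measurable_mxfun G.
Proof. by apply: measurable_mulmx; [exact: measurable_invmx|case: W0_weight]. Qed.

Let mV : measurable_mxfun V.
Proof. by apply: measurable_mulmx => //; apply: measurable_invmx; case: W0_weight. Qed.

Let pointwise : {ae mu, forall x, [/\ forall j, w' j x = w j x,
  forall v : 'cV_n, cvnorm (W0 x *m v) = cvnorm (G x *m v),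
  forall v : 'cV_n, cvnorm (W1 x *m v) = cvnorm (\col_j ((w' j x)%:C * (G x *m v) j ord0)),
  forall v : 'cV_n, cvnorm (M x *m v) =
    cvnorm (\col_j ((w' j x `^ theta)%:C * (G x *m v) j ord0)) &
  U x *m (rdiag (fun j => w' j x `^ theta) *m G x) = M x]}.
Proof.
have [_ W0p] := W0_weight; have [_ W1p] := W1_weight.
apply: filterS2 (filterI U_unitary (filterI D_diag UDU)) (filterI W0p W1p).
move=> x [Ux [Dx UDUx]] [W0x W1x].
have [wx h0 h1 hM hpow] := matrix_weight_pointwise theta W0x W1x Ux Dx UDUx.
have w'w j : w' j x = w j x by rewrite /w' (wx j).
split.
- exact: w'w.
- exact: h0.
- by move=> v; rewrite h1; congr cvnorm; apply/colP => j; rewrite !mxE w'w.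
- by move=> v; rewrite hM; congr cvnorm; apply/colP => j; rewrite !mxE w'w.
have -> : (fun j => w' j x `^ theta) = (fun j => w j x `^ theta).
  by apply/funext => j; rewrite w'w.
rewrite /M hpow /G !mulmxA; reflexivity.
Qed.

Let W0E : {ae mu, forall x (v : 'cV_n), cvnorm (W0 x *m v) = cvnorm (G x *m v)}.
Proof. by apply: filterS pointwise => x []. Qed.

Let W1E : {ae mu, forall x (v : 'cV_n), cvnorm (W1 x *m v) =
  cvnorm (\col_j ((w' j x)%:C * (G x *m v) j ord0))}.
Proof. by apply: filterS pointwise => x []. Qed.

Let ME : {ae mu, forall x (v : 'cV_n), cvnorm (M x *m v) =
  cvnorm (\col_j ((w' j x `^ theta)%:C * (G x *m v) j ord0))}.
Proof. by apply: filterS pointwise => x []. Qed.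

Let ww' j : {ae mu, forall x, w j x = w' j x}.
Proof. by apply: filterS pointwise => x []. Qed.

Let GV : {ae mu, forall x, G x *m V x = 1%:M}.
Proof.
have [_ W0p] := W0_weight.
apply: filterS2 U_unitary W0p => x /unitarymx_unit Ux /posdefmx_unit W0x.
by rewrite /G /V mulmxA -(mulmxA (invmx _)) mulmxV// mulmx1 mulVmx.
Qed.

Let mW0 : measurable_mxfun W0. Proof. by case: W0_weight. Qed.
Let mW1 : measurable_mxfun W1. Proof. by case: W1_weight. Qed.

Let mwth j : measurable_fun setT (fun x => w' j x `^ theta).
Proof. exact: (measurableT_comp (measurable_powR _)). Qed.

(** The pointwise choice of a spectral decomposition in [mxpowR] carries no evident measurability.
    Almost everywhere the matrix equals U diag(w'^theta) U^-1 W0, which is measurable, and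
    completeness concludes. *)
Let mM : measurable_mxfun M.
Proof.
apply: (ae_measurable_mxfun cmu (F := fun x => U x *m (rdiag (fun j => w' j x `^ theta) *m G x))).
  by apply: filterS pointwise => x [].
apply: measurable_mulmx => //; apply: measurable_mulmx => // i j.
rewrite (_ : (fun x => _) = (fun x => if i == j then (w' j x `^ theta)%:C else 0)).
  case: (i == j); first exact: (measurable_cfun_real (mwth j)).
  exact: measurable_cfun_cst.
by apply/funext => x; rewrite !mxE; case: eqP => [->|].
Qed.

Let interp := real_interp mu (weighted (Lp mu n p0) W0) (weighted (Lp mu n p1) W1) theta q.

Lemma interp_LD : p0 <= p1 -> eq_fspace interp (weighted (LD mu D p0 p1 q theta) G).
Proof.
rewrite le_eqVlt => /orP[/eqP p01|p01]; rewrite /LD.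
  rewrite -p01 ltxx.
  have [M0 _ hM] := Beurling_bounds cmu mw' w'0 ww' p0_ge1 q_gt0 theta_gt0.
  apply: (interp_eq_direct_sum p0_gt0 p1_gt0 mW0 mW1 mG mV mw' w'0 W0E W1E GV q_gt0).
  - by move=> j h mh; have [] := hM j h mh.
  - by move=> j h mh; have [] := hM j h mh.
  rewrite -p01; exact: (Beurling_Ksum cmu mw' w'0 ww' p0_ge1 q_gt0 theta_gt0 theta_lt1).
rewrite p01.
apply: (interp_eq_direct_sum p0_gt0 p1_gt0 mW0 mW1 mG mV mw' w'0 W0E W1E GV q_gt0).
- by move=> j h; exact: (Lorentz_summand_carrier cmu mw' ww' p0 p1 q theta).
- by move=> j h _; exact: (Lorentz_summand_ge0 mu w p0 p1 q theta).
exact: (Lorentz_Ksum cmu mw' w'0 ww' p0_ge1 p01 q_gt0 theta_gt0 theta_lt1).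
Qed.

Lemma interp_diagonal : q^-1 = (1 - theta) / p0 + theta / p1 ->
  eq_fspace interp (weighted (Lp mu n q) M).
Proof.
move=> qE.
apply: (interp_eq p0_gt0 p1_gt0 mW0 mW1 mG mV mw' w'0 W0E W1E GV q_gt0).
- move=> f; split=> [[mf [_ fin]]//|[mf fin]]; split => //; split => //.
  exact: measurable_mulmx.
- by move=> f _; exact: Lnorm_ge0.
have wth0 j x : 0 < w' j x `^ theta by exact: powR_gt0.
apply: (comparable_on_trans (weighted_Lp_Ipow q_gt0 mM mG mwth wth0 ME)).
apply: comparable_on_sum.
- by move=> f j _; exact: Ipow_ge0.
- by move=> f j _; apply: zsum_ge0 => k; exact: poweR_ge0.
apply: comparable_on_sym.
apply: (comparable_on_comp (e := fun fj => (w' fj.2, coord G fj.1 fj.2)) _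
  (Ksum_diagonal mu p0_ge1 p1_ge1 theta_gt0 theta_lt1 qE)) => -[f j] mf.
by split; [exact: mw'|exact: (measurable_coord mG j mf)|exact: w'0|move=> x; exact: coord_ge0].
Qed.

End weighted_interpolation.

Theorem theorem7p5 (R : realType) (d n : nat) (d_gt0 : (0 < d)%N) (n_gt0 : (0 < n)%N)
  (p0 p1 theta q : R) (p0_ge1 : 1 <= p0) (p1_ge1 : 1 <= p1)
  (theta_gt0 : 0 < theta) (theta_lt1 : theta < 1) (q_ge1 : 1 <= q)
  (W0 W1 U D : Rd R d -> 'M[R[i]]_n)
  (W0_weight : matrix_weight (lebesgue_Rd R d) W0)
  (W1_weight : matrix_weight (lebesgue_Rd R d) W1)
  (U_meas : measurable_mxfun U) (D_meas : measurable_mxfun D)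
  (U_unitary : {ae lebesgue_Rd R d, forall x, U x \is unitarymx})
  (D_diag : {ae lebesgue_Rd R d, forall x, is_diag_mx (D x)})
  (UDU : {ae lebesgue_Rd R d, forall x,
           mxabs (W1 x *m invmx (W0 x)) = U x *m D x *m invmx (U x)}) :
  let mu := lebesgue_Rd R d in
  let interp := real_interp mu (weighted (Lp mu n p0) W0)
                               (weighted (Lp mu n p1) W1) theta q in
  (p0 <= p1 ->
     eq_fspace interp
       (weighted (LD mu D p0 p1 q theta) (fun x => invmx (U x) *m W0 x))) /\
  (q^-1 = (1 - theta) / p0 + theta / p1 ->
     eq_fspace interp
       (weighted (Lp mu n q)
          (fun x => mxpowR (mxabs (W1 x *m invmx (W0 x))) theta *m W0 x))).
Proof.
(* The Caratheodory extension is complete; this permits all corrections on null sets. *)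
move=> mu interp; have cmu : measure_is_complete mu by exact: measure_is_complete_caratheodory.
split=> [p01|qE].
  exact: (interp_LD cmu p0_ge1 p1_ge1 theta_gt0 theta_lt1 q_ge1 W0_weight W1_weight U_meas D_meas).
exact: (interp_diagonal cmu p0_ge1 p1_ge1 theta_gt0 theta_lt1 q_ge1 W0_weight W1_weight U_meas D_meas U_unitary D_diag UDU qE).
Qed.
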